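(* Let $\alpha,\beta,\gamma,\nu\in\mathbb{R}$. Suppose that $s>1/2$ and $f\in H^s_+(\mathbb{T})$, $g\in H^s_-(\mathbb{T})$. Then there exists $T=T(\|f\|_s,\|g\|_s)>0$ such that the initial-value problem \begin{align*} &u_\tau = i\partial_x\mathbf{P}\left[\alpha u^*\partial_x^{-1}(u^2)+\beta v\,\partial_x^{-1}(uv^* )\right]-\gamma u-i\nu\,\partial_x^{-2}u,\qquad \mathbf{P}[u]=u,\\ &v_\tau = i\partial_x\mathbf{Q}\left[\alpha v^*\partial_x^{-1}(v^2)+\beta u\,\partial_x^{-1}(u^*v)\right]-\gamma v-i\nu\,\partial_x^{-2}v,\qquad \mathbf{Q}[v]=v,\\ &u(0)=f,\qquad v(0)=g \end{align*} has a unique solution with $$u\in C([-T,T];H^s_+(\mathbb{T})),\qquad v\in C([-T,T];H^s_-(\mathbb{T})).$$ Moreover, this $H^s$-solution breaks down as $\tau\uparrow T_*$, for some $T_*>0$ (that is, the solution exists on $[0,T_* )$ but cannot be continued as an $H^s$-solution beyond $T_*$), only if $$\int_0^\tau\left\{\|u(\sigma)\|_A^2+\|v(\sigma)\|_A^2\right\}d\sigma\uparrow\infty\qquad\text{as }\tau\uparrow T_*.$$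
   Context: Functions are complex-valued and $2\pi$-periodic in $x\in\mathbb{T}=\mathbb{R}/2\pi\mathbb{Z}$, $\tau$ is time, and $^*$ denotes complex conjugation. Let $\mathbb{Z}^*=\mathbb{Z}\setminus\{0\}$. For $s\in\mathbb{R}$, $\dot H^s(\mathbb{T})$ is the space of zero-mean periodic functions (or distributions) $f(x)=\sum_{n\in\mathbb{Z}^*}\hat f(n)e^{inx}$ with $$\|f\|_s=\Big(\sum_{n\in\mathbb{Z}^*}|n|^{2s}|\hat f(n)|^2\Big)^{1/2}<\infty.$$ The Wiener-algebra norm is $\|f\|_A=\sum_{n\in\mathbb{Z}^*}|\hat f(n)|$. The projections onto positive and negative wavenumbers are $$\mathbf{P}[f](x)=\sum_{n=1}^\infty\hat f(n)e^{inx},\qquad \mathbf{Q}[f](x)=\sum_{n=-\infty}^{-1}\hat f(n)e^{inx}.$$ The projected Sobolev spaces are $H^s_+(\mathbb{T})=\{u\in\dot H^s(\mathbb{T}):\mathbf{P}[u]=u\}$ and $H^s_-(\mathbb{T})=\{v\in\dot H^s(\mathbb{T}):\mathbf{Q}[v]=v\}$. The inverse derivative acts on zero-mean functions by $\partial_x^{-1}(e^{inx})=\frac{1}{in}e^{inx}$ for $n\neq0$, and $\partial_x^{-2}=(\partial_x^{-1})^2$. (The functions $u^2$, $uv^*$ have only positive wavenumbers and $v^2$, $u^*v$ only negative wavenumbers, so $\partial_x^{-1}$ is defined on them.) The equations are understood as an ordinary differential equation in $\tau$ for $(u,v)$ with values in $H^s_+(\mathbb{T})\times H^s_-(\mathbb{T})$.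 The coefficients $\alpha,\beta,\gamma,\nu$ are fixed constants. *)

(* Defs.v *)
From Stdlib Require Import Reals ZArith.
From Coquelicot Require Import Coquelicot.

Open Scope R_scope.

(* Functions on the torus R / 2 pi Z are maps R -> C; elements of H^s carry an
   explicit 2 pi-periodicity clause. *)

(** ** Fourier series *)

Definition expi (t : R) : C := (cos t, sin t).

Definition fourier (f : R -> C) (n : Z) : C :=
  (RtoC (/ (2 * PI)) *
   RInt (V := C_R_CompleteNormedModule)
     (fun x => f x * expi (- (IZR n * x)))%C 0 (2 * PI))%C.

Definition wavenumber (k : nat) : Z := Z.of_nat (S k).

(* A sum over Z \ {0} is the series over k of its two terms of index +(k+1) and
   -(k+1): for nonnegative or absolutely convergent families the order of
   summation is irrelevant. *)
Definition paired {G : AbelianMonoid} (a : Z -> G) (k : nat) : G :=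
  plus (a (wavenumber k)) (a (- wavenumber k)%Z).

Definition CSeries (a : nat -> C) : C :=
  (Series (fun k => Re (a k)), Series (fun k => Im (a k))).

Definition mode (f : R -> C) (x : R) (n : Z) : C :=
  (fourier f n * expi (IZR n * x))%C.

Definition projP (f : R -> C) (x : R) : C :=
  CSeries (fun k => mode f x (wavenumber k)).

Definition projQ (f : R -> C) (x : R) : C :=
  CSeries (fun k => mode f x (- wavenumber k)%Z).

(* The antiderivative of a zero-mean function; the zero mode is ignored. *)
Definition dx_inv (f : R -> C) (x : R) : C :=
  CSeries (paired (fun n => / (Ci * RtoC (IZR n)) * mode f x n)%C).

(* Classical derivative, taken on real and imaginary parts.  It is applied below
   only to functions which, for s > 1/2, have coefficients c with
   sum |n| |c n| < oo and hence are of class C^1. *)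
Definition dx (f : R -> C) (x : R) : C :=
  (Derive (fun y => Re (f y)) x, Derive (fun y => Im (f y)) x).

(** ** Function spaces *)

Definition sobolev_term (s : R) (f : R -> C) (n : Z) : R :=
  Rpower (Rabs (IZR n)) (2 * s) * Cmod (fourier f n) ^ 2.

Definition normH (s : R) (f : R -> C) : R :=
  sqrt (Series (paired (sobolev_term s f))).

Definition normA (f : R -> C) : R :=
  Series (paired (fun n => Cmod (fourier f n))).

(* Meant for s > 1/2, where the Fourier series of an H^s distribution converges
   absolutely: the last clause then says that f is the continuous
   representative, so that pointwise equality is equality in H^s. *)
Record Hdot (s : R) (f : R -> C) : Prop := {
  Hdot_periodic : forall x, f (x + 2 * PI) = f x;
  Hdot_zero_mean : fourier f 0 = RtoC 0;
  Hdot_finite : ex_series (paired (sobolev_term s f));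
  Hdot_fourier : forall x,
    is_series (V := C_R_NormedModule) (paired (mode f x)) (f x)
}.

Definition Hplus (s : R) (u : R -> C) : Prop :=
  Hdot s u /\ forall x, projP u x = u x.

Definition Hminus (s : R) (v : R -> C) : Prop :=
  Hdot s v /\ forall x, projQ v x = v x.

(** ** Curves in H^s, parametrized by a time set I *)

Definition continuous_H (s : R) (I : R -> Prop) (u : R -> R -> C) (t : R) : Prop :=
  filterlim (fun r => normH s (fun x => u r x - u t x)%C)
    (within I (locally t)) (locally 0).

(* The limit is taken within I, hence is one-sided at an endpoint of I.  Since
   normH is a total function, w is explicitly required to lie in H^s. *)
Definition is_derive_H (s : R) (I : R -> Prop) (u : R -> R -> C) (t : R)
    (w : R -> C) : Prop :=
  Hdot s w /\
  filterlim
    (fun r => normH s (fun x => (u r x - u t x) / RtoC (r - t) - w x)%C)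
    (within (fun r => I r /\ r <> t) (locally t)) (locally 0).

(** ** The evolution equations *)

Definition rhs_u (alpha beta gamma nu : R) (u v : R -> C) (x : R) : C :=
  (Ci * dx (projP (fun y =>
      alpha * (Cconj (u y) * dx_inv (fun z => u z * u z) y)
      + beta * (v y * dx_inv (fun z => u z * Cconj (v z)) y))) x
   - gamma * u x - Ci * nu * dx_inv (dx_inv u) x)%C.

Definition rhs_v (alpha beta gamma nu : R) (u v : R -> C) (x : R) : C :=
  (Ci * dx (projQ (fun y =>
      alpha * (Cconj (v y) * dx_inv (fun z => v z * v z) y)
      + beta * (u y * dx_inv (fun z => Cconj (u z) * v z) y))) x
   - gamma * v x - Ci * nu * dx_inv (dx_inv v) x)%C.

Record is_solution (alpha beta gamma nu s : R) (f g : R -> C) (I : R -> Prop)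
    (u v : R -> R -> C) : Prop := {
  sol_u_space : forall t, I t -> Hplus s (u t);
  sol_v_space : forall t, I t -> Hminus s (v t);
  sol_u_cont : forall t, I t -> continuous_H s I u t;
  sol_v_cont : forall t, I t -> continuous_H s I v t;
  sol_u_eq : forall t, I t ->
    is_derive_H s I u t (rhs_u alpha beta gamma nu (u t) (v t));
  sol_v_eq : forall t, I t ->
    is_derive_H s I v t (rhs_v alpha beta gamma nu (u t) (v t));
  sol_u_init : forall x, u 0 x = f x;
  sol_v_init : forall x, v 0 x = g x
}.

Definition Icc (a b t : R) : Prop := a <= t <= b.
Definition Ico (a b t : R) : Prop := a <= t < b.

Definition agree_on (I : R -> Prop) (u v u' v' : R -> R -> C) : Prop :=
  forall t, I t -> forall x, u t x = u' t x /\ v t x = v' t x.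

Definition breaks_down (alpha beta gamma nu s : R) (f g : R -> C) (Tstar : R)
    (u v : R -> R -> C) : Prop :=
  is_solution alpha beta gamma nu s f g (Ico 0 Tstar) u v /\
  ~ exists (T' : R) (u' v' : R -> R -> C),
      Tstar < T' /\
      is_solution alpha beta gamma nu s f g (Ico 0 T') u' v' /\
      agree_on (Ico 0 Tstar) u v u' v'.

Definition increases_to_infinity (F : R -> R) (b : R) : Prop :=
  (forall r t, 0 <= r -> r <= t -> t < b -> F r <= F t) /\
  filterlim F (at_left b) (Rbar_locally p_infty).

Definition wiener_density (u v : R -> R -> C) (t : R) : R :=
  normA (u t) ^ 2 + normA (v t) ^ 2.

(* Main.v *)
Require Import Defs.
From Stdlib Require Import Reals Lra Lia ZArith.
From Stdlib Require Import Classical FunctionalExtensionality ProofIrrelevance.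
From Stdlib Require Import PropExtensionality ClassicalEpsilon.
From Coquelicot Require Import Coquelicot.
Open Scope R_scope.

(** Why the theorem is true.  On Fourier coefficients the loss of derivative in the
    nonlinearity disappears: the coefficient of [i d/dx P (u^* d/dx^-1 (u^2))] at the
    wavenumber [n] is a sum over [k] of [n / (n + k)] times the conjugate of [u_k] times the
    coefficient of [u^2] at [n + k], and the quotient is at most 1.  The same holds for the
    other cubic terms, so the right-hand side is a locally Lipschitz map of the Sobolev
    space, and the equation is an ordinary differential equation in a Banach space.

    The basic estimate ([tri_bound]) is tame: since one of the two inner wavenumbers is at
    least half of the output wavenumber, the Sobolev weight falls on one inner factor, and
    the inequalities of Young ([l2_le_convR]) and of Cauchy-Schwarz ([l2_le_correlation])
    let the two other factors be measured in the Wiener norm.  For [s > 1/2] the Wiener norm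
    is dominated by the Sobolev norm ([sob_le_l1]), which gives the Lipschitz bound
    ([flow_field_lipschitz]); kept as it is, the estimate says that the field grows at most
    linearly in the Sobolev norm, at a rate quadratic in the Wiener norms
    ([flow_field_growth]).

    Picard iteration in the complete space of pairs of coefficient sequences then yields a
    solution on a symmetric interval whose length depends on the norm of the data only
    ([ode_exists]), and Gronwall's inequality yields uniqueness ([ode_unique]).  If the
    integral of the squared Wiener norms stays bounded up to [Tstar], Gronwall's inequality
    bounds the Sobolev norm there ([flow_norm_bound]); a restart shortly before [Tstar] with
    the uniform existence time continues the solution ([ode_continue]).

    It remains to identify both formulations.  For [s > 1/2] all Fourier series converge
    absolutely, so products, antiderivatives, projections and the outer derivative are
    computed termwise ([rhs_signed_Syn]), and curves in the function spaces correspond to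
    curves of coefficients with the same derivatives ([is_derive_H_Syn]).  Reflecting the
    negative wavenumbers turns the second equation into the first one with the unknowns
    exchanged, so one computation serves for both. *)


(** * Differential inequalities on an interval *)

(** Consider the supremum of the times up to which [psi r <= psi 0 + e * r] holds.
    Continuity shows that the inequality still holds there, and the Dini condition
    pushes it further unless the supremum is [b]. *)
Lemma dini_nonincreasing (psi : R -> R) (b : R) :
  0 <= b ->
  (forall t, 0 <= t <= b -> forall eps, 0 < eps -> exists del, 0 < del /\
     forall r, 0 <= r <= b -> Rabs (r - t) < del -> Rabs (psi r - psi t) <= eps) ->
  (forall t, 0 <= t < b -> forall eps, 0 < eps -> exists del, 0 < del /\
     forall r, t <= r <= b -> r - t < del -> psi r <= psi t + eps * (r - t)) ->
  psi b <= psi 0.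
Proof.
  intros Hb Hcont Hdini.
  apply Rle_plus_epsilon; intros eps Heps.
  set (e := eps / (b + 1)).
  assert (He : 0 < e) by (apply Rdiv_lt_0_compat; lra).
  assert (Heb : e * b <= eps).
  { unfold e. apply Rmult_le_reg_r with (b + 1); [lra|].
    field_simplify; [nra|lra]. }
  set (S := fun t => 0 <= t <= b /\ forall r, 0 <= r <= t -> psi r <= psi 0 + e * r).
  destruct (completeness S) as [c [Hub Hlub]].
  { exists b. intros t [Ht _]; lra. }
  { exists 0. split; [lra|]. intros r Hr. replace r with 0 by lra. lra. }
  assert (Hc0 : 0 <= c).
  { apply Hub. split; [lra|]. intros r Hr. replace r with 0 by lra. lra. }
  assert (Hcb : c <= b) by (apply Hlub; intros t [Ht _]; lra).
  assert (Hbelow : forall r, 0 <= r < c -> psi r <= psi 0 + e * r).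
  { intros r Hr. apply NNPP; intros Hn.
    assert (c <= r); [|lra]. apply Hlub. intros t [Ht1 Ht2].
    destruct (Rle_dec t r) as [|Hrt]; [assumption|]. exfalso. apply Hn, Ht2. lra. }
  assert (HcS : psi c <= psi 0 + e * c).
  { apply Rle_plus_epsilon; intros eta Heta.
    destruct (Req_dec c 0) as [->|Hne]; [lra|].
    destruct (Hcont c ltac:(lra) eta Heta) as [del [Hdel Hd]].
    set (r := Rmax 0 (c - del / 2)).
    assert (Hr : 0 <= r < c /\ c - r < del).
    { unfold r, Rmax; destruct Rle_dec; lra. }
    generalize (Hd r ltac:(lra)) (Hbelow r ltac:(lra)). intros H1 H2.
    assert (H3 : Rabs (r - c) < del) by (rewrite Rabs_left; lra).
    apply H1 in H3. apply Rabs_le_between in H3.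
    assert (e * r <= e * c) by (apply Rmult_le_compat_l; lra). lra. }
  destruct (Req_dec c b) as [->|Hne]; [lra|].
  exfalso.
  destruct (Hdini c ltac:(lra) e He) as [del [Hdel Hd]].
  set (t := Rmin b (c + del / 2)).
  assert (Ht : c < t <= b /\ t - c < del).
  { unfold t, Rmin; destruct Rle_dec; lra. }
  assert (S t).
  { split; [lra|]. intros r Hr. destruct (Rlt_dec r c) as [|Hrc]; [apply Hbelow; lra|].
    generalize (Hd r ltac:(lra) ltac:(lra)). lra. }
  generalize (Hub t H). lra.
Qed.

(** The function [phi * exp (- A)] satisfies the hypotheses of [dini_nonincreasing].
    Norms of curves have one-sided upper Dini bounds but need not be differentiable,
    which is why the growth rate is not stated with a derivative of [phi]. *)
Lemma dini_gronwall (phi a A : R -> R) (b : R) :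
  0 <= b ->
  (forall t, 0 <= t <= b -> 0 <= phi t) ->
  (forall t, 0 <= t <= b -> is_derive A t (a t)) ->
  (forall t, 0 <= t <= b -> forall eps, 0 < eps -> exists del, 0 < del /\
     forall r, 0 <= r <= b -> Rabs (r - t) < del -> Rabs (phi r - phi t) <= eps) ->
  (forall t, 0 <= t < b -> forall eps, 0 < eps -> exists del, 0 < del /\
     forall r, t <= r <= b -> r - t < del ->
       phi r <= phi t + (r - t) * (a t * phi t + eps)) ->
  phi b <= phi 0 * exp (A b - A 0).
Proof.
  intros Hb Hpos HA Hcont Hdini.
  set (E := fun t => exp (- A t)).
  assert (HE : forall t, 0 <= t <= b -> is_derive E t (- a t * E t)).
  { intros t Ht. unfold E. evar_last.
    - apply (is_derive_comp exp (fun t => - A t)).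
      + apply is_derive_exp.
      + apply (is_derive_opp (V := R_NormedModule)), HA, Ht.
    - unfold scal; simpl; unfold mult, opp; simpl. ring. }
  assert (HE0 : forall t, 0 < E t) by (intros; apply exp_pos).
  assert (HEd : forall t, 0 <= t <= b -> forall eps, 0 < eps -> exists del, 0 < del /\
    forall r, Rabs (r - t) < del ->
      Rabs (E r - E t - (r - t) * (- a t * E t)) <= eps * Rabs (r - t)).
  { intros t Ht eps Heps. destruct (HE t Ht) as [_ H].
    destruct (H t (fun P HP => HP) (mkposreal eps Heps)) as [del Hd].
    exists del. split; [apply cond_pos|]. intros r Hr.
    exact (Hd r Hr). }
  assert (Hmain : phi b * E b <= phi 0 * E 0).
  { apply (dini_nonincreasing (fun t => phi t * E t) b Hb).
    - intros t Ht eps Heps.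
      set (K := Rabs (a t) * E t + 1).
      assert (HK : 0 < K).
      { unfold K. generalize (Rabs_pos (a t)) (HE0 t). intros. nra. }
      destruct (HEd t Ht 1 Rlt_0_1) as [d1 [Hd1 H1]].
      set (e1 := Rmin 1 (eps / 2 / (E t + K))).
      assert (HEK : 0 < E t + K) by (generalize (HE0 t); lra).
      assert (He1 : 0 < e1).
      { unfold e1. apply Rmin_pos; [lra|]. apply Rdiv_lt_0_compat; lra. }
      destruct (Hcont t Ht e1 He1) as [d2 [Hd2 H2]].
      set (d3 := eps / 2 / (K * (phi t + 1))).
      assert (Hphi := Hpos t Ht).
      assert (HKp : 0 < K * (phi t + 1)) by (apply Rmult_lt_0_compat; lra).
      assert (Hd3 : 0 < d3) by (apply Rdiv_lt_0_compat; lra).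
      exists (Rmin (Rmin d1 d2) (Rmin 1 d3)). split.
      { repeat apply Rmin_pos; lra. }
      intros r Hr Hrt.
      assert (Rabs (r - t) < d1 /\ Rabs (r - t) < d2 /\ Rabs (r - t) < 1 /\ Rabs (r - t) < d3).
      { revert Hrt. unfold Rmin. repeat destruct Rle_dec; lra. }
      destruct H as (Ha & Hb' & Hc & Hd).
      specialize (H1 r Ha). specialize (H2 r Hr Hb').
      assert (HEr : Rabs (E r - E t) <= K * Rabs (r - t)).
      { replace (E r - E t) with ((E r - E t - (r - t) * (- a t * E t))
          + (r - t) * (- a t * E t)) by ring.
        eapply Rle_trans; [apply Rabs_triang|].
        rewrite (Rabs_mult (r - t)), (Rabs_mult (- a t)), Rabs_Ropp, (Rabs_pos_eq (E t));
          [|left; apply HE0].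
        unfold K. lra. }
      replace (phi r * E r - phi t * E t)
        with ((phi r - phi t) * E t + phi r * (E r - E t)) by ring.
      eapply Rle_trans; [apply Rabs_triang|].
      rewrite !Rabs_mult, (Rabs_pos_eq (E t)); [|left; apply HE0].
      rewrite (Rabs_pos_eq (phi r)); [|apply Hpos, Hr].
      assert (Hpr : phi r <= phi t + 1).
      { apply Rabs_le_between in H2. assert (e1 <= 1) by apply Rmin_l. lra. }
      assert (T1 : Rabs (phi r - phi t) * E t <= eps / 2).
      { apply Rle_trans with (e1 * (E t + K)).
        - apply Rmult_le_compat; try lra. apply Rabs_pos. left; apply HE0.
        - apply Rle_trans with (eps / 2 / (E t + K) * (E t + K)).
          + apply Rmult_le_compat_r; [lra|apply Rmin_r].
          + right; field; lra. }
      assert (T2 : phi r * Rabs (E r - E t) <= eps / 2).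
      { apply Rle_trans with ((phi t + 1) * (K * d3)).
        - apply Rmult_le_compat; try lra; [apply Hpos, Hr|apply Rabs_pos|].
          eapply Rle_trans; [apply HEr|]. apply Rmult_le_compat_l; lra.
        - right. unfold d3. field. lra. }
      lra.
    - intros t Ht eps Heps.
      assert (Hphi := Hpos t ltac:(lra)).
      assert (HEt := HE0 t).
      set (e1 := Rmin 1 (eps / 3 / E t)).
      assert (He1 : 0 < e1) by (apply Rmin_pos; [lra|apply Rdiv_lt_0_compat; lra]).
      set (e2 := Rmin 1 (eps / 3 / (phi t + 1))).
      assert (He2 : 0 < e2) by (apply Rmin_pos; [lra|apply Rdiv_lt_0_compat; lra]).
      destruct (Hdini t Ht e1 He1) as [d1 [Hd1 H1]].
      destruct (HEd t ltac:(lra) e2 He2) as [d2 [Hd2 H2]].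
      set (Q := Rabs (a t * phi t + e1) * Rabs (- a t * E t + e2) + 1).
      assert (HQ : 0 < Q).
      { unfold Q. generalize (Rabs_pos (a t * phi t + e1)) (Rabs_pos (- a t * E t + e2)).
        intros; nra. }
      set (d3 := eps / 3 / Q).
      assert (Hd3 : 0 < d3) by (apply Rdiv_lt_0_compat; lra).
      exists (Rmin (Rmin d1 d2) d3). split; [repeat apply Rmin_pos; lra|].
      intros r Hr Hrt.
      assert (r - t < d1 /\ r - t < d2 /\ r - t < d3).
      { revert Hrt. unfold Rmin. repeat destruct Rle_dec; lra. }
      destruct H as (Ha & Hb' & Hc).
      set (h := r - t) in *. assert (Hh : 0 <= h) by (unfold h; lra).
      specialize (H1 r Hr Ha).
      assert (Habs : Rabs (r - t) = h) by (apply Rabs_pos_eq; exact Hh).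
      specialize (H2 r ltac:(rewrite Habs; lra)). rewrite Habs in H2.
      apply Rabs_le_between in H2. fold h in H1, H2.
      assert (Hpr := Hpos r ltac:(unfold h in *; lra)).
      (* The product of the two first-order upper bounds: the first-order terms in [a]
         cancel and the quadratic remainder is absorbed by the choice of [d3]. *)
      set (X := phi t + h * (a t * phi t + e1)) in *.
      set (Y := E t + h * (- a t * E t + e2)).
      assert (HY : E r <= Y) by (unfold Y; lra).
      apply Rle_trans with (X * Y).
      { apply Rmult_le_compat; try lra. left; apply HE0. }
      assert (HXY : X * Y = phi t * E t + h * (e1 * E t + phi t * e2)
        + h * (h * ((a t * phi t + e1) * (- a t * E t + e2)))) by (unfold X, Y; ring).
      rewrite HXY.
      assert (B1 : e1 * E t <= eps / 3).
      { apply Rle_trans with (eps / 3 / E t * E t).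
        - apply Rmult_le_compat_r; [lra|apply Rmin_r].
        - right; field; lra. }
      assert (B2 : phi t * e2 <= eps / 3).
      { apply Rle_trans with ((phi t + 1) * (eps / 3 / (phi t + 1))).
        - apply Rmult_le_compat; try lra. apply Rmin_r.
        - right; field; lra. }
      assert (B3 : h * ((a t * phi t + e1) * (- a t * E t + e2)) <= eps / 3).
      { apply Rle_trans with (h * Q).
        - apply Rmult_le_compat_l; [exact Hh|]. unfold Q.
          eapply Rle_trans; [apply Rle_abs|]. rewrite Rabs_mult. lra.
        - apply Rle_trans with (d3 * Q).
          + apply Rmult_le_compat_r; lra.
          + right. unfold d3. field. lra. }
      assert (h * (e1 * E t + phi t * e2
         + h * ((a t * phi t + e1) * (- a t * E t + e2))) <= h * eps).
      { apply Rmult_le_compat_l; [exact Hh|lra]. }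
      lra. }
  unfold E in Hmain.
  replace (exp (A b - A 0)) with (exp (- A 0) / exp (- A b)).
  - apply Rmult_le_reg_r with (exp (- A b)); [apply exp_pos|].
    eapply Rle_trans; [exact Hmain|]. right. field. apply Rgt_not_eq, exp_pos.
  - rewrite !exp_Ropp. unfold Rminus. rewrite exp_plus, exp_Ropp. field.
    split; apply Rgt_not_eq, exp_pos.
Qed.


(** * Ordinary differential equations in normed modules *)

(** The difference quotient is multiplied out, so that [r = t] is no exception; the
    derivative is relative to [I], hence one-sided at an endpoint. *)
Definition has_deriv {X : NormedModule R_AbsRing} (I : R -> Prop) (y : R -> X)
    (t : R) (w : X) : Prop :=
  forall eps, 0 < eps -> exists del, 0 < del /\
    forall r, I r -> Rabs (r - t) < del ->
      norm (minus (minus (y r) (y t)) (scal (r - t) w)) <= eps * Rabs (r - t).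

Definition ode_sol {X : NormedModule R_AbsRing} (F : X -> X) (I : R -> Prop)
    (y : R -> X) : Prop :=
  forall t, I t -> has_deriv I y t (F (y t)).

Lemma norm_minus_sym {X : NormedModule R_AbsRing} (x y : X) :
  norm (minus x y) = norm (minus y x).
Proof. rewrite <- norm_opp, opp_minus. reflexivity. Qed.

Lemma norm_minus_triangle {X : NormedModule R_AbsRing} (z x y : X) :
  norm (minus x y) <= norm (minus x z) + norm (minus z y).
Proof. rewrite (minus_trans z x y). apply norm_triangle. Qed.

Lemma norm_le_minus {X : NormedModule R_AbsRing} (x y : X) :
  norm x <= norm y + norm (minus x y).
Proof.
  generalize (norm_triangle_inv x y). intros H.
  apply Rabs_le_between in H. lra.
Qed.

Lemma norm_scal_le {X : NormedModule R_AbsRing} (l : R) (x : X) :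
  norm (scal l x) <= Rabs l * norm x.
Proof. exact (norm_scal l x). Qed.

Lemma minusE {G : AbelianGroup} (a b : G) : minus a b = plus a (opp b).
Proof. reflexivity. Qed.

Lemma minus_interchange {G : AbelianGroup} (a b c d : G) :
  minus (minus a b) (minus c d) = minus (minus a c) (minus b d).
Proof.
  rewrite !minusE, !opp_plus, !opp_opp.
  rewrite <- !plus_assoc. f_equal. rewrite !plus_assoc. f_equal. apply plus_comm.
Qed.

Lemma has_deriv_minus {X : NormedModule R_AbsRing} (I : R -> Prop)
    (y1 y2 : R -> X) (t : R) (w1 w2 : X) :
  has_deriv I y1 t w1 -> has_deriv I y2 t w2 ->
  has_deriv I (fun r => minus (y1 r) (y2 r)) t (minus w1 w2).
Proof.
  intros H1 H2 eps Heps.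
  destruct (H1 (eps / 2) ltac:(lra)) as [d1 [Hd1 K1]].
  destruct (H2 (eps / 2) ltac:(lra)) as [d2 [Hd2 K2]].
  exists (Rmin d1 d2). split; [apply Rmin_pos; lra|].
  intros r Hr Hrt.
  specialize (K1 r Hr (Rlt_le_trans _ _ _ Hrt (Rmin_l _ _))).
  specialize (K2 r Hr (Rlt_le_trans _ _ _ Hrt (Rmin_r _ _))).
  rewrite (minus_interchange (y1 r)).
  replace (scal (r - t) (minus w1 w2))
    with (minus (scal (r - t) w1) (scal (r - t) w2))
    by (symmetry; apply (scal_minus_distr_l (r - t) w1 w2)).
  rewrite (minus_interchange (minus (y1 r) (y1 t))).
  rewrite (minusE (minus (minus (y1 r) _) _)). eapply Rle_trans; [apply norm_triangle|].
  rewrite norm_opp. lra.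
Qed.

Lemma has_deriv_incl {X : NormedModule R_AbsRing} (I J : R -> Prop)
    (y : R -> X) (t : R) (w : X) :
  (forall r, J r -> I r) -> has_deriv I y t w -> has_deriv J y t w.
Proof.
  intros HJ H eps Heps. destruct (H eps Heps) as [d [Hd K]].
  exists d. split; [exact Hd|]. intros r Hr. apply K, HJ, Hr.
Qed.

Lemma ode_sol_incl {X : NormedModule R_AbsRing} (F : X -> X) (I J : R -> Prop)
    (y : R -> X) :
  (forall r, J r -> I r) -> ode_sol F I y -> ode_sol F J y.
Proof.
  intros HJ H t Ht. apply has_deriv_incl with I; [exact HJ|]. apply H, HJ, Ht.
Qed.

(** Locality of the derivative, by which two solutions are glued. *)
Lemma has_deriv_local {X : NormedModule R_AbsRing} (I J : R -> Prop)
    (y z : R -> X) (t d0 : R) (w : X) :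
  0 < d0 ->
  (forall r, J r -> Rabs (r - t) < d0 -> I r /\ z r = y r) ->
  z t = y t -> has_deriv I y t w -> has_deriv J z t w.
Proof.
  intros Hd0 Hloc Ht H eps Heps. destruct (H eps Heps) as [d [Hd K]].
  exists (Rmin d0 d). split; [apply Rmin_pos; lra|].
  intros r Hr Hrt.
  destruct (Hloc r Hr (Rlt_le_trans _ _ _ Hrt (Rmin_l _ _))) as [HI Hz].
  rewrite Hz, Ht. apply K; [exact HI|].
  exact (Rlt_le_trans _ _ _ Hrt (Rmin_r _ _)).
Qed.

Lemma has_deriv_shift {X : NormedModule R_AbsRing} (I : R -> Prop)
    (y : R -> X) (c t : R) (w : X) :
  has_deriv I y (t + c) w ->
  has_deriv (fun r => I (r + c)) (fun r => y (r + c)) t w.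
Proof.
  intros H eps Heps. destruct (H eps Heps) as [d [Hd K]].
  exists d. split; [exact Hd|]. intros r Hr Hrt.
  specialize (K (r + c) Hr). replace (r + c - (t + c)) with (r - t) in K by ring.
  apply K, Hrt.
Qed.

Lemma has_deriv_reverse {X : NormedModule R_AbsRing} (I : R -> Prop)
    (y : R -> X) (t : R) (w : X) :
  has_deriv I y (- t) w ->
  has_deriv (fun r => I (- r)) (fun r => y (- r)) t (opp w).
Proof.
  intros H eps Heps. destruct (H eps Heps) as [d [Hd K]].
  exists d. split; [exact Hd|]. intros r Hr Hrt.
  specialize (K (- r) Hr). replace (- r - - t) with (- (r - t)) in K by ring.
  rewrite Rabs_Ropp in K. specialize (K Hrt).
  replace (scal (r - t) (opp w)) with (scal (- (r - t)) w); [exact K|].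
  exact (eq_trans (scal_opp_l (r - t) w) (eq_sym (scal_opp_r (r - t) w))).
Qed.

Lemma has_deriv_cont {X : NormedModule R_AbsRing} (I : R -> Prop)
    (y : R -> X) (t : R) (w : X) :
  has_deriv I y t w ->
  forall eps, 0 < eps -> exists del, 0 < del /\
    forall r, I r -> Rabs (r - t) < del -> norm (minus (y r) (y t)) <= eps.
Proof.
  intros H eps Heps. destruct (H 1 Rlt_0_1) as [d [Hd K]].
  assert (Hw := norm_ge_0 w).
  assert (He : 0 < eps / (1 + norm w)) by (apply Rdiv_lt_0_compat; lra).
  exists (Rmin d (eps / (1 + norm w))). split; [apply Rmin_pos; lra|].
  intros r Hr Hrt.
  specialize (K r Hr (Rlt_le_trans _ _ _ Hrt (Rmin_l _ _))).
  assert (H1 := Rlt_le_trans _ _ _ Hrt (Rmin_r _ _)).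
  eapply Rle_trans; [apply (norm_le_minus _ (scal (r - t) w))|].
  generalize (norm_scal_le (r - t) w). intros H2.
  apply Rle_trans with (Rabs (r - t) * (1 + norm w)); [lra|].
  apply Rle_trans with (eps / (1 + norm w) * (1 + norm w)).
  - apply Rmult_le_compat_r; lra.
  - right. field. lra.
Qed.

(** The triangle inequality turns the derivative of [y] into an upper Dini bound for
    its norm, so any normed module is allowed. *)
Lemma norm_gronwall {X : NormedModule R_AbsRing} (y w : R -> X) (a A : R -> R) (b : R) :
  0 <= b ->
  (forall t, 0 <= t <= b -> is_derive A t (a t)) ->
  (forall t, 0 <= t <= b -> has_deriv (fun r => 0 <= r <= b) y t (w t)) ->
  (forall t, 0 <= t <= b -> norm (w t) <= a t * norm (y t)) ->
  norm (y b) <= norm (y 0) * exp (A b - A 0).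
Proof.
  intros Hb HA Hd Hw.
  apply (dini_gronwall (fun t => norm (y t)) a A b Hb).
  - intros; apply norm_ge_0.
  - exact HA.
  - intros t Ht eps Heps.
    destruct (has_deriv_cont _ _ _ _ (Hd t Ht) eps Heps) as [d [Hd' K]].
    exists d. split; [exact Hd'|]. intros r Hr Hrt.
    eapply Rle_trans; [apply norm_triangle_inv|]. apply K; assumption.
  - intros t Ht eps Heps.
    destruct (Hd t ltac:(lra) eps Heps) as [d [Hd' K]].
    exists d. split; [exact Hd'|]. intros r Hr Hrt.
    assert (Habs : Rabs (r - t) = r - t) by (apply Rabs_pos_eq; lra).
    specialize (K r ltac:(lra) ltac:(lra)). rewrite Habs in K.
    generalize (norm_le_minus (minus (y r) (y t)) (scal (r - t) (w t)))
      (norm_le_minus (y r) (y t)) (norm_scal_le (r - t) (w t)) (Hw t ltac:(lra)).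
    rewrite Habs. intros H1 H2 H3 H4.
    assert ((r - t) * norm (w t) <= (r - t) * (a t * norm (y t)))
      by (apply Rmult_le_compat_l; lra).
    lra.
Qed.

Definition clamp (a b t : R) : R := Rmax a (Rmin b t).

Lemma clamp_in a b t : a <= b -> a <= clamp a b t <= b.
Proof. intros. unfold clamp, Rmax, Rmin; repeat destruct Rle_dec; lra. Qed.

Lemma clamp_id a b t : a <= t <= b -> clamp a b t = t.
Proof. intros. unfold clamp, Rmax, Rmin; repeat destruct Rle_dec; lra. Qed.

Lemma clamp_lip a b r t : a <= b -> Rabs (clamp a b r - clamp a b t) <= Rabs (r - t).
Proof.
  intros. unfold clamp, Rmax, Rmin, Rabs;
    repeat destruct Rle_dec; repeat destruct Rcase_abs; lra.
Qed.

(** Precomposing with the retraction [clamp] turns continuity relative to a segment,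
    one-sided at its endpoints, into continuity on the whole line. *)
Lemma continuous_clamp (f : R -> R) (a b : R) :
  a <= b ->
  (forall t, a <= t <= b -> forall eps, 0 < eps -> exists del, 0 < del /\
     forall r, a <= r <= b -> Rabs (r - t) < del -> Rabs (f r - f t) <= eps) ->
  forall t, continuous (fun r => f (clamp a b r)) t.
Proof.
  intros Hab H t. apply filterlim_locally. intros eps.
  destruct (H (clamp a b t) (clamp_in a b t Hab) (eps / 2)) as [d [Hd K]].
  { generalize (cond_pos eps); lra. }
  exists (mkposreal d Hd). intros r Hr.
  apply Rle_lt_trans with (eps / 2); [|generalize (cond_pos eps); lra].
  apply (K (clamp a b r) (clamp_in a b r Hab)).
  eapply Rle_lt_trans; [apply clamp_lip, Hab|exact Hr].
Qed.

Lemma ode_sol_bounded {X : NormedModule R_AbsRing} (F : X -> X) (y : R -> X) (b : R) :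
  0 <= b -> ode_sol F (fun t => 0 <= t <= b) y ->
  exists M, forall t, 0 <= t <= b -> norm (y t) <= M.
Proof.
  intros Hb Hy.
  destruct (continuity_ab_maj (fun t => norm (y (clamp 0 b t))) 0 b Hb) as [m [Hm _]].
  - intros c _. apply continuity_pt_filterlim.
    apply (continuous_clamp (fun t => norm (y t)) 0 b Hb).
    intros t Ht eps Heps.
    destruct (has_deriv_cont _ _ _ _ (Hy t Ht) eps Heps) as [d [Hd K]].
    exists d. split; [exact Hd|]. intros r Hr Hrt.
    eapply Rle_trans; [apply norm_triangle_inv|]. apply K; assumption.
  - exists (norm (y (clamp 0 b m))). intros t Ht.
    generalize (Hm t Ht). rewrite (clamp_id 0 b t Ht). tauto.
Qed.

Definition loc_lipschitz {X : NormedModule R_AbsRing} (F : X -> X) (L : R -> R) : Prop :=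
  forall M x y, norm x <= M -> norm y <= M ->
    norm (minus (F x) (F y)) <= L M * norm (minus x y).

Lemma loc_lipschitz_norm {X : NormedModule R_AbsRing} (F : X -> X) (L : R -> R) (M : R) (x : X) :
  loc_lipschitz F L -> F zero = zero -> norm x <= M -> norm (F x) <= L M * norm x.
Proof.
  intros HF H0 Hx.
  assert (Hm0 : forall z : X, minus z zero = z).
  { intros z. rewrite minusE, opp_zero. apply plus_zero_r. }
  assert (Hz : norm (zero : X) <= M).
  { eapply Rle_trans; [right; apply norm_zero|]. eapply Rle_trans; [|exact Hx]. apply norm_ge_0. }
  generalize (HF M x zero Hx Hz). rewrite H0, !Hm0. tauto.
Qed.

(** The difference of two solutions starts at 0 and, both being bounded on the segment,
    grows at most at a constant exponential rate. *)
Lemma ode_unique_fwd {X : NormedModule R_AbsRing} (F : X -> X) (L : R -> R)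
    (y z : R -> X) (b : R) :
  loc_lipschitz F L -> 0 <= b ->
  ode_sol F (fun t => 0 <= t <= b) y -> ode_sol F (fun t => 0 <= t <= b) z ->
  y 0 = z 0 -> y b = z b.
Proof.
  intros HF Hb Hy Hz H0.
  destruct (ode_sol_bounded F y b Hb Hy) as [M1 HM1].
  destruct (ode_sol_bounded F z b Hb Hz) as [M2 HM2].
  set (M := Rmax M1 M2).
  assert (H : norm (minus (y b) (z b)) <= norm (minus (y 0) (z 0))
      * exp (L M * b - L M * 0)).
  { apply (norm_gronwall (fun t => minus (y t) (z t))
      (fun t => minus (F (y t)) (F (z t))) (fun _ => L M) (fun t => L M * t) b Hb).
    - intros t Ht. auto_derive; [easy|ring].
    - intros t Ht. apply has_deriv_minus; [apply Hy|apply Hz]; exact Ht.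
    - intros t Ht. apply HF.
      + eapply Rle_trans; [apply HM1, Ht|apply Rmax_l].
      + eapply Rle_trans; [apply HM2, Ht|apply Rmax_r]. }
  assert (Hz0 : norm (minus (z 0) (z 0)) = 0) by (rewrite minus_eq_zero; apply norm_zero).
  rewrite H0, Hz0, Rmult_0_l in H.
  apply NNPP; intros Hne. generalize (norm_minus_gt_0 _ _ Hne). lra.
Qed.

Lemma ode_sol_shift {X : NormedModule R_AbsRing} (F : X -> X) (I : R -> Prop)
    (y : R -> X) (c : R) :
  ode_sol F I y -> ode_sol F (fun t => I (t + c)) (fun t => y (t + c)).
Proof. intros H t Ht. apply has_deriv_shift, H, Ht. Qed.

Lemma ode_sol_reverse {X : NormedModule R_AbsRing} (F : X -> X) (I : R -> Prop)
    (y : R -> X) :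
  ode_sol F I y -> ode_sol (fun x => opp (F x)) (fun t => I (- t)) (fun t => y (- t)).
Proof. intros H t Ht. apply has_deriv_reverse, H, Ht. Qed.

(** Negative times are reached by reversing time, which replaces [F] by its opposite. *)
Lemma ode_unique {X : NormedModule R_AbsRing} (F : X -> X) (L : R -> R)
    (y z : R -> X) (I : R -> Prop) :
  loc_lipschitz F L ->
  (forall t r, I t -> (0 <= r <= t \/ t <= r <= 0) -> I r) ->
  ode_sol F I y -> ode_sol F I z -> y 0 = z 0 -> forall t, I t -> y t = z t.
Proof.
  intros HF HI Hy Hz H0 t Ht.
  destruct (Rle_dec 0 t) as [Hpos|Hneg].
  - apply (ode_unique_fwd F L y z t HF Hpos); [| |exact H0];
      apply ode_sol_incl with I; try assumption; intros r Hr; apply (HI t); tauto.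
  - replace t with (- - t) by ring.
    apply (ode_unique_fwd (fun x => opp (F x)) L (fun r => y (- r)) (fun r => z (- r))).
    + intros M x x' Hx Hx'. generalize (HF M x x' Hx Hx').
      replace (minus (opp (F x)) (opp (F x'))) with (opp (minus (F x) (F x'))).
      { rewrite norm_opp; tauto. }
      rewrite !minusE. apply opp_plus.
    + lra.
    + apply ode_sol_incl with (fun r => I (- r)); [|apply ode_sol_reverse, Hy].
      intros r Hr. apply (HI t); [exact Ht|right; lra].
    + apply ode_sol_incl with (fun r => I (- r)); [|apply ode_sol_reverse, Hz].
      intros r Hr. apply (HI t); [exact Ht|right; lra].
    + rewrite Ropp_0. exact H0.
Qed.


(** * Picard iteration and continuation *)

Lemma minus_plus_l {G : AbelianGroup} (a b : G) : minus (plus a b) a = b.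
Proof.
  rewrite minusE, (plus_comm a b), <- plus_assoc, plus_opp_r. apply plus_zero_r.
Qed.

Lemma minus_plus_plus {G : AbelianGroup} (a b c : G) :
  minus (plus a b) (plus a c) = minus b c.
Proof.
  rewrite !minusE, opp_plus, (plus_comm a b), <- plus_assoc. f_equal.
  rewrite plus_assoc, plus_opp_r. apply plus_zero_l.
Qed.

Section Picard.

Context {X : CompleteNormedModule R_AbsRing}.
Variables (F : X -> X) (x0 : X) (B K l T : R).
Hypothesis HB : 0 <= B.
Hypothesis HK : 0 <= K.
Hypothesis Hl : 0 < l.
Hypothesis HT : 0 <= T.
Hypothesis HTK : T * K <= B.
Hypothesis HTl : T * l <= 1 / 2.
Hypothesis F_bound : forall x : X, norm (minus x x0) <= B -> norm (F x) <= K.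
Hypothesis F_lip : forall x y : X, norm (minus x x0) <= B -> norm (minus y x0) <= B ->
  norm (minus (F x) (F y)) <= l * norm (minus x y).

(** The set on which the Picard map contracts.  The Lipschitz clause makes [F (z r)]
    continuous in [r], hence integrable, and is preserved by uniform limits. *)
Definition admissible (z : R -> X) : Prop :=
  (forall t, norm (minus (z t) x0) <= B) /\
  (forall r t, norm (minus (z r) (z t)) <= K * Rabs (r - t)).

(** Clamping the upper limit of integration makes the iterates functions on the whole
    line, so that they live in a complete space of functions. *)
Definition picard_map (z : R -> X) (t : R) : X :=
  plus x0 (RInt (fun r => F (z r)) 0 (clamp (- T) T t)).

Lemma picard_triangle (z x y : X) :
  norm (minus x y) <= norm (minus x z) + norm (minus z y).
Proof. exact (norm_minus_triangle (X := X) z x y). Qed.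

Lemma picard_sym (x y : X) : norm (minus x y) = norm (minus y x).
Proof. exact (norm_minus_sym (X := X) x y). Qed.

Lemma picard_minus_l (a b : X) : minus (plus a b) a = b.
Proof. exact (minus_plus_l (G := CompleteNormedModule.AbelianGroup R_AbsRing X) a b). Qed.

Lemma picard_minus_plus (a b c : X) : minus (plus a b) (plus a c) = minus b c.
Proof. exact (minus_plus_plus (G := CompleteNormedModule.AbelianGroup R_AbsRing X) a b c). Qed.

Lemma admissible_continuous z : admissible z -> forall t, continuous (fun r => F (z r)) t.
Proof.
  intros [Hz1 Hz2] t. apply filterlim_locally. intros eps.
  assert (He : 0 < eps / (l * K + 1)).
  { apply Rdiv_lt_0_compat; [apply cond_pos|nra]. }
  exists (mkposreal _ He). intros r Hr. apply (norm_compat1 (V := X)).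
  assert (Hr' : Rabs (r - t) < eps / (l * K + 1)) by exact Hr.
  eapply Rle_lt_trans; [apply F_lip; apply Hz1|].
  apply Rle_lt_trans with (l * (K * Rabs (r - t))).
  { apply Rmult_le_compat_l; [lra|apply Hz2]. }
  apply Rle_lt_trans with ((l * K + 1) * Rabs (r - t)).
  { generalize (Rabs_pos (r - t)). nra. }
  apply Rlt_le_trans with ((l * K + 1) * (eps / (l * K + 1))).
  - apply Rmult_lt_compat_l; [nra|exact Hr'].
  - right. field. nra.
Qed.

Lemma admissible_int z a b : admissible z -> is_RInt (fun r => F (z r)) a b (RInt (fun r => F (z r)) a b).
Proof.
  intros Hz. apply RInt_correct. apply ex_RInt_continuous.
  intros t _. apply admissible_continuous, Hz.
Qed.

Lemma admissible_int_diff z a b : admissible z ->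
  minus (RInt (fun r => F (z r)) 0 b) (RInt (fun r => F (z r)) 0 a)
  = RInt (fun r => F (z r)) a b.
Proof.
  intros Hz. rewrite <- (RInt_Chasles (fun r => F (z r)) 0 a b).
  - apply picard_minus_l.
  - eexists; apply admissible_int, Hz.
  - eexists; apply admissible_int, Hz.
Qed.

Lemma admissible_int_le z a b : admissible z ->
  norm (RInt (fun r => F (z r)) a b) <= Rabs (b - a) * K.
Proof.
  intros Hz. apply (norm_RInt_le_const_abs (fun r => F (z r)) a b).
  - intros x _. apply F_bound, Hz.
  - apply admissible_int, Hz.
Qed.

Lemma clamp_abs t : Rabs (clamp (- T) T t) <= T.
Proof. apply Rabs_le. generalize (clamp_in (- T) T t). lra. Qed.

Lemma picard_admissible z : admissible z -> admissible (picard_map z).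
Proof.
  intros Hz. split.
  - intros t. unfold picard_map. rewrite picard_minus_l.
    eapply Rle_trans; [apply admissible_int_le, Hz|].
    rewrite Rminus_0_r. generalize (clamp_abs t). intros.
    apply Rle_trans with (T * K); [apply Rmult_le_compat_r|]; assumption.
  - intros r t. unfold picard_map. rewrite picard_minus_plus, admissible_int_diff by exact Hz.
    eapply Rle_trans; [apply admissible_int_le, Hz|].
    rewrite Rmult_comm. apply Rmult_le_compat_l; [exact HK|]. apply clamp_lip. lra.
Qed.

Lemma picard_contracts z z' d : admissible z -> admissible z' ->
  (forall t, norm (minus (z t) (z' t)) <= d) ->
  forall t, norm (minus (picard_map z t) (picard_map z' t)) <= d / 2.
Proof.
  intros Hz Hz' Hd t. unfold picard_map. rewrite picard_minus_plus.
  set (c := clamp (- T) T t).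
  assert (Hi := is_RInt_minus _ _ _ _ _ _ (admissible_int z 0 c Hz) (admissible_int z' 0 c Hz')).
  assert (Hn := norm_RInt_le_const_abs _ _ _ _ (l * d) (fun x _ => Rle_trans _ _ _
    (F_lip _ _ (proj1 Hz x) (proj1 Hz' x))
    (Rmult_le_compat_l l _ _ (Rlt_le _ _ Hl) (Hd x))) Hi).
  eapply Rle_trans; [exact Hn|]. rewrite Rminus_0_r.
  assert (Hd0 : 0 <= d) by (eapply Rle_trans; [|apply (Hd 0)]; apply norm_ge_0).
  apply Rle_trans with (T * (l * d)).
  - apply Rmult_le_compat_r; [nra|apply clamp_abs].
  - nra.
Qed.

Fixpoint picard_iter (n : nat) : R -> X :=
  match n with
  | O => fun _ => x0
  | S n => picard_map (picard_iter n)
  end.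

Lemma norm_minus_self (x : X) : norm (minus x x) = 0.
Proof. rewrite minus_eq_zero. exact (norm_zero (V := X)). Qed.

Lemma picard_iter_admissible n : admissible (picard_iter n).
Proof.
  induction n as [|n IH]; [|apply picard_admissible, IH].
  split; intros; cbn [picard_iter]; rewrite norm_minus_self; [exact HB|].
  apply Rmult_le_pos; [exact HK|apply Rabs_pos].
Qed.

Lemma picard_iter_step n t :
  norm (minus (picard_iter (S n) t) (picard_iter n t)) <= B * (1 / 2) ^ n.
Proof.
  revert t. induction n as [|n IH]; intros t.
  - simpl pow. rewrite Rmult_1_r. apply (picard_iter_admissible 1).
  - replace (B * (1 / 2) ^ S n) with (B * (1 / 2) ^ n / 2) by (simpl; field).
    apply (picard_contracts (picard_iter (S n)) (picard_iter n));
      [apply picard_iter_admissible|apply picard_iter_admissible|exact IH].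
Qed.

Lemma picard_iter_tail n k t :
  norm (minus (picard_iter (n + k) t) (picard_iter n t))
  <= 2 * B * (1 / 2) ^ n * (1 - (1 / 2) ^ k).
Proof.
  induction k as [|k IH].
  - rewrite Nat.add_0_r, norm_minus_self. simpl. lra.
  - rewrite Nat.add_succ_r.
    eapply Rle_trans; [apply (picard_triangle (picard_iter (n + k) t))|].
    assert (Hs := picard_iter_step (n + k) t). rewrite pow_add in Hs.
    eapply Rle_trans; [exact (Rplus_le_compat _ _ _ _ Hs IH)|].
    right. rewrite <- tech_pow_Rmult. field.
Qed.

Lemma half_pow_pos n : 0 < (1 / 2) ^ n.
Proof. apply pow_lt. lra. Qed.

Lemma half_pow_small (eps : R) : 0 < eps -> exists N, 2 * B * (1 / 2) ^ N <= eps.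
Proof.
  intros He.
  destruct (pow_lt_1_zero (1 / 2) ltac:(rewrite Rabs_pos_eq; lra) (eps / (2 * B + 1))) as [N HN].
  { apply Rdiv_lt_0_compat; lra. }
  exists N. specialize (HN N (Nat.le_refl N)).
  rewrite Rabs_pos_eq in HN; [|left; apply half_pow_pos].
  apply Rle_trans with ((2 * B + 1) * (eps / (2 * B + 1))).
  - apply Rmult_le_compat; try lra. left; apply half_pow_pos.
  - right. field. lra.
Qed.

(** Completeness of the target passes to functions with uniform convergence, so the
    limit curve is obtained at once, without choosing limits pointwise. *)
Lemma picard_limit : exists y : R -> X, forall eps, 0 < eps ->
  exists N, forall n, (N <= n)%nat -> forall t, norm (minus (picard_iter n t) (y t)) <= eps.
Proof.
  destruct (proj1 (filterlim_locally_cauchy (U := @fct_CompleteSpace R X) (F := eventually)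
    (picard_iter))) as [y Hy].
  - intros eps. destruct (half_pow_small (eps / 4)) as [N HN].
    { generalize (cond_pos eps); lra. }
    exists (fun n => (N <= n)%nat). split; [exists N; tauto|].
    intros m n Hm Hn t. apply (norm_compat1 (V := X)).
    assert (Htail : forall m, (N <= m)%nat ->
      norm (minus (picard_iter m t) (picard_iter N t)) <= eps / 4).
    { intros p Hp. replace p with (N + (p - N))%nat by lia.
      eapply Rle_trans; [apply picard_iter_tail|].
      generalize (Rmult_le_pos _ _ HB (Rmult_le_pos _ _ (Rlt_le _ _ (half_pow_pos (p - N)))
        (Rlt_le _ _ (half_pow_pos N)))). nra. }
    eapply Rle_lt_trans; [apply (picard_triangle (picard_iter N t))|].
    rewrite (picard_sym (picard_iter N t)).
    generalize (Htail m Hm) (Htail n Hn) (cond_pos eps). lra.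
  - exists y. intros eps Heps.
    assert (Hf : 0 < @norm_factor _ X) by apply norm_factor_gt_0.
    assert (He : 0 < eps / @norm_factor _ X) by (apply Rdiv_lt_0_compat; lra).
    destruct (proj1 (filterlim_locally _ _) Hy (mkposreal _ He)) as [N HN].
    exists N. intros n Hn t. left.
    specialize (HN n Hn t). apply (norm_compat2 (V := X)) in HN. cbn [pos] in HN.
    replace (norm_factor * (eps / norm_factor)) with eps in HN by (field; lra). exact HN.
Qed.

Lemma picard_fixpoint : exists y, admissible y /\ forall t, y t = picard_map y t.
Proof.
  destruct picard_limit as [y Hy]. exists y.
  assert (Hadm : admissible y).
  { split.
    - intros t. apply Rle_plus_epsilon; intros eps Heps.
      destruct (Hy eps Heps) as [N HN].
      eapply Rle_trans; [apply (picard_triangle (picard_iter N t))|].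
      rewrite picard_sym.
      generalize (HN N (Nat.le_refl N) t) (proj1 (picard_iter_admissible N) t). lra.
    - intros r t. apply Rle_plus_epsilon; intros eps Heps.
      destruct (Hy (eps / 2) ltac:(lra)) as [N HN].
      eapply Rle_trans; [apply (picard_triangle (picard_iter N r))|].
      assert (H := picard_triangle (picard_iter N t) (picard_iter N r) (y t)).
      rewrite (picard_sym (y r)).
      generalize (HN N (Nat.le_refl N) t) (HN N (Nat.le_refl N) r)
        (proj2 (picard_iter_admissible N) r t). lra. }
  split; [exact Hadm|]. intros t.
  apply NNPP; intros Hne.
  assert (Hd : 0 < norm (minus (y t) (picard_map y t)))
    by exact (norm_minus_gt_0 (V := X) _ _ Hne).
  set (d := norm (minus (y t) (picard_map y t))) in *.
  destruct (Hy (d / 2) ltac:(lra)) as [N HN].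
  assert (H1 := picard_contracts _ _ (d / 2) (picard_iter_admissible N) Hadm
    (HN N (Nat.le_refl N)) t).
  assert (H2 := HN (S N) (Nat.le_succ_diag_r N) t).
  assert (H3 := picard_triangle (picard_iter (S N) t) (y t) (picard_map y t)).
  rewrite (picard_sym (y t) (picard_iter (S N) t)) in H3. fold d in H3.
  change (picard_map (picard_iter N) t) with (picard_iter (S N) t) in H1. lra.
Qed.

(** The fixed point is differentiable because the increment minus its linear part is the
    integral of [F (y q) - F (y t)], which is of second order by the Lipschitz bounds. *)
Lemma picard_solution : exists y, y 0 = x0 /\ ode_sol F (Icc (- T) T) y.
Proof.
  destruct picard_fixpoint as [y [Hadm Hfix]]. exists y. split.
  - rewrite Hfix. unfold picard_map. rewrite clamp_id by lra.
    rewrite RInt_point. apply plus_zero_r.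
  - intros t Ht eps Heps.
    assert (Hd : 0 < eps / (l * K + 1)) by (apply Rdiv_lt_0_compat; nra).
    exists (eps / (l * K + 1)). split; [exact Hd|]. intros r Hr Hrt.
    rewrite (Hfix r), (Hfix t) at 1. unfold picard_map.
    rewrite picard_minus_plus, !clamp_id by assumption.
    rewrite admissible_int_diff by exact Hadm.
    assert (Hi := is_RInt_minus _ _ _ _ _ _ (admissible_int y t r Hadm)
      (is_RInt_const t r (F (y t)))).
    rewrite (Rmult_comm eps).
    apply (norm_RInt_le_const_abs _ _ _ _ eps) in Hi; [exact Hi|].
    intros q Hq.
    assert (Hqt : Rabs (q - t) <= Rabs (r - t)).
    { revert Hq. unfold Rmin, Rmax, Rabs. repeat destruct Rle_dec; repeat destruct Rcase_abs; lra. }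
    eapply Rle_trans; [apply F_lip; apply Hadm|].
    apply Rle_trans with (l * (K * Rabs (q - t))).
    { apply Rmult_le_compat_l; [lra|apply Hadm]. }
    apply Rle_trans with ((l * K + 1) * (eps / (l * K + 1))).
    + generalize (Rabs_pos (q - t)). intros.
      assert (Rabs (q - t) <= eps / (l * K + 1)) by lra.
      apply Rle_trans with ((l * K + 1) * Rabs (q - t)); [nra|].
      apply Rmult_le_compat_l; nra.
    + right. field. nra.
Qed.

End Picard.

(** The Picard existence time for data of norm at most [M]: the iterates stay in the
    ball of radius [M + 1], where [F] is bounded by [(|L| + 1) (M + 1)], and they move
    by at most 1/2 within this time. *)
Definition ode_time (L : R -> R) (M : R) : R :=
  / (2 * ((Rabs (L (M + 1)) + 1) * (M + 1))).

Lemma ode_time_pos L M : 0 <= M -> 0 < ode_time L M.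
Proof.
  intros HM. apply Rinv_0_lt_compat. generalize (Rabs_pos (L (M + 1))). intros.
  apply Rmult_lt_0_compat; [lra|]. apply Rmult_lt_0_compat; lra.
Qed.

Lemma ode_exists {X : CompleteNormedModule R_AbsRing} (F : X -> X) (L : R -> R) (M : R) (x0 : X) :
  loc_lipschitz F L -> F zero = zero -> norm x0 <= M ->
  exists y, y 0 = x0 /\ ode_sol F (Icc (- ode_time L M) (ode_time L M)) y.
Proof.
  intros HF H0 HM.
  assert (HM0 : 0 <= M) by (eapply Rle_trans; [|exact HM]; apply norm_ge_0).
  set (l := Rabs (L (M + 1)) + 1).
  assert (Hl : 1 <= l) by (unfold l; generalize (Rabs_pos (L (M + 1))); lra).
  assert (HLl : L (M + 1) <= l) by (unfold l; generalize (Rle_abs (L (M + 1))); lra).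
  assert (Hball : forall x, norm (minus x x0) <= 1 -> norm x <= M + 1).
  { intros x Hx.
    apply Rle_trans with (1 := norm_le_minus (X := X) x x0), (Rplus_le_compat _ _ _ _ HM Hx). }
  assert (Hlip : forall x y, norm x <= M + 1 -> norm y <= M + 1 ->
    norm (minus (F x) (F y)) <= l * norm (minus x y)).
  { intros x y Hx Hy. eapply Rle_trans; [apply HF; eassumption|].
    apply Rmult_le_compat_r; [apply norm_ge_0|exact HLl]. }
  apply (picard_solution F x0 1 (l * (M + 1)) l (ode_time L M)); try nra.
  - left. apply ode_time_pos, HM0.
  - unfold ode_time. fold l. apply Rle_trans with (1 / 2); [right; field|]; nra.
  - unfold ode_time. fold l.
    apply Rle_trans with (/ (2 * (M + 1))).
    + right. field. split; nra.
    + unfold Rdiv. rewrite Rmult_1_l. apply Rinv_le_contravar; lra.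
  - intros x Hx. apply Hball in Hx.
    eapply Rle_trans; [apply (loc_lipschitz_norm F L (M + 1) x HF H0 Hx)|].
    apply Rle_trans with (l * norm x).
    + apply Rmult_le_compat_r; [apply norm_ge_0|exact HLl].
    + apply Rmult_le_compat_l; [lra|exact Hx].
  - intros x y Hx Hy. apply Hlip; apply Hball; assumption.
Qed.

(** The existence time depends on [M] only, so a restart less than one existence time
    before the end [b] reaches past it; uniqueness glues the two pieces. *)
Lemma ode_continue {X : CompleteNormedModule R_AbsRing} (F : X -> X) (L : R -> R) (M b : R)
    (y : R -> X) :
  loc_lipschitz F L -> F zero = zero -> 0 < b -> 0 <= M ->
  ode_sol F (Ico 0 b) y -> (forall t, Ico 0 b t -> norm (y t) <= M) ->
  exists b' z, b < b' /\ ode_sol F (Ico 0 b') z /\ forall t, Ico 0 b t -> z t = y t.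
Proof.
  intros HF H0 Hb HM Hy HyM.
  set (T := ode_time L M). assert (HT : 0 < T) by (apply ode_time_pos, HM).
  set (t0 := Rmax 0 (b - T / 2)).
  assert (Ht0 : 0 <= t0 < b /\ b < t0 + T) by (unfold t0, Rmax; destruct Rle_dec; lra).
  destruct (ode_exists F L M (y t0) HF H0) as [w [Hw0 Hw]].
  { apply HyM. unfold Ico; lra. }
  fold T in Hw.
  assert (Hagree : forall t, t0 <= t < b -> w (t - t0) = y t).
  { intros t Ht.
    replace (y t) with (y (t - t0 + t0)) by (f_equal; ring).
    apply (ode_unique F L w (fun r => y (r + t0)) (fun r => 0 <= r < b - t0)); try lra.
    - exact HF.
    - intros p q Hp Hq. lra.
    - apply ode_sol_incl with (Icc (- T) T); [|exact Hw]. unfold Icc; intros; lra.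
    - apply ode_sol_incl with (fun r => Ico 0 b (r + t0));
        [unfold Ico; intros; lra|]. apply ode_sol_shift, Hy.
    - rewrite Hw0, Rplus_0_l. reflexivity. }
  set (z := fun t => if Rlt_dec t b then y t else w (t - t0)).
  assert (Hz1 : forall t, t < b -> z t = y t).
  { intros t Ht. unfold z. destruct Rlt_dec; [reflexivity|lra]. }
  assert (Hz2 : forall t, t0 <= t -> z t = w (t - t0)).
  { intros t Ht. unfold z. destruct Rlt_dec; [|reflexivity]. symmetry. apply Hagree. lra. }
  exists (t0 + T), z. split; [lra|]. split.
  - intros t Ht. unfold Ico in Ht. destruct (Rlt_dec t b) as [Htb|Htb].
    + rewrite (Hz1 t Htb).
      apply has_deriv_local with (I := Ico 0 b) (y := y) (d0 := b - t); [lra| | |].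
      * intros r Hr Hrt. apply Rabs_lt_between in Hrt. unfold Ico in *.
        split; [lra|]. apply Hz1; lra.
      * apply Hz1, Htb.
      * apply Hy. unfold Ico; lra.
    + rewrite (Hz2 t ltac:(lra)).
      apply has_deriv_local with (I := fun r => Icc (- T) T (r - t0))
        (y := fun r => w (r - t0)) (d0 := t - t0); [lra| | |].
      * intros r Hr Hrt. apply Rabs_lt_between in Hrt. unfold Ico, Icc in *.
        split; [lra|]. apply Hz2; lra.
      * apply Hz2; lra.
      * apply (ode_sol_shift F (Icc (- T) T) w (- t0) Hw t).
        unfold Icc; lra.
  - intros t Ht. apply Hz1. unfold Ico in Ht; lra.
Qed.


(** * Weighted square-summable sequences *)

Lemma sum_n_nonneg (a : nat -> R) N : (forall k, 0 <= a k) -> 0 <= sum_n a N.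
Proof.
  intros H. induction N as [|N IH]; [rewrite sum_O; apply H|].
  rewrite sum_Sn. apply Rplus_le_le_0_compat; [exact IH|apply H].
Qed.

Lemma sum_n_le (a b : nat -> R) N :
  (forall k, (k <= N)%nat -> a k <= b k) -> sum_n a N <= sum_n b N.
Proof.
  intros H. induction N as [|N IH]; [rewrite !sum_O; apply H; lia|].
  rewrite !sum_Sn. apply Rplus_le_compat; [apply IH; intros; apply H; lia|apply H; lia].
Qed.

Lemma sum_n_incr (a : nat -> R) N M :
  (forall k, 0 <= a k) -> (N <= M)%nat -> sum_n a N <= sum_n a M.
Proof.
  intros H HNM. induction HNM as [|M HNM IH]; [lra|].
  rewrite sum_Sn. apply Rle_trans with (1 := IH).
  generalize (H (S M)). unfold plus; simpl. lra.
Qed.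

Lemma sum_n_term_le (a : nat -> R) N k :
  (forall k, 0 <= a k) -> (k <= N)%nat -> a k <= sum_n a N.
Proof.
  intros H Hk. apply Rle_trans with (sum_n a k); [|apply sum_n_incr; assumption].
  destruct k as [|k]; [rewrite sum_O; lra|]. rewrite sum_Sn.
  generalize (sum_n_nonneg a k H). unfold plus; simpl. lra.
Qed.

Lemma sum_n_plus_R (a b : nat -> R) N :
  sum_n (fun k => a k + b k) N = sum_n a N + sum_n b N.
Proof. exact (sum_n_plus a b N). Qed.

Lemma sum_n_scal_R (c : R) (a : nat -> R) N :
  sum_n (fun k => c * a k) N = c * sum_n a N.
Proof. exact (sum_n_mult_l (K := R_Ring) c a N). Qed.

Lemma series_of_bounded (a : nat -> R) (M : R) :
  (forall k, 0 <= a k) -> (forall N, sum_n a N <= M) -> ex_series a /\ Series a <= M.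
Proof.
  intros Ha HM.
  assert (Hex : ex_finite_lim_seq (sum_n a)).
  { apply ex_finite_lim_seq_incr with M; [|exact HM].
    intros n. apply sum_n_incr; [exact Ha|lia]. }
  assert (Hs : ex_series a).
  { destruct Hex as [l Hl]. exists l. exact Hl. }
  split; [exact Hs|].
  assert (Hl := Series_correct a Hs).
  change (Rbar_le (Finite (Series a)) (Finite M)).
  apply is_lim_seq_le with (u := sum_n a) (v := fun _ => M).
  - exact HM.
  - exact Hl.
  - apply is_lim_seq_const.
Qed.

Lemma sum_n_le_Series (a : nat -> R) N :
  (forall k, 0 <= a k) -> ex_series a -> sum_n a N <= Series a.
Proof.
  intros Ha Hs.
  change (Rbar_le (Finite (sum_n a N)) (Finite (Series a))).
  apply is_lim_seq_le_loc with (u := fun _ => sum_n a N) (v := sum_n a).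
  - exists N. intros n Hn. apply sum_n_incr; assumption.
  - apply is_lim_seq_const.
  - exact (Series_correct a Hs).
Qed.

Definition weight (s : R) (k : nat) : R := Rpower (INR (S k)) (2 * s).

Lemma weight_pos s k : 0 < weight s k.
Proof. apply exp_pos. Qed.

Definition sob_term (s : R) (a : nat -> C) (k : nat) : R := weight s k * Cmod (a k) ^ 2.

(** A bound on the weighted norm, stated on partial sums: it asserts summability as
    well, and every estimate reduces to finite sums. *)
Definition sob_le (s : R) (a : nat -> C) (A : R) : Prop :=
  0 <= A /\ forall N, sum_n (sob_term s a) N <= A ^ 2.

Lemma sob_term_pos s a k : 0 <= sob_term s a k.
Proof. apply Rmult_le_pos; [left; apply weight_pos|apply pow2_ge_0]. Qed.

Lemma sob_le_incr s a A B : sob_le s a A -> A <= B -> sob_le s a B.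
Proof.
  intros [HA H] HB. split; [lra|]. intros N. apply Rle_trans with (1 := H N).
  apply pow_incr. lra.
Qed.

Lemma sob_le_eps s a A : 0 <= A -> (forall eps, 0 < eps -> sob_le s a (A + eps)) -> sob_le s a A.
Proof.
  intros HA H. split; [exact HA|]. intros N. apply Rnot_lt_le. intros Hlt.
  assert (Hs : A < sqrt (sum_n (sob_term s a) N)).
  { rewrite <- (sqrt_pow2 A) by exact HA. apply sqrt_lt_1_alt. split; [apply pow2_ge_0|exact Hlt]. }
  set (q := sqrt (sum_n (sob_term s a) N)) in *.
  destruct (H ((q - A) / 2) ltac:(lra)) as [_ HN]. specialize (HN N).
  assert (Hq : sum_n (sob_term s a) N = q ^ 2).
  { unfold q. rewrite pow2_sqrt; [reflexivity|apply sum_n_nonneg, sob_term_pos]. }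
  rewrite Hq in HN. nra.
Qed.

Lemma sob_le_plus s a b A B :
  sob_le s a A -> sob_le s b B -> sob_le s (fun k => (a k + b k)%C) (A + B).
Proof.
  (* For positive A and B, convexity of the square gives
     (x + y)^2 <= (A + B) (x^2 / A + y^2 / B) termwise. *)
  assert (Hpos : forall A B, 0 < A -> 0 < B -> sob_le s a A -> sob_le s b B ->
    sob_le s (fun k => (a k + b k)%C) (A + B)).
  { clear A B. intros A B HA HB [_ Ha] [_ Hb]. split; [lra|]. intros N.
    apply Rle_trans with (sum_n (fun k => (A + B) / A * sob_term s a k
      + (A + B) / B * sob_term s b k) N).
    - apply sum_n_le. intros k _. unfold sob_term.
      apply Rle_trans with (weight s k * ((A + B) / A * Cmod (a k) ^ 2
        + (A + B) / B * Cmod (b k) ^ 2)); [|right; ring].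
      apply Rmult_le_compat_l; [left; apply weight_pos|].
      apply Rle_trans with ((Cmod (a k) + Cmod (b k)) ^ 2).
      + apply pow_incr. split; [apply Cmod_ge_0|apply Cmod_triangle].
      + set (x := Cmod (a k)). set (y := Cmod (b k)).
        apply Rminus_le.
        replace ((x + y) ^ 2 - ((A + B) / A * x ^ 2 + (A + B) / B * y ^ 2))
          with (- ((B * x - A * y) ^ 2 / (A * B))) by (field; lra).
        assert (0 <= (B * x - A * y) ^ 2 / (A * B)); [|lra].
        apply Rdiv_le_0_compat; [apply pow2_ge_0|nra].
    - rewrite sum_n_plus_R, !sum_n_scal_R.
      replace ((A + B) ^ 2) with ((A + B) / A * A ^ 2 + (A + B) / B * B ^ 2) by (field; lra).
      apply Rplus_le_compat; (apply Rmult_le_compat_l; [|auto]);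
        apply Rdiv_le_0_compat; lra. }
  intros Ha Hb. apply sob_le_eps; [destruct Ha, Hb; lra|]. intros eps Heps.
  replace (A + B + eps) with ((A + eps / 2) + (B + eps / 2)) by field.
  destruct (Ha) as [HA _]. destruct (Hb) as [HB _].
  apply Hpos; [lra|lra| |]; eapply sob_le_incr; try eassumption; lra.
Qed.

Lemma sob_le_dom s a b A K :
  0 <= K -> (forall k, Cmod (b k) <= K * Cmod (a k)) -> sob_le s a A -> sob_le s b (K * A).
Proof.
  intros HK Hd [HA Ha]. split; [nra|]. intros N.
  apply Rle_trans with (sum_n (fun k => K ^ 2 * sob_term s a k) N).
  - apply sum_n_le. intros k _. unfold sob_term.
    replace (K ^ 2 * (weight s k * Cmod (a k) ^ 2))
      with (weight s k * (K * Cmod (a k)) ^ 2) by ring.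
    apply Rmult_le_compat_l; [left; apply weight_pos|].
    apply pow_incr. split; [apply Cmod_ge_0|apply Hd].
  - rewrite sum_n_scal_R, Rpow_mult_distr. apply Rmult_le_compat_l; [apply pow2_ge_0|apply Ha].
Qed.

Lemma sob_le_scal s a A (c : C) : sob_le s a A -> sob_le s (fun k => (c * a k)%C) (Cmod c * A).
Proof.
  apply sob_le_dom; [apply Cmod_ge_0|]. intros k. rewrite Cmod_mult. lra.
Qed.

Lemma sob_le_opp s a A : sob_le s a A -> sob_le s (fun k => (- a k)%C) A.
Proof.
  intros H. rewrite <- (Rmult_1_l A). apply sob_le_dom with (a := a); [lra| |exact H].
  intros k. rewrite Cmod_opp. lra.
Qed.

Lemma sob_le_zero s : sob_le s (fun _ => RtoC 0) 0.
Proof.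
  split; [lra|]. intros N. right. induction N as [|N IH].
  - rewrite sum_O. unfold sob_term. rewrite Cmod_0. ring.
  - rewrite sum_Sn, IH. unfold sob_term. rewrite Cmod_0. unfold plus; simpl. ring.
Qed.

Lemma sob_le_ex s a A : sob_le s a A -> ex_series (sob_term s a).
Proof.
  intros [HA H]. apply (series_of_bounded _ (A ^ 2)); [apply sob_term_pos|exact H].
Qed.

Lemma sob_le_sqrt s a A : sob_le s a A -> sqrt (Series (sob_term s a)) <= A.
Proof.
  intros [HA H]. rewrite <- (sqrt_pow2 A) by exact HA. apply sqrt_le_1_alt.
  apply (series_of_bounded _ (A ^ 2)); [apply sob_term_pos|exact H].
Qed.

Lemma ex_sob_le s a : ex_series (sob_term s a) -> sob_le s a (sqrt (Series (sob_term s a))).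
Proof.
  intros H. split; [apply sqrt_pos|]. intros N.
  assert (HN := sum_n_le_Series _ N (sob_term_pos s a) H).
  rewrite pow2_sqrt; [exact HN|].
  eapply Rle_trans; [apply (sum_n_nonneg (sob_term s a) 0), sob_term_pos|].
  apply sum_n_le_Series; [apply sob_term_pos|exact H].
Qed.

Lemma sob_le_coef s a A k : sob_le s a A -> Cmod (a k) <= A / sqrt (weight s k).
Proof.
  intros [HA H].
  assert (Hw := weight_pos s k). assert (Hq := sqrt_lt_R0 _ Hw).
  assert (Hk := Rle_trans _ _ _ (sum_n_term_le _ k k (sob_term_pos s a) (le_n k)) (H k)).
  apply Rmult_le_reg_r with (sqrt (weight s k)); [exact Hq|].
  replace (A / sqrt (weight s k) * sqrt (weight s k)) with A by (field; lra).
  apply Rsqr_incr_0_var; [|exact HA].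
  unfold sob_term in Hk. rewrite Rsqr_mult, Rsqr_sqrt, !Rsqr_pow2 by lra. lra.
Qed.

(** Entry [k] of a sequence is the coefficient at the wavenumber [k + 1] or [- (k + 1)]. *)
Record ell2 (s : R) : Type := Ell2 {
  coefs :> nat -> C;
  coefs_finite : ex_series (sob_term s coefs)
}.
Arguments coefs {s} _ _.
Arguments Ell2 {s} _ _.

Lemma ell2_ext {s} (a b : ell2 s) : (forall k, a k = b k) -> a = b.
Proof.
  destruct a as [a Ha], b as [b Hb]. simpl. intros H.
  assert (E : a = b) by (apply functional_extensionality, H).
  destruct E. f_equal. apply proof_irrelevance.
Qed.

Definition ell2_norm {s} (a : ell2 s) : R := sqrt (Series (sob_term s a)).

Definition ell2_of {s} (a : nat -> C) (A : R) (H : sob_le s a A) : ell2 s :=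
  Ell2 a (sob_le_ex s a A H).

Lemma ell2_norm_le {s} (a : ell2 s) (A : R) : sob_le s a A <-> ell2_norm a <= A.
Proof.
  split; [apply sob_le_sqrt|]. intros H.
  apply sob_le_incr with (2 := H). apply ex_sob_le, coefs_finite.
Qed.

Lemma ell2_sob {s} (a : ell2 s) : sob_le s a (ell2_norm a).
Proof. apply ell2_norm_le. lra. Qed.

Definition ell2_zero {s} : ell2 s := ell2_of _ _ (sob_le_zero s).
Definition ell2_plus {s} (a b : ell2 s) : ell2 s :=
  ell2_of _ _ (sob_le_plus s a b _ _ (ell2_sob a) (ell2_sob b)).
Definition ell2_opp {s} (a : ell2 s) : ell2 s :=
  ell2_of _ _ (sob_le_opp s a _ (ell2_sob a)).
Definition ell2_scal {s} (c : R) (a : ell2 s) : ell2 s :=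
  ell2_of _ _ (sob_le_scal s a _ (RtoC c) (ell2_sob a)).

Definition ell2_AbelianMonoid_mixin s : AbelianMonoid.mixin_of (ell2 s).
Proof.
  apply (AbelianMonoid.Mixin (ell2 s) ell2_plus ell2_zero);
    intros; apply ell2_ext; intros k; simpl; ring.
Defined.
Canonical ell2_AbelianMonoid s := AbelianMonoid.Pack (ell2 s) (ell2_AbelianMonoid_mixin s) (ell2 s).

Definition ell2_AbelianGroup_mixin s : AbelianGroup.mixin_of (ell2_AbelianMonoid s).
Proof.
  apply (AbelianGroup.Mixin (ell2_AbelianMonoid s) ell2_opp).
  intros; apply ell2_ext; intros k; simpl; ring.
Defined.
Canonical ell2_AbelianGroup s :=
  AbelianGroup.Pack (ell2 s) (AbelianGroup.Class _ _ (ell2_AbelianGroup_mixin s)) (ell2 s).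

Definition ell2_ModuleSpace_mixin s : ModuleSpace.mixin_of R_Ring (ell2_AbelianGroup s).
Proof.
  apply (ModuleSpace.Mixin R_Ring (ell2_AbelianGroup s) ell2_scal);
    intros; apply ell2_ext; intros k; simpl; unfold mult, plus, one; simpl;
    rewrite ?RtoC_mult, ?RtoC_plus; ring.
Defined.
Canonical ell2_ModuleSpace s :=
  ModuleSpace.Pack R_Ring (ell2 s) (ModuleSpace.Class _ _ _ (ell2_ModuleSpace_mixin s)) (ell2 s).

Lemma ell2_norm_triangle {s} (a b : ell2 s) :
  ell2_norm (ell2_plus a b) <= ell2_norm a + ell2_norm b.
Proof. apply ell2_norm_le. apply sob_le_plus; apply ell2_sob. Qed.

Lemma ell2_norm_scal {s} (c : R) (a : ell2 s) :
  ell2_norm (ell2_scal c a) <= Rabs c * ell2_norm a.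
Proof. apply ell2_norm_le. rewrite <- Cmod_R. apply sob_le_scal, ell2_sob. Qed.

Lemma ell2_norm_opp {s} (a : ell2 s) : ell2_norm (ell2_opp a) <= ell2_norm a.
Proof. apply ell2_norm_le. apply sob_le_opp, ell2_sob. Qed.

Definition ell2_dist {s} (a b : ell2 s) : R := ell2_norm (ell2_plus b (ell2_opp a)).

Lemma ell2_dist_refl {s} (a : ell2 s) : ell2_dist a a = 0.
Proof.
  unfold ell2_dist. replace (ell2_plus a (ell2_opp a)) with (@ell2_zero s).
  - apply Rle_antisym; [|apply sqrt_pos]. apply ell2_norm_le, sob_le_zero.
  - apply ell2_ext; intros k; simpl; ring.
Qed.

Lemma ell2_dist_sym {s} (a b : ell2 s) : ell2_dist a b <= ell2_dist b a.
Proof.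
  unfold ell2_dist.
  replace (ell2_plus b (ell2_opp a)) with (ell2_opp (ell2_plus a (ell2_opp b))).
  - apply ell2_norm_opp.
  - apply ell2_ext; intros k; simpl; ring.
Qed.

Lemma ell2_dist_triangle {s} (b a c : ell2 s) : ell2_dist a c <= ell2_dist a b + ell2_dist b c.
Proof.
  unfold ell2_dist. rewrite Rplus_comm.
  replace (ell2_plus c (ell2_opp a))
    with (ell2_plus (ell2_plus c (ell2_opp b)) (ell2_plus b (ell2_opp a))).
  - apply ell2_norm_triangle.
  - apply ell2_ext; intros k; simpl; ring.
Qed.

Definition ell2_UniformSpace_mixin s : UniformSpace.mixin_of (ell2 s).
Proof.
  apply (UniformSpace.Mixin (ell2 s) ell2_zero (fun a e b => ell2_dist a b < e)).
  - intros a e. rewrite ell2_dist_refl. apply cond_pos.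
  - intros a b e H. eapply Rle_lt_trans; [apply ell2_dist_sym|exact H].
  - intros a b c e1 e2 H1 H2. generalize (ell2_dist_triangle b a c). lra.
Defined.
Canonical ell2_UniformSpace s :=
  UniformSpace.Pack (ell2 s) (ell2_UniformSpace_mixin s) (ell2 s).

Canonical ell2_NormedModuleAux s :=
  NormedModuleAux.Pack R_AbsRing (ell2 s)
    (NormedModuleAux.Class R_AbsRing (ell2 s)
      (ModuleSpace.class _ (ell2_ModuleSpace s)) (ell2_UniformSpace_mixin s)) (ell2 s).

Lemma ell2_norm_zero_eq {s} (a : ell2 s) : ell2_norm a = 0 -> a = ell2_zero.
Proof.
  intros H. apply ell2_ext. intros k. simpl. apply Cmod_eq_0.
  assert (Hk := sob_le_coef s a 0 k). rewrite <- H in Hk at 1.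
  specialize (Hk (ell2_sob a)). unfold Rdiv in Hk. rewrite Rmult_0_l in Hk.
  generalize (Cmod_ge_0 (a k)). lra.
Qed.

Definition ell2_NormedModule_mixin s : NormedModule.mixin_of R_AbsRing (ell2_NormedModuleAux s).
Proof.
  apply (NormedModule.Mixin R_AbsRing (ell2_NormedModuleAux s) ell2_norm 1).
  - exact ell2_norm_triangle.
  - exact ell2_norm_scal.
  - intros x y eps H. exact H.
  - intros x y eps H. rewrite Rmult_1_l. exact H.
  - exact ell2_norm_zero_eq.
Defined.
Canonical ell2_NormedModule s :=
  NormedModule.Pack R_AbsRing (ell2 s)
    (NormedModule.Class R_AbsRing (ell2 s)
      (NormedModuleAux.class _ (ell2_NormedModuleAux s)) (ell2_NormedModule_mixin s)) (ell2 s).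


(** * Completeness and the phase space *)

(** The value 0 for sequences that are not square-summable is a mere default. *)
Definition ell2_make (s : R) (a : nat -> C) : ell2 s :=
  match excluded_middle_informative (ex_series (sob_term s a)) with
  | left H => Ell2 a H
  | right _ => ell2_zero
  end.

Lemma ell2_make_coefs s a k : ex_series (sob_term s a) -> ell2_make s a k = a k.
Proof.
  intros H. unfold ell2_make. destruct excluded_middle_informative; [reflexivity|contradiction].
Qed.

Definition ell2_lim_coefs {s} (F : (ell2 s -> Prop) -> Prop) (k : nat) : C :=
  lim (T := C_R_CompleteNormedModule) (filtermap (fun a : ell2 s => a k) F).

Definition ell2_lim {s} (F : (ell2 s -> Prop) -> Prop) : ell2 s :=
  ell2_make s (ell2_lim_coefs F).

Lemma Cmod_minus_sym (a b : C) : Cmod (a - b) = Cmod (b - a).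
Proof. rewrite <- Cmod_opp. f_equal. ring. Qed.

Lemma ell2_dist_coef {s} (a b : ell2 s) k :
  Cmod (b k - a k) <= ell2_dist a b / sqrt (weight s k).
Proof.
  exact (sob_le_coef s (ell2_plus b (ell2_opp a)) _ k (ell2_sob _)).
Qed.

Lemma C_ball_Cmod (z : C) (eps : R) : 0 < eps ->
  exists e : posreal, forall w, ball (M := C_UniformSpace) z e w -> Cmod (w - z) < eps.
Proof.
  intros Heps.
  assert (H2 : 0 < sqrt 2) by (apply sqrt_lt_R0; lra).
  assert (He : 0 < eps / sqrt 2) by (apply Rdiv_lt_0_compat; lra).
  exists (mkposreal _ He). intros w Hw.
  apply (C_NormedModule_mixin_compat2 z) in Hw. simpl in Hw.
  replace (sqrt 2 * (eps / sqrt 2)) with eps in Hw by (field; lra). exact Hw.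
Qed.

Lemma ell2_lim_coef {s} (F : (ell2 s -> Prop) -> Prop) k eps :
  ProperFilter F -> cauchy F -> 0 < eps ->
  F (fun a => Cmod (a k - ell2_lim_coefs F k) < eps).
Proof.
  intros HF HC Heps.
  assert (Hw := sqrt_lt_R0 _ (weight_pos s k)).
  assert (HCk : cauchy (T := C_R_CompleteNormedModule) (filtermap (fun a : ell2 s => a k) F)).
  { intros e.
    assert (Hd : 0 < e * sqrt (weight s k)) by (apply Rmult_lt_0_compat; [apply cond_pos|exact Hw]).
    destruct (HC (mkposreal _ Hd)) as [x Hx]. exists (x k).
    apply filter_imp with (2 := Hx). intros y Hy. apply C_NormedModule_mixin_compat1.
    apply Rle_lt_trans with (1 := ell2_dist_coef x y k).
    apply Rmult_lt_reg_r with (sqrt (weight s k)); [exact Hw|].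
    unfold Rdiv. rewrite Rmult_assoc, Rinv_l, Rmult_1_r by lra. exact Hy. }
  destruct (C_ball_Cmod (ell2_lim_coefs F k) eps Heps) as [e He].
  assert (H : F (fun a : ell2 s => ball (M := C_UniformSpace) (ell2_lim_coefs F k) e (a k)))
    by exact (complete_cauchy (T := C_R_CompleteNormedModule) _
      (filtermap_proper_filter _ _ _ _ HF) HCk e).
  apply filter_imp with (2 := H). intros a. apply He.
Qed.

(** Fatou's lemma: each partial sum of the squared norm is a continuous function of
    finitely many coefficients, so a bound along the filter passes to the limit. *)
Lemma ell2_lim_dist {s} (F : (ell2 s -> Prop) -> Prop) (x : ell2 s) e :
  ProperFilter F -> cauchy F -> 0 < e -> F (fun z => ell2_dist x z < e) ->
  sob_le s (fun k => (ell2_lim_coefs F k - x k)%C) e.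
Proof.
  intros HF HC He Hx. split; [lra|]. intros N.
  set (l := ell2_lim_coefs F).
  assert (Hterm : forall k, filterlim (fun z : ell2 s => sob_term s (fun k => (z k - x k)%C) k) F
    (locally (sob_term s (fun k => (l k - x k)%C) k))).
  { intros k. unfold sob_term.
    apply (filterlim_comp _ _ _ (fun z : ell2 s => Cmod (z k - x k)%C)
      (fun r => weight s k * r ^ 2) F (locally (Cmod (l k - x k)%C))).
    - apply filterlim_locally. intros eps.
      apply filter_imp with (2 := ell2_lim_coef F k eps HF HC (cond_pos eps)).
      intros z Hz. fold l in Hz.
      apply Rle_lt_trans with (2 := Hz).
      change (Rabs (Cmod (z k - x k) - Cmod (l k - x k)) <= Cmod (z k - l k)).
      assert (H1 := Cmod_triangle (z k - l k) (l k - x k)).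
      assert (H2 := Cmod_triangle (l k - z k) (z k - x k)).
      rewrite (Cmod_minus_sym (l k)) in H2.
      replace (z k - l k + (l k - x k))%C with (z k - x k)%C in H1 by ring.
      replace (l k - z k + (z k - x k))%C with (l k - x k)%C in H2 by ring.
      apply Rabs_le. lra.
    - apply (ex_derive_continuous (V := R_NormedModule) (fun r => weight s k * r ^ 2)). auto_derive. easy. }
  assert (Hsum : filterlim (fun z : ell2 s => sum_n (sob_term s (fun k => (z k - x k)%C)) N) F
    (locally (sum_n (sob_term s (fun k => (l k - x k)%C)) N))).
  { induction N as [|N IH].
    - apply filterlim_ext with (2 := eq_ind_r (fun v => filterlim _ F (locally v)) (Hterm 0%nat)
        (sum_O _)). intros z. rewrite sum_O. reflexivity.
    - rewrite sum_Sn.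
      apply filterlim_ext with (fun z : ell2 s => plus (sum_n (sob_term s (fun k => (z k - x k)%C)) N)
        (sob_term s (fun k => (z k - x k)%C) (S N))).
      { intros z. rewrite sum_Sn. reflexivity. }
      exact (filterlim_comp_2 _ _ _ IH (Hterm (S N)) (filterlim_plus (V := R_NormedModule) _ _)). }
  change (Rbar_le (Finite (sum_n (sob_term s (fun k => (l k - x k)%C)) N)) (Finite (e ^ 2))).
  refine (filterlim_le (F := F) _ (fun _ => e ^ 2) (Finite _) (Finite _) _ Hsum _).
  - apply filter_imp with (2 := Hx). intros z Hz.
    assert (Hs : sob_le s (fun k => (z k - x k)%C) e); [|apply Hs].
    apply sob_le_incr with (ell2_dist x z); [|lra].
    exact (ell2_sob (ell2_plus z (ell2_opp x))).
  - apply (filterlim_const (U := R_UniformSpace)).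
Qed.

Definition ell2_CompleteSpace_mixin s : CompleteSpace.mixin_of (ell2_UniformSpace s).
Proof.
  apply (CompleteSpace.Mixin (ell2_UniformSpace s) ell2_lim).
  - intros F HF HC eps.
    assert (He : 0 < eps / 4) by (generalize (cond_pos eps); lra).
    destruct (HC (mkposreal _ He)) as [x Hx].
    assert (HL := ell2_lim_dist F x (eps / 4) HF HC He Hx).
    assert (Hex : ex_series (sob_term s (ell2_lim_coefs F))).
    { apply (sob_le_ex s _ (eps / 4 + ell2_norm x)).
      replace (ell2_lim_coefs F) with (fun k => (ell2_lim_coefs F k - x k + x k)%C).
      - apply sob_le_plus; [exact HL|apply ell2_sob].
      - apply functional_extensionality. intros k. ring. }
    assert (Hd : ell2_dist x (ell2_lim F) <= eps / 4).
    { apply ell2_norm_le. destruct HL as [HL1 HL2]. split; [exact HL1|].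
      intros N. eapply Rle_trans; [|apply (HL2 N)]. right. apply sum_n_ext. intros k.
      unfold sob_term. simpl. unfold ell2_lim. rewrite ell2_make_coefs by exact Hex. reflexivity. }
    apply filter_imp with (2 := Hx). intros y Hy.
    change (ell2_dist (ell2_lim F) y < eps).
    change (ell2_dist x y < eps / 4) in Hy.
    generalize (ell2_dist_triangle x (ell2_lim F) y) (ell2_dist_sym (ell2_lim F) x). lra.
  - intros F1 F2 H1 H2. replace F2 with F1.
    + intros eps. apply ball_center.
    + apply functional_extensionality. intros P. apply propositional_extensionality.
      split; [apply H2|apply H1].
Qed.

Definition ell2_CompleteNormedModule s : CompleteNormedModule R_AbsRing :=
  CompleteNormedModule.Pack R_AbsRing (ell2 s)
    (CompleteNormedModule.Class R_AbsRing (ell2 s)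
      (NormedModule.class _ (ell2_NormedModule s)) (ell2_CompleteSpace_mixin s)) (ell2 s).

Lemma filtermap_cauchy {U V : UniformSpace} (f : U -> V) (F : (U -> Prop) -> Prop) :
  Filter F -> (forall x y e, ball x e y -> ball (f x) e (f y)) ->
  cauchy F -> cauchy (filtermap f F).
Proof.
  intros HF Hf HC e. destruct (HC e) as [x Hx]. exists (f x).
  apply filter_imp with (2 := Hx). intros y. apply Hf.
Qed.

Definition prod_CompleteSpace_mixin (U V : CompleteSpace) :
  CompleteSpace.mixin_of (prod_UniformSpace U V).
Proof.
  apply (CompleteSpace.Mixin (prod_UniformSpace U V)
    (fun F => (lim (filtermap fst F), lim (filtermap snd F)))).
  - intros F HF HC eps.
    assert (H1 : F (fun z => ball (lim (filtermap fst F)) eps (fst z))).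
    exact (complete_cauchy (filtermap fst F) (filtermap_proper_filter _ _ _ _ HF)
      (filtermap_cauchy (U := prod_UniformSpace U V) fst F _
         (fun x y e (H : ball x e y) => proj1 H) HC) eps).
    assert (H2 : F (fun z => ball (lim (filtermap snd F)) eps (snd z))).
    exact (complete_cauchy (filtermap snd F) (filtermap_proper_filter _ _ _ _ HF)
      (filtermap_cauchy (U := prod_UniformSpace U V) snd F _
         (fun x y e (H : ball x e y) => proj2 H) HC) eps).
    apply filter_imp with (2 := filter_and _ _ H1 H2). intros y [Hy1 Hy2]. split; assumption.
  - intros F1 F2 H1 H2. replace F2 with F1.
    + intros eps. apply ball_center.
    + apply functional_extensionality. intros P. apply propositional_extensionality.
      split; [apply H2|apply H1].
Qed.

(** The first component holds the coefficients of [u], at the wavenumbers 1, 2, 3 and so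
    on, the second one those of [v], at the opposite wavenumbers. *)
Definition phase_space (s : R) : CompleteNormedModule R_AbsRing :=
  let E := ell2_CompleteNormedModule s in
  CompleteNormedModule.Pack R_AbsRing (ell2 s * ell2 s)
    (CompleteNormedModule.Class R_AbsRing (ell2 s * ell2 s)
      (NormedModule.class _ (prod_NormedModule R_AbsRing (ell2_NormedModule s) (ell2_NormedModule s)))
      (prod_CompleteSpace_mixin E E)) (ell2 s * ell2 s).


(** * Convolution inequalities *)

Definition l1_le (a : nat -> C) (A : R) : Prop :=
  forall N, sum_n (fun k => Cmod (a k)) N <= A.

Definition l2_le (x : nat -> R) (A : R) : Prop :=
  0 <= A /\ forall N, sum_n (fun k => x k ^ 2) N <= A ^ 2.

Definition convR (x y : nat -> R) (m : nat) : R := sum_n (fun i => x i * y (m - i)%nat) m.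

Lemma sum_n_head (x : nat -> R) n : sum_n x (S n) = x O + sum_n (fun k => x (S k)) n.
Proof.
  induction n as [|n IH]; [rewrite sum_Sn, !sum_O; reflexivity|].
  rewrite sum_Sn, IH, (sum_Sn (fun k => x (S k))). unfold plus; simpl. ring.
Qed.

Lemma sum_n_rev (x : nat -> R) n : sum_n (fun i => x (n - i)%nat) n = sum_n x n.
Proof.
  revert x. induction n as [|n IH]; intros x; [rewrite !sum_O; reflexivity|].
  rewrite sum_Sn, sum_n_head, Nat.sub_diag, <- (IH (fun k => x (S k))).
  rewrite (sum_n_ext_loc _ (fun i => x (S (n - i)))).
  - unfold plus; simpl. ring.
  - intros i Hi. f_equal. lia.
Qed.

Lemma convR_comm x y m : convR x y m = convR y x m.
Proof.
  unfold convR. rewrite <- sum_n_rev. apply sum_n_ext_loc. intros i Hi.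
  replace (m - (m - i))%nat with i by lia. apply Rmult_comm.
Qed.

Lemma sum_convR x y N :
  sum_n (convR x y) N = sum_n (fun i => x i * sum_n y (N - i)) N.
Proof.
  induction N as [|N IH]; [unfold convR; rewrite !sum_O; reflexivity|].
  rewrite sum_Sn, IH. unfold convR. rewrite !sum_Sn, !Nat.sub_diag, sum_O.
  rewrite (sum_n_ext_loc (fun i => x i * sum_n y (S N - i))
    (fun i => x i * sum_n y (N - i) + x i * y (S N - i)%nat)).
  - rewrite sum_n_plus_R. unfold plus; simpl. ring.
  - intros i Hi. replace (S N - i)%nat with (S (N - i)) by lia. rewrite sum_Sn.
    unfold plus; simpl. ring.
Qed.

Lemma convR_pos x y m : (forall k, 0 <= x k) -> (forall k, 0 <= y k) -> 0 <= convR x y m.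
Proof. intros Hx Hy. apply sum_n_nonneg. intros; apply Rmult_le_pos; auto. Qed.

Lemma sum_convR_le x y X Y N :
  (forall k, 0 <= x k) -> (forall k, 0 <= y k) ->
  (forall N, sum_n x N <= X) -> (forall N, sum_n y N <= Y) ->
  sum_n (convR x y) N <= X * Y.
Proof.
  intros Hx Hy HX HY. rewrite sum_convR.
  assert (0 <= Y) by (eapply Rle_trans; [apply (sum_n_nonneg y 0 Hy)|apply HY]).
  apply Rle_trans with (sum_n (fun i => Y * x i) N).
  - apply sum_n_le. intros k _. rewrite (Rmult_comm Y).
    apply Rmult_le_compat_l; auto.
  - rewrite sum_n_scal_R, Rmult_comm. apply Rmult_le_compat_r; auto.
Qed.

(** Cauchy-Schwarz for the measure with masses [a]. *)
Lemma sum_n_cauchy_schwarz (a z : nat -> R) N :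
  (forall k, 0 <= a k) ->
  sum_n (fun k => a k * z k) N ^ 2 <= sum_n a N * sum_n (fun k => a k * z k ^ 2) N.
Proof.
  intros Ha.
  assert (Hz : forall k, 0 <= a k * z k ^ 2)
    by (intros; apply Rmult_le_pos; [apply Ha|apply pow2_ge_0]).
  induction N as [|N IH]; [rewrite !sum_O; right; ring|].
  rewrite !sum_Sn. unfold plus; simpl.
  assert (HA := sum_n_nonneg a N Ha).
  assert (HQ := sum_n_nonneg _ N Hz). simpl in HQ.
  revert IH HA HQ. simpl.
  generalize (sum_n (fun k => a k * z k) N) (sum_n a N)
    (sum_n (fun k => a k * (z k * (z k * 1))) N) (a (S N)) (z (S N)) (Ha (S N)).
  intros S A Q b y Hb HI HA HQ.
  assert (H2 : 2 * S * y <= A * y ^ 2 + Q).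
  { apply Rnot_lt_le. intros Hlt.
    assert (0 <= A * y ^ 2) by (apply Rmult_le_pos; [lra|apply pow2_ge_0]).
    assert ((A * y ^ 2 + Q) ^ 2 < (2 * S * y) ^ 2) by (apply pow_lt_compat_l_R || nra).
    assert (0 <= (A * y ^ 2 - Q) ^ 2) by apply pow2_ge_0.
    assert (S * (S * 1) * y ^ 2 <= A * Q * y ^ 2)
      by (apply Rmult_le_compat_r; [apply pow2_ge_0|exact HI]).
    nra. }
  nra.
Qed.

Lemma l2_le_dom x y A K :
  0 <= K -> (forall k, Rabs (y k) <= K * x k) -> l2_le x A -> l2_le y (K * A).
Proof.
  intros HK Hd [HA H]. split; [nra|]. intros N.
  apply Rle_trans with (sum_n (fun k => K ^ 2 * x k ^ 2) N).
  - apply sum_n_le. intros k _. rewrite <- Rpow_mult_distr, <- (pow2_abs (y k)).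
    apply pow_incr. split; [apply Rabs_pos|apply Hd].
  - rewrite sum_n_scal_R, Rpow_mult_distr.
    apply Rmult_le_compat_l; [apply pow2_ge_0|apply H].
Qed.

(** From [(x + y) ^ 2 <= 2 * x ^ 2 + 2 * y ^ 2]: crude, but only the order of growth matters. *)
Lemma l2_le_plus x y A B : l2_le x A -> l2_le y B -> l2_le (fun k => x k + y k) (2 * (A + B)).
Proof.
  intros [HA Hx] [HB Hy]. split; [lra|]. intros N.
  apply Rle_trans with (sum_n (fun k => 2 * x k ^ 2 + 2 * y k ^ 2) N).
  - apply sum_n_le. intros k _. generalize (pow2_ge_0 (x k - y k)). nra.
  - rewrite sum_n_plus_R, !sum_n_scal_R. generalize (Hx N) (Hy N). nra.
Qed.

(** Young's inequality l2 * l1 -> l2: Cauchy-Schwarz for the masses [y] bounds the square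
    of the convolution by [B] times the convolution of [x ^ 2] with [y]. *)
Lemma l2_le_convR x y A B :
  (forall k, 0 <= x k) -> (forall k, 0 <= y k) ->
  l2_le x A -> (forall N, sum_n y N <= B) -> l2_le (convR x y) (A * B).
Proof.
  intros Hx Hy [HA HX] HY.
  assert (HB : 0 <= B) by (eapply Rle_trans; [apply (sum_n_nonneg y 0 Hy)|apply HY]).
  split; [nra|]. intros N.
  apply Rle_trans with (sum_n (fun m => B * convR (fun i => x i ^ 2) y m) N).
  - apply sum_n_le. intros m _. unfold convR.
    rewrite (sum_n_ext _ (fun i => y (m - i)%nat * x i)) by (intros; apply Rmult_comm).
    eapply Rle_trans; [apply sum_n_cauchy_schwarz; intros; apply Hy|].
    rewrite (sum_n_rev y).
    rewrite (sum_n_ext (fun i => y (m - i)%nat * x i ^ 2) (fun i => x i ^ 2 * y (m - i)%nat))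
      by (intros; apply Rmult_comm).
    apply Rmult_le_compat_r; [|apply HY].
    apply sum_n_nonneg. intros; apply Rmult_le_pos; [apply pow2_ge_0|apply Hy].
  - rewrite sum_n_scal_R.
    replace ((A * B) ^ 2) with (B * (A ^ 2 * B)) by ring.
    apply Rmult_le_compat_l; [exact HB|].
    apply sum_convR_le; auto. intros; apply pow2_ge_0.
Qed.

Lemma l2_le_lim (g : nat -> nat -> R) (h : nat -> R) A :
  (forall n, is_lim_seq (fun K => g K n) (h n)) -> (forall K, l2_le (g K) A) -> l2_le h A.
Proof.
  intros Hlim Hg. split; [apply (Hg O)|]. intros N.
  assert (Hs : is_lim_seq (fun K => sum_n (fun n => g K n ^ 2) N) (sum_n (fun n => h n ^ 2) N)).
  { assert (Hsq : forall n, is_lim_seq (fun K => g K n ^ 2) (h n ^ 2)).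
    { intros n. simpl. apply is_lim_seq_mult'; [apply Hlim|].
      apply is_lim_seq_mult'; [apply Hlim|apply is_lim_seq_const]. }
    induction N as [|N IH].
    - apply is_lim_seq_ext with (fun K => g K O ^ 2); [intros; rewrite sum_O; reflexivity|].
      rewrite sum_O. apply Hsq.
    - apply is_lim_seq_ext with (fun K => sum_n (fun n => g K n ^ 2) N + g K (S N) ^ 2).
      { intros; rewrite sum_Sn; reflexivity. }
      rewrite sum_Sn. apply is_lim_seq_plus'; [exact IH|apply Hsq]. }
  change (Rbar_le (Finite (sum_n (fun n => h n ^ 2) N)) (Finite (A ^ 2))).
  apply is_lim_seq_le with (2 := Hs) (3 := is_lim_seq_const (A ^ 2)).
  intros K. apply (Hg K).
Qed.

Lemma sum_n_shift_le (x : nat -> R) k N :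
  (forall n, 0 <= x n) -> sum_n (fun n => x (n + k)%nat) N <= sum_n x (N + k).
Proof.
  revert x. induction k as [|k IH]; intros x Hx.
  - rewrite Nat.add_0_r. right. apply sum_n_ext. intros; rewrite Nat.add_0_r; reflexivity.
  - rewrite Nat.add_succ_r, sum_n_head.
    rewrite (sum_n_ext _ (fun n => x (S (n + k)))) by (intros; f_equal; lia).
    generalize (IH (fun n => x (S n)) (fun n => Hx (S n))) (Hx O). lra.
Qed.

Lemma l2_le_bounded z Z k : l2_le z Z -> z k <= Z.
Proof.
  intros [HZ H]. apply Rnot_lt_le. intros Hlt.
  assert (Hk := sum_n_term_le (fun k => z k ^ 2) k k (fun k => pow2_ge_0 _) (le_n k)).
  generalize (H k). simpl in *. nra.
Qed.

(** Correlation with a summable sequence acts on l2, by Cauchy-Schwarz and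
    translation invariance. *)
Lemma l2_le_correlation a z A Z :
  (forall k, 0 <= a k) -> (forall k, 0 <= z k) ->
  (forall N, sum_n a N <= A) -> l2_le z Z ->
  (forall n, ex_series (fun k => a k * z (n + k)%nat)) /\
  l2_le (fun n => Series (fun k => a k * z (n + k)%nat)) (A * Z).
Proof.
  intros Ha Hz HA HZ.
  assert (HA0 : 0 <= A) by (eapply Rle_trans; [apply (sum_n_nonneg a 0 Ha)|apply HA]).
  assert (HZ0 := proj1 HZ).
  assert (Hex : forall n, ex_series (fun k => a k * z (n + k)%nat)).
  { intros n. apply (series_of_bounded _ (Z * A)).
    - intros; apply Rmult_le_pos; auto.
    - intros N. apply Rle_trans with (sum_n (fun k => Z * a k) N).
      + apply sum_n_le. intros k _. rewrite Rmult_comm. apply Rmult_le_compat_r; [auto|].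
        apply l2_le_bounded, HZ.
      + rewrite sum_n_scal_R. apply Rmult_le_compat_l; auto. }
  split; [exact Hex|].
  apply l2_le_lim with (g := fun K n => sum_n (fun k => a k * z (n + k)%nat) K).
  { intros n. exact (Series_correct _ (Hex n)). }
  intros K. split; [nra|]. intros N.
  apply Rle_trans with (sum_n (fun n => A * sum_n (fun k => a k * z (n + k)%nat ^ 2) K) N).
  { apply sum_n_le. intros n _.
    eapply Rle_trans; [apply sum_n_cauchy_schwarz, Ha|].
    apply Rmult_le_compat_r; [|apply HA].
    apply sum_n_nonneg. intros; apply Rmult_le_pos; [apply Ha|apply pow2_ge_0]. }
  rewrite sum_n_scal_R.
  replace ((A * Z) ^ 2) with (A * (A * Z ^ 2)) by ring.
  apply Rmult_le_compat_l; [exact HA0|].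
  rewrite sum_n_switch.
  apply Rle_trans with (sum_n (fun k => Z ^ 2 * a k) K).
  { apply sum_n_le. intros k _. rewrite sum_n_scal_R, Rmult_comm.
    apply Rmult_le_compat_r; [apply Ha|].
    apply Rle_trans with (sum_n (fun n => z n ^ 2) (N + k)); [|apply HZ].
    apply (sum_n_shift_le (fun n => z n ^ 2)). intros; apply pow2_ge_0. }
  rewrite sum_n_scal_R, Rmult_comm. apply Rmult_le_compat_r; [apply pow2_ge_0|apply HA].
Qed.

(** * Embedding of Sobolev sequences into the Wiener algebra *)

Definition root_weight (s : R) (k : nat) : R := Rpower (INR (S k)) s.

Lemma root_weight_pos s k : 0 < root_weight s k.
Proof. apply exp_pos. Qed.

Lemma root_weight_sqr s k : root_weight s k ^ 2 = weight s k.
Proof.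
  unfold root_weight, weight. simpl. rewrite Rmult_1_r, <- Rpower_plus. f_equal. ring.
Qed.

Lemma sob_le_l2 s a A : sob_le s a A <-> l2_le (fun k => root_weight s k * Cmod (a k)) A.
Proof.
  assert (H : forall N, sum_n (sob_term s a) N
    = sum_n (fun k => (root_weight s k * Cmod (a k)) ^ 2) N).
  { intros N. apply sum_n_ext. intros k. unfold sob_term.
    rewrite Rpow_mult_distr, root_weight_sqr. reflexivity. }
  unfold sob_le, l2_le. split; intros [HA Ha]; (split; [exact HA|]); intros N.
  - rewrite <- H. apply Ha.
  - rewrite H. apply Ha.
Qed.

Lemma exp_increasing_le x y : x <= y -> exp x <= exp y.
Proof. intros [H| ->]; [left; apply exp_increasing, H|right; reflexivity]. Qed.

(** Comparison of the p-series with a telescoping sum: its terms are bounded by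
    differences of the sequence x^(-sigma) / sigma. *)
Lemma inv_weight_step s k : 1 / 2 < s ->
  / weight s (S k) <= / (2 * s - 1)
    * (Rpower (INR (S k)) (- (2 * s - 1)) - Rpower (INR (S (S k))) (- (2 * s - 1))).
Proof.
  intros Hs. set (sg := 2 * s - 1). assert (Hsg : 0 < sg) by (unfold sg; lra).
  assert (Hx : 0 < INR (S k)) by (apply lt_0_INR; lia).
  set (x := INR (S k)) in *. assert (Hx1 : INR (S (S k)) = x + 1) by apply S_INR.
  unfold weight. rewrite Hx1.
  assert (Hp := exp_pos (- sg * ln (x + 1))). fold (Rpower (x + 1) (- sg)) in Hp.
  assert (E1 : / Rpower (x + 1) (2 * s) = Rpower (x + 1) (- sg) / (x + 1)).
  { rewrite <- Rpower_Ropp. replace (- (2 * s)) with (- sg + - 1) by (unfold sg; ring).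
    rewrite Rpower_plus, (Rpower_Ropp _ 1), Rpower_1 by lra. reflexivity. }
  assert (Hln : ln x + / (x + 1) <= ln (x + 1)).
  { assert (Hlt : ln x <= ln (x + 1) + - / (x + 1)); [|lra].
    rewrite <- (ln_exp (- / (x + 1))), <- ln_mult by (lra || apply exp_pos).
    apply ln_le; [exact Hx|].
    apply Rle_trans with ((x + 1) * (1 + - / (x + 1))).
    - right. field. lra.
    - apply Rmult_le_compat_l; [lra|apply exp_ineq1_le]. }
  assert (E2 : Rpower (x + 1) (- sg) * (1 + sg / (x + 1)) <= Rpower x (- sg)).
  { apply Rle_trans with (Rpower (x + 1) (- sg) * exp (sg / (x + 1))).
    - apply Rmult_le_compat_l; [lra|apply exp_ineq1_le].
    - unfold Rpower. rewrite <- exp_plus. apply exp_increasing_le.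
      assert (sg * (ln x + / (x + 1)) <= sg * ln (x + 1)) by (apply Rmult_le_compat_l; lra).
      unfold Rdiv. lra. }
  rewrite E1. apply Rmult_le_reg_l with sg; [exact Hsg|].
  rewrite <- Rmult_assoc, Rinv_r, Rmult_1_l by lra. unfold Rdiv in *. lra.
Qed.

Definition zeta_bound (s : R) : R := 1 + / (2 * s - 1).

Lemma sum_inv_weight s N : 1 / 2 < s -> sum_n (fun k => / weight s k) N <= zeta_bound s.
Proof.
  intros Hs. set (sg := 2 * s - 1). assert (Hsg : 0 < / sg) by (apply Rinv_0_lt_compat; unfold sg; lra).
  assert (H : sum_n (fun k => / weight s k) N
    <= 1 + / sg * (1 - Rpower (INR (S N)) (- sg))).
  { induction N as [|N IH].
    - rewrite sum_O. unfold weight. simpl INR. unfold Rpower. rewrite ln_1, !Rmult_0_r, exp_0. lra.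
    - rewrite sum_Sn. generalize (inv_weight_step s N Hs). fold sg.
      intros H. eapply Rle_trans; [exact (Rplus_le_compat _ _ _ _ IH H)|]. lra. }
  unfold zeta_bound. fold sg. apply Rle_trans with (1 := H).
  generalize (exp_pos (- sg * ln (INR (S N)))). fold (Rpower (INR (S N)) (- sg)). intros. nra.
Qed.

Lemma Rmult_inv_weight s k x : x = / weight s k * (weight s k * x).
Proof. field. apply Rgt_not_eq, weight_pos. Qed.

Definition embed_const (s : R) : R := sqrt (zeta_bound s).

(** Cauchy-Schwarz against the inverse weights, which are summable when [2 * s > 1]. *)
Lemma sob_le_l1 s a A : 1 / 2 < s -> sob_le s a A -> l1_le a (embed_const s * A).
Proof.
  intros Hs [HA Ha] N.
  assert (HZ : 0 <= zeta_bound s).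
  { unfold zeta_bound. assert (0 < / (2 * s - 1)) by (apply Rinv_0_lt_compat; lra). lra. }
  apply Rsqr_incr_0_var; [|apply Rmult_le_pos; [apply sqrt_pos|exact HA]].
  rewrite Rsqr_mult. unfold embed_const. rewrite Rsqr_sqrt by exact HZ.
  rewrite !Rsqr_pow2.
  rewrite (sum_n_ext _ (fun k => / weight s k * (weight s k * Cmod (a k)))).
  2:{ intros k. apply (Rmult_inv_weight s k (Cmod (a k))). }
  eapply Rle_trans; [apply sum_n_cauchy_schwarz; intros; left; apply Rinv_0_lt_compat, weight_pos|].
  rewrite (sum_n_ext (fun k => / weight s k * (weight s k * Cmod (a k)) ^ 2) (sob_term s a)).
  2:{ intros k. unfold sob_term.
      transitivity (weight s k * (/ weight s k * (weight s k * Cmod (a k) ^ 2))).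
      - simpl. ring.
      - rewrite <- Rmult_inv_weight. reflexivity. }
  apply Rmult_le_compat.
  - apply sum_n_nonneg. intros; left; apply Rinv_0_lt_compat, weight_pos.
  - apply sum_n_nonneg, sob_term_pos.
  - apply sum_inv_weight, Hs.
  - apply Ha.
Qed.


(** * Absolutely convergent complex series *)

Definition Csum (a : nat -> C) (n : nat) : C := sum_n (G := C_AbelianMonoid) a n.

Lemma Csum_Sn a n : Csum a (S n) = (Csum a n + a (S n))%C.
Proof. exact (sum_Sn a n). Qed.

Lemma Csum_O a : Csum a 0 = a O.
Proof. exact (sum_O a). Qed.

Lemma Csum_ext a b n : (forall k, (k <= n)%nat -> a k = b k) -> Csum a n = Csum b n.
Proof. exact (sum_n_ext_loc a b n). Qed.

Lemma Csum_plus a b n : Csum (fun k => (a k + b k)%C) n = (Csum a n + Csum b n)%C.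
Proof. exact (sum_n_plus a b n). Qed.

Lemma Csum_scal (c : C) a n : Csum (fun k => (c * a k)%C) n = (c * Csum a n)%C.
Proof. exact (sum_n_mult_l (K := C_Ring) c a n). Qed.

Lemma Csum_components a n :
  Csum a n = (sum_n (fun k => Re (a k)) n, sum_n (fun k => Im (a k)) n).
Proof.
  induction n as [|n IH].
  - rewrite Csum_O, !sum_O. apply surjective_pairing.
  - rewrite Csum_Sn, !sum_Sn, IH. reflexivity.
Qed.

Lemma Cmod_Csum a n : Cmod (Csum a n) <= sum_n (fun k => Cmod (a k)) n.
Proof.
  induction n as [|n IH].
  - rewrite Csum_O, sum_O. lra.
  - rewrite Csum_Sn, sum_Sn. eapply Rle_trans; [apply Cmod_triangle|].
    apply Rplus_le_compat_r, IH.
Qed.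

Definition abs_summable (a : nat -> C) : Prop := ex_series (fun k => Cmod (a k)).

Lemma abs_summable_Re a : abs_summable a -> ex_series (fun k => Re (a k)).
Proof.
  apply (ex_series_le (V := R_CompleteNormedModule)). intros k.
  apply Rle_trans with (2 := Rmax_Cmod (a k)). apply Rmax_l.
Qed.

Lemma abs_summable_Im a : abs_summable a -> ex_series (fun k => Im (a k)).
Proof.
  apply (ex_series_le (V := R_CompleteNormedModule)). intros k.
  apply Rle_trans with (2 := Rmax_Cmod (a k)). apply Rmax_r.
Qed.

Lemma abs_summable_dom a b K :
  (forall k, Cmod (b k) <= K * Cmod (a k)) -> abs_summable a -> abs_summable b.
Proof.
  intros H Ha. apply (ex_series_le (V := R_CompleteNormedModule) _ (fun k => K * Cmod (a k))).
  - intros k. unfold norm; simpl. rewrite Rabs_pos_eq by apply Cmod_ge_0. apply H.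
  - apply (ex_series_scal (V := R_NormedModule) K (fun k => Cmod (a k))), Ha.
Qed.

Lemma abs_summable_scal c a : abs_summable a -> abs_summable (fun k => (c * a k)%C).
Proof. apply abs_summable_dom with (K := Cmod c). intros k. rewrite Cmod_mult. lra. Qed.

Lemma abs_summable_plus a b :
  abs_summable a -> abs_summable b -> abs_summable (fun k => (a k + b k)%C).
Proof.
  intros Ha Hb.
  apply (ex_series_le (V := R_CompleteNormedModule) _ (fun k => Cmod (a k) + Cmod (b k))).
  - intros k. unfold norm; simpl. rewrite Rabs_pos_eq by apply Cmod_ge_0. apply Cmod_triangle.
  - apply (ex_series_plus (V := R_NormedModule)); assumption.
Qed.

(** Convergence in the plane is convergence of both components, which ties the
    componentwise sum [CSeries] to convergent series in a normed module. *)
Lemma is_series_C (a : nat -> C) (l : C) :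
  is_series (V := C_R_NormedModule) a l <->
  is_series (fun k => Re (a k)) (Re l) /\ is_series (fun k => Im (a k)) (Im l).
Proof.
  assert (E : forall n, sum_n (G := NormedModule.AbelianMonoid _ C_R_NormedModule) a n
    = (sum_n (fun k => Re (a k)) n, sum_n (fun k => Im (a k)) n)).
  { exact (Csum_components a). }
  unfold is_series. split.
  - intros H. split.
    + apply filterlim_locally. intros eps.
      generalize (proj1 (filterlim_locally _ _) H eps).
      apply filter_imp. intros n Hn. rewrite E in Hn. apply Hn.
    + apply filterlim_locally. intros eps.
      generalize (proj1 (filterlim_locally _ _) H eps).
      apply filter_imp. intros n Hn. rewrite E in Hn. apply Hn.
  - intros [H1 H2]. apply filterlim_locally. intros eps.
    generalize (filter_and _ _ (proj1 (filterlim_locally _ _) H1 eps)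
      (proj1 (filterlim_locally _ _) H2 eps)).
    apply filter_imp. intros n [Hn1 Hn2]. rewrite E. split; assumption.
Qed.

Lemma is_series_CSeries (a : nat -> C) : abs_summable a ->
  is_series (V := C_R_NormedModule) a (CSeries a).
Proof.
  intros H. apply is_series_C. split; apply Series_correct;
    [apply abs_summable_Re|apply abs_summable_Im]; exact H.
Qed.

Lemma CSeries_unique (a : nat -> C) (l : C) :
  is_series (V := C_R_NormedModule) a l -> CSeries a = l.
Proof.
  intros H. apply is_series_C in H. destruct H as [H1 H2]. unfold CSeries.
  rewrite (is_series_unique _ _ H1), (is_series_unique _ _ H2). symmetry.
  apply surjective_pairing.
Qed.

Lemma CSeries_ext a b : (forall k, a k = b k) -> CSeries a = CSeries b.
Proof. intros H. unfold CSeries. f_equal; apply Series_ext; intros; rewrite H; reflexivity. Qed.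

Lemma CSeries_plus a b : abs_summable a -> abs_summable b ->
  CSeries (fun k => (a k + b k)%C) = (CSeries a + CSeries b)%C.
Proof.
  intros Ha Hb. apply CSeries_unique.
  exact (is_series_plus (V := C_R_NormedModule) a b _ _
    (is_series_CSeries a Ha) (is_series_CSeries b Hb)).
Qed.

Lemma CSeries_scal c a : abs_summable a ->
  CSeries (fun k => (c * a k)%C) = (c * CSeries a)%C.
Proof.
  intros Ha. apply CSeries_unique.
  exact (is_series_scal (V := C_NormedModule) c a _ (is_series_CSeries a Ha)).
Qed.

Lemma Cmod_Csum_tail (a : nat -> C) n m : (n <= m)%nat ->
  Cmod (Csum a m - Csum a n) <= sum_n (fun k => Cmod (a k)) m - sum_n (fun k => Cmod (a k)) n.
Proof.
  intros H. induction H as [|m H IH].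
  - replace (Csum a n - Csum a n)%C with (RtoC 0) by ring. rewrite Cmod_0. lra.
  - rewrite Csum_Sn, sum_Sn.
    replace (Csum a m + a (S m) - Csum a n)%C with ((Csum a m - Csum a n) + a (S m))%C by ring.
    eapply Rle_trans; [apply Cmod_triangle|].
    apply Rle_trans with (1 := Rplus_le_compat_r _ _ _ IH).
    right. change (plus (sum_n (fun k => Cmod (a k)) m) (Cmod (a (S m))))
      with (sum_n (fun k => Cmod (a k)) m + Cmod (a (S m))). ring.
Qed.

Lemma CSeries_approx (a : nat -> C) n eps : abs_summable a -> 0 < eps ->
  exists m, (n <= m)%nat /\ Cmod (Csum a m - CSeries a) < eps.
Proof.
  intros Ha Heps.
  destruct (C_ball_Cmod (CSeries a) eps Heps) as [e He].
  destruct (proj1 (filterlim_locally _ _) (is_series_CSeries a Ha) e) as [N HN].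
  exists (max n N). split; [lia|]. apply He, HN. lia.
Qed.

Lemma Cmod_CSeries_tail (a : nat -> C) n : abs_summable a ->
  Cmod (Csum a n - CSeries a) <= Series (fun k => Cmod (a k)) - sum_n (fun k => Cmod (a k)) n.
Proof.
  intros Ha. apply Rle_plus_epsilon. intros eps Heps.
  destruct (CSeries_approx a n eps Ha Heps) as [m [Hm Hd]].
  assert (H1 := Cmod_Csum_tail a n m Hm). rewrite Cmod_minus_sym in H1.
  assert (H2 := sum_n_le_Series _ m (fun k => Cmod_ge_0 (a k)) Ha).
  assert (H3 := Cmod_triangle (Csum a n - Csum a m) (Csum a m - CSeries a)).
  replace (Csum a n - Csum a m + (Csum a m - CSeries a))%C
    with (Csum a n - CSeries a)%C in H3 by ring.
  lra.
Qed.

Lemma Cmod_CSeries a : abs_summable a -> Cmod (CSeries a) <= Series (fun k => Cmod (a k)).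
Proof.
  intros Ha.
  assert (H := Cmod_CSeries_tail a 0 Ha). rewrite Csum_O, sum_O, Cmod_minus_sym in H.
  assert (HT := Cmod_triangle (CSeries a - a O) (a O)).
  replace (CSeries a - a O + a O)%C with (CSeries a) in HT by ring. lra.
Qed.

Lemma CSeries_single a m : (forall k, k <> m -> a k = RtoC 0) -> CSeries a = a m.
Proof.
  intros H.
  assert (HS : forall f : C -> R, f (RtoC 0) = 0 -> Series (fun k => f (a k)) = f (a m)).
  { intros f Hf. apply is_series_unique.
    apply filterlim_ext_loc with (fun _ : nat => f (a m)); [|apply filterlim_const].
    exists m. intros n Hn. induction Hn as [|n Hn IH].
    - assert (Hlt : forall p, (p < m)%nat -> sum_n (fun k => f (a k)) p = 0).
      { intros p Hp. rewrite (sum_n_ext_loc _ (fun _ => 0)).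
        - rewrite sum_n_const. apply Rmult_0_r.
        - intros q Hq. rewrite H by lia. exact Hf. }
      destruct m as [|m]; [rewrite sum_O; reflexivity|].
      rewrite sum_Sn, Hlt by lia. symmetry. apply Rplus_0_l.
    - rewrite sum_Sn, <- IH, (H (S n)), Hf by lia. symmetry. apply Rplus_0_r. }
  unfold CSeries. rewrite !HS by reflexivity. symmetry. apply surjective_pairing.
Qed.

Lemma CSeries_zero a : (forall k, a k = RtoC 0) -> CSeries a = RtoC 0.
Proof. intros H. rewrite (CSeries_single a 0); auto. Qed.


(** * The cubic nonlinearity on coefficient sequences *)

Definition conv (b c : nat -> C) (m : nat) : C :=
  Csum (fun i => (b i * c (m - i)%nat)%C) m.

(** The terms of the Fourier coefficients of [i d/dx P (a d/dx^-1 (b c))], where [a] carries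
    negative wavenumbers.  Indices start at 0 for the wavenumber 1: [conv b c m] is the
    coefficient of the product at the wavenumber [m + 2], and the quotient is the output
    wavenumber over that of the inner product. *)
Definition tri_term (a b c : nat -> C) (n k : nat) : C :=
  (Ci * RtoC (INR (S n) / INR (S (S (n + k)))) * (a k * conv b c (n + k)))%C.

Definition tri (a b c : nat -> C) (n : nat) : C := CSeries (tri_term a b c n).

Lemma l1_le_nonneg a A : l1_le a A -> 0 <= A.
Proof.
  intros H. eapply Rle_trans; [|apply (H O)].
  apply (sum_n_nonneg (fun k => Cmod (a k))). intros; apply Cmod_ge_0.
Qed.

Lemma l1_le_summable a A : l1_le a A -> abs_summable a.
Proof. intros H. apply (series_of_bounded _ A); [intros; apply Cmod_ge_0|exact H]. Qed.

Lemma summable_l1_le a : abs_summable a -> l1_le a (Series (fun k => Cmod (a k))).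
Proof. intros H N. apply sum_n_le_Series; [intros; apply Cmod_ge_0|exact H]. Qed.

Lemma Cmod_conv b c m :
  Cmod (conv b c m) <= convR (fun k => Cmod (b k)) (fun k => Cmod (c k)) m.
Proof.
  unfold conv, convR. eapply Rle_trans; [apply Cmod_Csum|].
  right. apply sum_n_ext. intros k. apply Cmod_mult.
Qed.

Lemma conv_l1_le b c B C : l1_le b B -> l1_le c C -> l1_le (conv b c) (B * C).
Proof.
  intros Hb Hc N.
  apply Rle_trans with (sum_n (convR (fun k => Cmod (b k)) (fun k => Cmod (c k))) N).
  - apply sum_n_le. intros; apply Cmod_conv.
  - apply sum_convR_le; auto using Cmod_ge_0.
Qed.

Lemma l1_le_coef a A k : l1_le a A -> Cmod (a k) <= A.
Proof.
  intros H. eapply Rle_trans; [|apply (H k)].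
  apply (sum_n_term_le (fun k => Cmod (a k))); auto using Cmod_ge_0.
Qed.

Lemma Cmod_Ci : Cmod Ci = 1.
Proof. unfold Cmod, Ci; simpl. replace (0 * (0 * 1) + 1 * (1 * 1)) with 1 by ring. apply sqrt_1. Qed.

Lemma ratio_le_1 n k : 0 <= INR (S n) / INR (S (S (n + k))) <= 1.
Proof.
  assert (H1 : 0 < INR (S n)) by (apply lt_0_INR; lia).
  assert (H2 : 0 < INR (S (S (n + k)))) by (apply lt_0_INR; lia).
  assert (H3 : INR (S n) <= INR (S (S (n + k)))) by (apply le_INR; lia).
  split.
  - apply Rdiv_le_0_compat; lra.
  - apply Rmult_le_reg_r with (1 := H2). unfold Rdiv.
    rewrite Rmult_assoc, Rinv_l by lra. lra.
Qed.

(** The derivative in front of the projected product is absorbed by the inverse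
    derivative inside: the output wavenumber never exceeds that of the inner factor. *)
Lemma Cmod_tri_term a b c n k :
  Cmod (tri_term a b c n k) <= Cmod (a k) * Cmod (conv b c (n + k)).
Proof.
  unfold tri_term. rewrite !Cmod_mult, Cmod_R.
  rewrite Cmod_Ci, Rmult_1_l.
  destruct (ratio_le_1 n k) as [H1 H2]. rewrite Rabs_pos_eq by exact H1.
  rewrite <- (Rmult_1_l (Cmod (a k) * _)) at 2.
  apply Rmult_le_compat_r; [|exact H2].
  apply Rmult_le_pos; apply Cmod_ge_0.
Qed.

Lemma tri_summable a b c A B C n :
  l1_le a A -> l1_le b B -> l1_le c C -> abs_summable (tri_term a b c n).
Proof.
  intros Ha Hb Hc. apply abs_summable_dom with (a := a) (K := B * C).
  - intros k. eapply Rle_trans; [apply Cmod_tri_term|]. rewrite Rmult_comm.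
    apply Rmult_le_compat_r; [apply Cmod_ge_0|].
    apply l1_le_coef, conv_l1_le; assumption.
  - apply l1_le_summable with A, Ha.
Qed.

(** One of the two inner wavenumbers is at least half of the output wavenumber. *)
Lemma root_weight_split s n k i : 0 <= s -> (i <= n + k)%nat ->
  root_weight s n <= Rpower 2 s * (root_weight s i + root_weight s (n + k - i)).
Proof.
  intros Hs Hi. unfold root_weight.
  assert (Hp : forall j, 0 < INR (S j)) by (intros; apply lt_0_INR; lia).
  assert (Hmax : forall j, (S n <= 2 * S j)%nat -> Rpower (INR (S n)) s <= Rpower 2 s * Rpower (INR (S j)) s).
  { intros j Hj. rewrite Rpower_mult_distr by (lra || apply Hp).
    apply Rle_Rpower_l; [exact Hs|]. split; [apply Hp|].
    apply le_INR in Hj. rewrite mult_INR in Hj. exact Hj. }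
  assert (H2 : 0 < Rpower 2 s) by apply exp_pos.
  assert (Hi' : 0 < Rpower (INR (S i)) s) by apply exp_pos.
  assert (Hj' : 0 < Rpower (INR (S (n + k - i))) s) by apply exp_pos.
  destruct (Nat.le_gt_cases (S n) (2 * S i)) as [H|H].
  - eapply Rle_trans; [apply Hmax, H|]. apply Rmult_le_compat_l; lra.
  - eapply Rle_trans; [apply (Hmax (n + k - i)%nat); lia|]. apply Rmult_le_compat_l; lra.
Qed.

Definition tri_const (s : R) : R := Rpower 2 s * 2.

(** The tame trilinear estimate: the Sobolev weight always falls on one of the two
    inner factors, and the others are measured in the Wiener algebra. *)
Lemma tri_bound s a b c A1 B1 C1 B C :
  0 <= s -> l1_le a A1 -> l1_le b B1 -> l1_le c C1 -> sob_le s b B -> sob_le s c C ->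
  sob_le s (tri a b c) (tri_const s * (A1 * (B * C1 + B1 * C))).
Proof.
  intros Hs Ha Hb Hc HB HC. apply sob_le_l2.
  set (x := fun k => Cmod (b k)). set (y := fun k => Cmod (c k)).
  set (x' := fun k => root_weight s k * x k). set (y' := fun k => root_weight s k * y k).
  assert (Hx : forall k, 0 <= x k) by (intros; apply Cmod_ge_0).
  assert (Hy : forall k, 0 <= y k) by (intros; apply Cmod_ge_0).
  assert (Hx' : forall k, 0 <= x' k)
    by (intros; apply Rmult_le_pos; [left; apply root_weight_pos|apply Hx]).
  assert (Hy' : forall k, 0 <= y' k)
    by (intros; apply Rmult_le_pos; [left; apply root_weight_pos|apply Hy]).
  apply sob_le_l2 in HB. apply sob_le_l2 in HC.
  set (z := fun m => convR x' y m + convR x y' m).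
  assert (Hz : l2_le z (2 * (B * C1 + B1 * C))).
  { apply l2_le_plus.
    - apply l2_le_convR; auto.
    - rewrite (Rmult_comm B1).
      assert (H := l2_le_convR y' x C B1 Hy' Hx HC Hb).
      rewrite <- (Rmult_1_l (C * B1)). apply l2_le_dom with (x := convR y' x); [lra| |exact H].
      intros k. rewrite Rmult_1_l, (convR_comm y' x), Rabs_pos_eq; [lra|].
      apply convR_pos; assumption. }
  assert (Hz0 : forall k, 0 <= z k).
  { intros k. unfold z. apply Rplus_le_le_0_compat; apply convR_pos; assumption. }
  destruct (l2_le_correlation (fun k => Cmod (a k)) z A1 _ (fun k => Cmod_ge_0 (a k)) Hz0 Ha Hz)
    as [Hex Hcor].
  unfold tri_const. replace (Rpower 2 s * 2 * (A1 * (B * C1 + B1 * C)))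
    with (Rpower 2 s * (A1 * (2 * (B * C1 + B1 * C)))) by ring.
  apply l2_le_dom with (3 := Hcor); [left; apply exp_pos|].
  intros n. rewrite Rabs_pos_eq.
  2:{ apply Rmult_le_pos; [left; apply root_weight_pos|apply Cmod_ge_0]. }
  assert (Hsum := tri_summable a b c A1 B1 C1 n Ha Hb Hc).
  apply Rle_trans with (root_weight s n * Series (fun k => Cmod (tri_term a b c n k))).
  { apply Rmult_le_compat_l; [left; apply root_weight_pos|]. apply Cmod_CSeries, Hsum. }
  rewrite <- !Series_scal_l. apply Series_le.
  2:{ apply (ex_series_scal (V := R_NormedModule) (Rpower 2 s)), Hex. }
  intros k. split.
  { apply Rmult_le_pos; [left; apply root_weight_pos|apply Cmod_ge_0]. }
  assert (Hw : root_weight s n * convR x y (n + k) <= Rpower 2 s * z (n + k)%nat).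
  { unfold z, convR. rewrite <- sum_n_scal_R, <- sum_n_plus_R, <- sum_n_scal_R.
    apply sum_n_le. intros i Hi. unfold x', y'.
    replace (Rpower 2 s * (root_weight s i * x i * y (n + k - i)%nat
        + x i * (root_weight s (n + k - i) * y (n + k - i)%nat)))
      with (Rpower 2 s * (root_weight s i + root_weight s (n + k - i))
        * (x i * y (n + k - i)%nat)) by ring.
    apply Rmult_le_compat_r; [apply Rmult_le_pos; auto|]. apply root_weight_split; assumption. }
  apply Rle_trans with (Cmod (a k) * (root_weight s n * convR x y (n + k))).
  - replace (Cmod (a k) * (root_weight s n * convR x y (n + k)))
      with (root_weight s n * (Cmod (a k) * convR x y (n + k))) by ring.
    apply Rmult_le_compat_l; [left; apply root_weight_pos|].
    eapply Rle_trans; [apply Cmod_tri_term|].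
    apply Rmult_le_compat_l; [apply Cmod_ge_0|apply Cmod_conv].
  - replace (Rpower 2 s * (Cmod (a k) * z (n + k)%nat))
      with (Cmod (a k) * (Rpower 2 s * z (n + k)%nat)) by ring.
    apply Rmult_le_compat_l; [apply Cmod_ge_0|exact Hw].
Qed.

Lemma conv_minus_l b b' c m :
  conv (fun k => (b k - b' k)%C) c m = (conv b c m - conv b' c m)%C.
Proof.
  unfold conv.
  replace (Csum (fun i => (b i * c (m - i)%nat)%C) m - Csum (fun i => (b' i * c (m - i)%nat)%C) m)%C
    with (Csum (fun i => (b i * c (m - i)%nat)%C) m + (- 1) * Csum (fun i => (b' i * c (m - i)%nat)%C) m)%C
    by ring.
  rewrite <- Csum_scal, <- Csum_plus. apply Csum_ext. intros; ring.
Qed.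

Lemma conv_minus_r b c c' m :
  conv b (fun k => (c k - c' k)%C) m = (conv b c m - conv b c' m)%C.
Proof.
  unfold conv.
  replace (Csum (fun i => (b i * c (m - i)%nat)%C) m - Csum (fun i => (b i * c' (m - i)%nat)%C) m)%C
    with (Csum (fun i => (b i * c (m - i)%nat)%C) m + (- 1) * Csum (fun i => (b i * c' (m - i)%nat)%C) m)%C
    by ring.
  rewrite <- Csum_scal, <- Csum_plus. apply Csum_ext. intros; ring.
Qed.

Lemma CSeries_minus a b : abs_summable a -> abs_summable b ->
  CSeries (fun k => (a k - b k)%C) = (CSeries a - CSeries b)%C.
Proof.
  intros Ha Hb.
  rewrite (CSeries_ext _ (fun k => a k + (- 1) * b k)%C) by (intros; ring).
  rewrite CSeries_plus, CSeries_scal by (auto using abs_summable_scal). ring.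
Qed.

(** Trilinearity, with the arguments changed one at a time. *)
Lemma tri_diff a b c a' b' c' A B C A' B' C' n :
  l1_le a A -> l1_le b B -> l1_le c C -> l1_le a' A' -> l1_le b' B' -> l1_le c' C' ->
  (tri a b c n - tri a' b' c' n
   = tri (fun k => a k - a' k) b c n + tri a' (fun k => b k - b' k) c n
     + tri a' b' (fun k => c k - c' k) n)%C.
Proof.
  intros Ha Hb Hc Ha' Hb' Hc'. unfold tri.
  rewrite (CSeries_ext (tri_term (fun k => a k - a' k)%C b c n)
    (fun k => tri_term a b c n k - tri_term a' b c n k)%C)
    by (intros; unfold tri_term; ring).
  rewrite (CSeries_ext (tri_term a' (fun k => b k - b' k)%C c n)
    (fun k => tri_term a' b c n k - tri_term a' b' c n k)%C)
    by (intros; unfold tri_term; rewrite conv_minus_l; ring).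
  rewrite (CSeries_ext (tri_term a' b' (fun k => c k - c' k)%C n)
    (fun k => tri_term a' b' c n k - tri_term a' b' c' n k)%C)
    by (intros; unfold tri_term; rewrite conv_minus_r; ring).
  rewrite !CSeries_minus; try (eapply tri_summable; eassumption). ring.
Qed.


(** * The evolution equations as an ordinary differential equation in phase space *)

Definition conj_seq (a : nat -> C) (k : nat) : C := Cconj (a k).

(** The multiplier of [- gamma - i nu d/dx^-2] at the wavenumbers [n + 1] and [- (n + 1)]. *)
Definition symbol (gamma nu : R) (n : nat) : C :=
  (- RtoC gamma + Ci * RtoC nu * RtoC (/ INR (S n) ^ 2))%C.

Definition coef_field (alpha beta gamma nu : R) (p r : nat -> C) (n : nat) : C :=
  (RtoC alpha * tri (conj_seq p) p p n + RtoC beta * tri r p (conj_seq r) n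
   + symbol gamma nu n * p n)%C.

Lemma Cmod_Cconj z : Cmod (Cconj z) = Cmod z.
Proof. unfold Cmod, Cconj; simpl. f_equal. ring. Qed.

Lemma Cmod_symbol gamma nu n : Cmod (symbol gamma nu n) <= Rabs gamma + Rabs nu.
Proof.
  unfold symbol. eapply Rle_trans; [apply Cmod_triangle|].
  rewrite Cmod_opp, !Cmod_mult, Cmod_Ci, !Cmod_R, Rmult_1_l.
  apply Rplus_le_compat_l. rewrite <- (Rmult_1_r (Rabs nu)) at 2.
  apply Rmult_le_compat_l; [apply Rabs_pos|].
  assert (H1 : 1 <= INR (S n)) by (rewrite S_INR; generalize (pos_INR n); lra).
  assert (H2 : 1 <= INR (S n) ^ 2) by nra.
  rewrite Rabs_pos_eq.
  - rewrite <- Rinv_1. apply Rinv_le_contravar; lra.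
  - left. apply Rinv_0_lt_compat. lra.
Qed.

Lemma sob_le_conj s a A : sob_le s a A -> sob_le s (conj_seq a) A.
Proof.
  intros H. rewrite <- (Rmult_1_l A). apply sob_le_dom with (3 := H); [lra|].
  intros k. unfold conj_seq. rewrite Cmod_Cconj. lra.
Qed.

Lemma l1_le_conj a A : l1_le a A -> l1_le (conj_seq a) A.
Proof.
  intros H N. rewrite (sum_n_ext _ (fun k => Cmod (a k))); [apply H|].
  intros k. apply Cmod_Cconj.
Qed.

Lemma sob_le_ext s a b A : (forall k, a k = b k) -> sob_le s a A -> sob_le s b A.
Proof.
  intros H. assert (E : a = b) by (apply functional_extensionality, H).
  rewrite E. tauto.
Qed.

Lemma sob_le_symbol s gamma nu p P : sob_le s p P ->
  sob_le s (fun n => (symbol gamma nu n * p n)%C) ((Rabs gamma + Rabs nu) * P).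
Proof.
  apply sob_le_dom.
  - generalize (Rabs_pos gamma) (Rabs_pos nu). lra.
  - intros k. rewrite Cmod_mult. apply Rmult_le_compat_r; [apply Cmod_ge_0|apply Cmod_symbol].
Qed.

Lemma sob_le_Rscal s a A (c : R) : sob_le s a A -> sob_le s (fun k => (RtoC c * a k)%C) (Rabs c * A).
Proof. rewrite <- Cmod_R. apply sob_le_scal. Qed.

Lemma tri_const_pos s : 0 < tri_const s.
Proof. unfold tri_const. generalize (exp_pos (s * ln 2)). fold (Rpower 2 s). lra. Qed.

(** In each cubic term the tame estimate leaves one factor in the Sobolev norm and two in
    the Wiener norm, whence linear growth at a rate quadratic in the Wiener norms. *)
Lemma coef_field_growth s alpha beta gamma nu p r N P1 R1 :
  0 <= s -> sob_le s p N -> sob_le s r N -> l1_le p P1 -> l1_le r R1 ->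
  sob_le s (coef_field alpha beta gamma nu p r)
    ((2 * (tri_const s * (Rabs alpha + Rabs beta)) * (P1 ^ 2 + R1 ^ 2)
      + (Rabs gamma + Rabs nu)) * N).
Proof.
  intros Hs HP HR Hp Hr.
  assert (HN := proj1 HP).
  assert (P0 := l1_le_nonneg _ _ Hp). assert (R0 := l1_le_nonneg _ _ Hr).
  assert (H1 := sob_le_Rscal _ _ _ alpha (tri_bound s (conj_seq p) p p P1 P1 P1 N N Hs
    (l1_le_conj _ _ Hp) Hp Hp HP HP)).
  assert (H2 := sob_le_Rscal _ _ _ beta (tri_bound s r p (conj_seq r) R1 P1 R1 N N Hs
    Hr Hp (l1_le_conj _ _ Hr) HP (sob_le_conj _ _ _ HR))).
  assert (H3 := sob_le_symbol s gamma nu p N HP).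
  apply sob_le_incr with (1 := sob_le_plus _ _ _ _ _ (sob_le_plus _ _ _ _ _ H1 H2) H3).
  rewrite (Rmult_plus_distr_r _ (Rabs gamma + Rabs nu)). apply Rplus_le_compat_r.
  assert (Ht := tri_const_pos s). assert (Ha := Rabs_pos alpha). assert (Hb := Rabs_pos beta).
  replace (2 * (tri_const s * (Rabs alpha + Rabs beta)) * (P1 ^ 2 + R1 ^ 2) * N)
    with (Rabs alpha * (tri_const s * (N * (2 * (P1 ^ 2 + R1 ^ 2))))
      + Rabs beta * (tri_const s * (N * (2 * (P1 ^ 2 + R1 ^ 2))))) by ring.
  apply Rplus_le_compat; (apply Rmult_le_compat_l; [assumption|]);
    (apply Rmult_le_compat_l; [lra|]).
  - replace (P1 * (N * P1 + P1 * N)) with (N * (2 * P1 ^ 2)) by ring.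
    apply Rmult_le_compat_l; [exact HN|]. nra.
  - replace (R1 * (N * R1 + P1 * N)) with (N * (R1 ^ 2 + R1 * P1)) by ring.
    apply Rmult_le_compat_l; [exact HN|]. nra.
Qed.

Definition tri_sob_const (s : R) : R := tri_const s * (2 * embed_const s ^ 2).

Lemma tri_sob s a b c A B D : 1 / 2 < s ->
  sob_le s a A -> sob_le s b B -> sob_le s c D ->
  sob_le s (tri a b c) (tri_sob_const s * (A * B * D)).
Proof.
  intros Hs Ha Hb Hc.
  apply sob_le_incr with (1 := tri_bound s a b c _ _ _ _ _ ltac:(lra)
    (sob_le_l1 _ _ _ Hs Ha) (sob_le_l1 _ _ _ Hs Hb) (sob_le_l1 _ _ _ Hs Hc) Hb Hc).
  right. unfold tri_sob_const. ring.
Qed.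

Lemma tri_sob_diff s a b c a' b' c' M D : 1 / 2 < s ->
  sob_le s a M -> sob_le s b M -> sob_le s c M ->
  sob_le s a' M -> sob_le s b' M -> sob_le s c' M ->
  sob_le s (fun k => (a k - a' k)%C) D -> sob_le s (fun k => (b k - b' k)%C) D ->
  sob_le s (fun k => (c k - c' k)%C) D ->
  sob_le s (fun n => (tri a b c n - tri a' b' c' n)%C) (3 * tri_sob_const s * M ^ 2 * D).
Proof.
  intros Hs Ha Hb Hc Ha' Hb' Hc' Da Db Dc.
  apply sob_le_ext with (fun n => (tri (fun k => a k - a' k) b c n
    + tri a' (fun k => b k - b' k) c n + tri a' b' (fun k => c k - c' k) n)%C).
  { intros n. symmetry.
    eapply tri_diff; eapply sob_le_l1; eassumption. }
  assert (H := sob_le_plus _ _ _ _ _ (sob_le_plus _ _ _ _ _ (tri_sob s _ _ _ _ _ _ Hs Da Hb Hc)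
    (tri_sob s _ _ _ _ _ _ Hs Ha' Db Hc)) (tri_sob s _ _ _ _ _ _ Hs Ha' Hb' Dc)).
  apply sob_le_incr with (1 := H). right. ring.
Qed.

Definition coef_field_lip (s alpha beta gamma nu M : R) : R :=
  3 * tri_sob_const s * M ^ 2 * (Rabs alpha + Rabs beta) + (Rabs gamma + Rabs nu).

Lemma coef_field_lipschitz s alpha beta gamma nu p r p' r' M D : 1 / 2 < s ->
  sob_le s p M -> sob_le s r M -> sob_le s p' M -> sob_le s r' M ->
  sob_le s (fun k => (p k - p' k)%C) D -> sob_le s (fun k => (r k - r' k)%C) D ->
  sob_le s (fun n => (coef_field alpha beta gamma nu p r n - coef_field alpha beta gamma nu p' r' n)%C)
    (coef_field_lip s alpha beta gamma nu M * D).
Proof.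
  intros Hs Hp Hr Hp' Hr' Dp Dr.
  assert (Dc : forall a a', sob_le s (fun k => (a k - a' k)%C) D ->
    sob_le s (fun k => (conj_seq a k - conj_seq a' k)%C) D).
  { intros a a' H. apply sob_le_ext with (2 := sob_le_conj _ _ _ H). intros k. unfold conj_seq.
    unfold Cconj, Cminus, Cplus, Copp; simpl. f_equal; ring. }
  assert (H1 := sob_le_Rscal _ _ _ alpha (tri_sob_diff s _ _ _ _ _ _ M D Hs
    (sob_le_conj _ _ _ Hp) Hp Hp (sob_le_conj _ _ _ Hp') Hp' Hp' (Dc _ _ Dp) Dp Dp)).
  assert (H2 := sob_le_Rscal _ _ _ beta (tri_sob_diff s _ _ _ _ _ _ M D Hs
    Hr Hp (sob_le_conj _ _ _ Hr) Hr' Hp' (sob_le_conj _ _ _ Hr') Dr Dp (Dc _ _ Dr))).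
  assert (H3 := sob_le_symbol s gamma nu _ D Dp).
  assert (H := sob_le_plus _ _ _ _ _ (sob_le_plus _ _ _ _ _ H1 H2) H3).
  eapply sob_le_ext; [|eapply sob_le_incr; [exact H|]].
  - intros k. unfold coef_field. ring.
  - right. unfold coef_field_lip. ring.
Qed.

Lemma coef_field_ex s alpha beta gamma nu p r : 1 / 2 < s ->
  ex_series (sob_term s p) -> ex_series (sob_term s r) ->
  ex_series (sob_term s (coef_field alpha beta gamma nu p r)).
Proof.
  intros Hs Hp Hr. apply ex_sob_le in Hp. apply ex_sob_le in Hr.
  set (N := sqrt (Series (sob_term s p)) + sqrt (Series (sob_term s r))).
  assert (H1 := sqrt_pos (Series (sob_term s p))). assert (H2 := sqrt_pos (Series (sob_term s r))).
  apply sob_le_incr with (B := N) in Hp; [|unfold N; lra].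
  apply sob_le_incr with (B := N) in Hr; [|unfold N; lra].
  eapply sob_le_ex. eapply (coef_field_growth s); try eassumption; [lra| |];
    apply sob_le_l1; eassumption.
Qed.

Lemma tri_zero b c n : tri (fun _ => RtoC 0) b c n = RtoC 0.
Proof. apply CSeries_zero. intros k. unfold tri_term. ring. Qed.

Lemma coef_field_zero alpha beta gamma nu n :
  coef_field alpha beta gamma nu (fun _ => RtoC 0) (fun _ => RtoC 0) n = RtoC 0.
Proof.
  unfold coef_field. replace (conj_seq (fun _ => RtoC 0)) with (fun _ : nat => RtoC 0).
  - rewrite !tri_zero. ring.
  - apply functional_extensionality. intros k. unfold conj_seq, Cconj, RtoC; simpl.
    rewrite Ropp_0. reflexivity.
Qed.

(** Reflecting [v] to positive wavenumbers makes the system symmetric: the second equation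
    is the first one with the unknowns exchanged. *)
Definition flow_field (s alpha beta gamma nu : R) (x : phase_space s) : phase_space s :=
  (ell2_make s (coef_field alpha beta gamma nu (fst x) (snd x)),
   ell2_make s (coef_field alpha beta gamma nu (snd x) (fst x))).

Lemma phase_norm_fst s (x : phase_space s) : ell2_norm (fst x) <= norm x.
Proof.
  change (ell2_norm (fst x) <= sqrt (ell2_norm (fst x) ^ 2 + ell2_norm (snd x) ^ 2)).
  rewrite <- (sqrt_pow2 (ell2_norm (fst x))) at 1 by apply sqrt_pos.
  apply sqrt_le_1_alt. generalize (pow2_ge_0 (ell2_norm (snd x))). lra.
Qed.

Lemma phase_norm_snd s (x : phase_space s) : ell2_norm (snd x) <= norm x.
Proof.
  change (ell2_norm (snd x) <= sqrt (ell2_norm (fst x) ^ 2 + ell2_norm (snd x) ^ 2)).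
  rewrite <- (sqrt_pow2 (ell2_norm (snd x))) at 1 by apply sqrt_pos.
  apply sqrt_le_1_alt. generalize (pow2_ge_0 (ell2_norm (fst x))). lra.
Qed.

Lemma phase_norm_le s (x : phase_space s) : norm x <= ell2_norm (fst x) + ell2_norm (snd x).
Proof.
  change (sqrt (ell2_norm (fst x) ^ 2 + ell2_norm (snd x) ^ 2)
    <= ell2_norm (fst x) + ell2_norm (snd x)).
  assert (H1 : 0 <= ell2_norm (fst x)) by apply sqrt_pos.
  assert (H2 : 0 <= ell2_norm (snd x)) by apply sqrt_pos.
  rewrite <- (sqrt_pow2 (ell2_norm (fst x) + ell2_norm (snd x))) by lra.
  apply sqrt_le_1_alt. nra.
Qed.

Lemma flow_field_zero s alpha beta gamma nu :
  flow_field s alpha beta gamma nu zero = zero.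
Proof.
  assert (H : ell2_make s (coef_field alpha beta gamma nu (@ell2_zero s) (@ell2_zero s)) = ell2_zero).
  { apply ell2_ext. intros k.
    assert (E : coef_field alpha beta gamma nu (@ell2_zero s) (@ell2_zero s) = @ell2_zero s).
    { apply functional_extensionality. intros n. apply (coef_field_zero alpha beta gamma nu n). }
    rewrite E. apply ell2_make_coefs, coefs_finite. }
  exact (f_equal2 pair H H).
Qed.

Lemma ell2_norm_make s a A : sob_le s a A -> ell2_norm (ell2_make s a) <= A.
Proof.
  intros H. apply ell2_norm_le. apply sob_le_ext with (2 := H). intros k. symmetry.
  apply ell2_make_coefs, sob_le_ex with A, H.
Qed.

Lemma flow_field_lipschitz s alpha beta gamma nu : 1 / 2 < s ->
  loc_lipschitz (flow_field s alpha beta gamma nu)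
    (fun M => 2 * coef_field_lip s alpha beta gamma nu M).
Proof.
  intros Hs M x y Hx Hy.
  assert (Hfx : sob_le s (fst x) M) by (apply ell2_norm_le; eapply Rle_trans; [apply phase_norm_fst|exact Hx]).
  assert (Hsx : sob_le s (snd x) M) by (apply ell2_norm_le; eapply Rle_trans; [apply phase_norm_snd|exact Hx]).
  assert (Hfy : sob_le s (fst y) M) by (apply ell2_norm_le; eapply Rle_trans; [apply phase_norm_fst|exact Hy]).
  assert (Hsy : sob_le s (snd y) M) by (apply ell2_norm_le; eapply Rle_trans; [apply phase_norm_snd|exact Hy]).
  set (D := norm (minus x y)).
  assert (Df : sob_le s (fun k => (fst x k - fst y k)%C) D).
  { exact (proj2 (ell2_norm_le (ell2_plus (fst x) (ell2_opp (fst y))) D)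
      (phase_norm_fst s (minus x y))). }
  assert (Ds : sob_le s (fun k => (snd x k - snd y k)%C) D).
  { exact (proj2 (ell2_norm_le (ell2_plus (snd x) (ell2_opp (snd y))) D)
      (phase_norm_snd s (minus x y))). }
  assert (Hgen : forall p r p' r' : ell2 s, sob_le s p M -> sob_le s r M -> sob_le s p' M ->
    sob_le s r' M -> sob_le s (fun k => (p k - p' k)%C) D -> sob_le s (fun k => (r k - r' k)%C) D ->
    ell2_norm (ell2_plus (ell2_make s (coef_field alpha beta gamma nu p r))
      (ell2_opp (ell2_make s (coef_field alpha beta gamma nu p' r'))))
    <= coef_field_lip s alpha beta gamma nu M * D).
  { intros p r p' r' H1 H2 H3 H4 H5 H6. apply ell2_norm_le.
    apply sob_le_ext with (2 := coef_field_lipschitz s alpha beta gamma nu p r p' r' M D Hs H1 H2 H3 H4 H5 H6).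
    intros k. simpl.
    rewrite !ell2_make_coefs by (apply coef_field_ex; try exact Hs; apply coefs_finite). reflexivity. }
  eapply Rle_trans; [apply (phase_norm_le s)|].
  rewrite Rmult_assoc.
  apply Rle_trans with (coef_field_lip s alpha beta gamma nu M * D + coef_field_lip s alpha beta gamma nu M * D);
    [|right; ring].
  apply Rplus_le_compat; apply Hgen; assumption.
Qed.

Definition wiener (a : nat -> C) : R := Series (fun k => Cmod (a k)).

Definition phase_density {s} (x : phase_space s) : R := wiener (fst x) ^ 2 + wiener (snd x) ^ 2.

Lemma ell2_summable {s} (a : ell2 s) : 1 / 2 < s -> abs_summable a.
Proof. intros Hs. eapply l1_le_summable, sob_le_l1; [exact Hs|apply ell2_sob]. Qed.

Definition growth_const (s alpha beta : R) : R :=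
  4 * (tri_const s * (Rabs alpha + Rabs beta)).

Lemma flow_field_growth s alpha beta gamma nu (x : phase_space s) : 1 / 2 < s ->
  norm (flow_field s alpha beta gamma nu x)
  <= (growth_const s alpha beta * phase_density x + 2 * (Rabs gamma + Rabs nu)) * norm x.
Proof.
  intros Hs.
  assert (Hf : sob_le s (fst x) (norm x)) by apply ell2_norm_le, phase_norm_fst.
  assert (Hg : sob_le s (snd x) (norm x)) by apply ell2_norm_le, phase_norm_snd.
  assert (Hf1 := summable_l1_le _ (ell2_summable (fst x) Hs)).
  assert (Hg1 := summable_l1_le _ (ell2_summable (snd x) Hs)).
  eapply Rle_trans; [apply (phase_norm_le s)|].
  eapply Rle_trans; [apply Rplus_le_compat; apply ell2_norm_make, coef_field_growth;
    [lra|exact Hf|exact Hg|exact Hf1|exact Hg1|lra|exact Hg|exact Hf|exact Hg1|exact Hf1]|].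
  right. unfold growth_const, phase_density, wiener. simpl. ring.
Qed.

Lemma wiener_diff a b : abs_summable a -> abs_summable b ->
  Rabs (wiener a - wiener b) <= wiener (fun k => (a k - b k)%C).
Proof.
  assert (H : forall a b, abs_summable a -> abs_summable b ->
    wiener a <= wiener b + wiener (fun k => (a k - b k)%C)).
  { intros u v Hu Hv.
    assert (Hd : abs_summable (fun k => (u k - v k)%C)).
    { apply abs_summable_plus; [exact Hu|]. apply abs_summable_dom with (a := v) (K := 1); [|exact Hv].
      intros k. rewrite Cmod_opp. lra. }
    unfold wiener. rewrite <- Series_plus by assumption. apply Series_le.
    - intros k. split; [apply Cmod_ge_0|].
      eapply Rle_trans; [|apply Cmod_triangle]. right. f_equal. ring.
    - apply (ex_series_plus (V := R_NormedModule)); assumption. }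
  intros Ha Hb. apply Rabs_le.
  assert (H1 := H a b Ha Hb). assert (H2 := H b a Hb Ha).
  replace (wiener (fun k => (b k - a k)%C)) with (wiener (fun k => (a k - b k)%C)) in H2.
  - lra.
  - apply Series_ext. intros k. apply Cmod_minus_sym.
Qed.

Lemma wiener_le s a A : 1 / 2 < s -> sob_le s a A -> wiener a <= embed_const s * A.
Proof.
  intros Hs Ha. apply (series_of_bounded (fun k => Cmod (a k))); [intros; apply Cmod_ge_0|].
  apply sob_le_l1; assumption.
Qed.

Lemma wiener_lipschitz s (a b : ell2 s) : 1 / 2 < s ->
  Rabs (wiener a - wiener b) <= embed_const s * ell2_norm (minus a b).
Proof.
  intros Hs. eapply Rle_trans; [apply wiener_diff; apply ell2_summable, Hs|].
  apply wiener_le; [exact Hs|]. apply (ell2_sob (minus a b)).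
Qed.


(** * Absolutely convergent trigonometric series *)

Lemma expi_plus a b : expi (a + b) = (expi a * expi b)%C.
Proof.
  unfold expi, Cmult; simpl. rewrite cos_plus, sin_plus. f_equal; ring.
Qed.

Lemma expi_0 : expi 0 = RtoC 1.
Proof. unfold expi. rewrite cos_0, sin_0. reflexivity. Qed.

Lemma Cmod_expi t : Cmod (expi t) = 1.
Proof.
  unfold Cmod, expi; cbn [fst snd].
  replace (cos t ^ 2 + sin t ^ 2) with 1; [apply sqrt_1|].
  rewrite <- (sin2_cos2 t). unfold Rsqr. ring.
Qed.

Lemma expi_opp t : expi (- t) = Cconj (expi t).
Proof. unfold expi, Cconj; simpl. rewrite cos_neg, sin_neg. reflexivity. Qed.

Lemma expi_2PI (m : Z) : expi (IZR m * (2 * PI)) = RtoC 1.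
Proof.
  assert (Hn : forall n : nat, expi (INR n * (2 * PI)) = RtoC 1).
  { intros n. replace (INR n * (2 * PI)) with (0 + 2 * INR n * PI) by ring.
    unfold expi. rewrite cos_period, sin_period, cos_0, sin_0. reflexivity. }
  destruct (Z_le_gt_dec 0 m) as [Hm|Hm].
  - rewrite <- (Z2Nat.id m) by exact Hm. rewrite <- INR_IZR_INZ. apply Hn.
  - replace (IZR m * (2 * PI)) with (- (IZR (- m) * (2 * PI))) by (rewrite opp_IZR; ring).
    rewrite expi_opp, <- (Z2Nat.id (- m)) by lia. rewrite <- INR_IZR_INZ, Hn.
    unfold Cconj, RtoC; simpl. rewrite Ropp_0. reflexivity.
Qed.

Definition trig_term (sigma : nat -> Z) (a : nat -> C) (x : R) (k : nat) : C :=
  (a k * expi (IZR (sigma k) * x))%C.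

Definition trig (sigma : nat -> Z) (a : nat -> C) (x : R) : C := CSeries (trig_term sigma a x).

Lemma Cmod_trig_term sigma a x k : Cmod (trig_term sigma a x k) = Cmod (a k).
Proof. unfold trig_term. rewrite Cmod_mult, Cmod_expi. ring. Qed.

Lemma trig_term_summable sigma a x : abs_summable a -> abs_summable (trig_term sigma a x).
Proof. apply abs_summable_dom with (K := 1). intros k. rewrite Cmod_trig_term. lra. Qed.

Lemma Cmod_trig sigma a x : abs_summable a -> Cmod (trig sigma a x) <= wiener a.
Proof.
  intros H. eapply Rle_trans; [apply Cmod_CSeries, trig_term_summable, H|].
  right. apply Series_ext. intros k. apply Cmod_trig_term.
Qed.

Lemma trig_uniform sigma a eps : abs_summable a -> 0 < eps ->
  exists N, forall n, (N <= n)%nat -> forall x,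
    Cmod (Csum (trig_term sigma a x) n - trig sigma a x) < eps.
Proof.
  intros Ha Heps.
  destruct (proj1 (filterlim_locally _ _) (Series_correct _ Ha) (mkposreal _ Heps)) as [N HN].
  exists N. intros n Hn x.
  eapply Rle_lt_trans; [apply Cmod_CSeries_tail, trig_term_summable, Ha|].
  specialize (HN n Hn).
  change (Rabs (sum_n (fun k => Cmod (a k)) n - Series (fun k => Cmod (a k))) < eps) in HN.
  unfold wiener.
  rewrite (Series_ext _ (fun k => Cmod (a k))) by (intros; apply Cmod_trig_term).
  rewrite (sum_n_ext _ (fun k => Cmod (a k))) by (intros; apply Cmod_trig_term).
  apply Rabs_lt_between in HN. lra.
Qed.

Lemma continuous_expi (m t : R) : continuous (fun x => expi (m * x)) t.
Proof.
  apply filterlim_locally. intros eps.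
  assert (H1 : continuous (fun x => cos (m * x)) t).
  { apply (ex_derive_continuous (fun x => cos (m * x))). auto_derive. easy. }
  assert (H2 : continuous (fun x => sin (m * x)) t).
  { apply (ex_derive_continuous (fun x => sin (m * x))). auto_derive. easy. }
  generalize (filter_and _ _ (proj1 (filterlim_locally _ _) H1 eps)
    (proj1 (filterlim_locally _ _) H2 eps)).
  apply filter_imp. intros x [Hx1 Hx2]. split; assumption.
Qed.

Lemma continuous_Cmod (f : R -> C) t :
  continuous f t <-> forall eps, 0 < eps -> locally t (fun x => Cmod (f x - f t) < eps).
Proof.
  split.
  - intros H eps Heps.
    destruct (C_ball_Cmod (f t) eps Heps) as [e He].
    generalize (proj1 (filterlim_locally _ _) H e).
    apply filter_imp. intros x. apply He.
  - intros H. apply filterlim_locally. intros eps.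
    generalize (H eps (cond_pos eps)). apply filter_imp. intros x Hx.
    apply C_NormedModule_mixin_compat1, Hx.
Qed.

Lemma continuous_Csum_trig sigma a n t : continuous (fun x => Csum (trig_term sigma a x) n) t.
Proof.
  assert (Hk : forall k, continuous (fun x => trig_term sigma a x k) t).
  { intros k. apply continuous_Cmod. intros eps Heps.
    assert (Ha : 0 < Cmod (a k) + 1) by (generalize (Cmod_ge_0 (a k)); lra).
    assert (He : 0 < eps / (Cmod (a k) + 1)) by (apply Rdiv_lt_0_compat; lra).
    generalize (proj1 (continuous_Cmod _ _) (continuous_expi (IZR (sigma k)) t) _ He).
    apply filter_imp. intros x Hx. unfold trig_term.
    replace (a k * expi (IZR (sigma k) * x) - a k * expi (IZR (sigma k) * t))%C
      with (a k * (expi (IZR (sigma k) * x) - expi (IZR (sigma k) * t)))%C by ring.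
    rewrite Cmod_mult.
    apply Rle_lt_trans with ((Cmod (a k) + 1) * Cmod (expi (IZR (sigma k) * x) - expi (IZR (sigma k) * t))).
    - apply Rmult_le_compat_r; [apply Cmod_ge_0|lra].
    - apply Rlt_le_trans with ((Cmod (a k) + 1) * (eps / (Cmod (a k) + 1))).
      + apply Rmult_lt_compat_l; assumption.
      + right. field. lra. }
  induction n as [|n IH].
  - apply continuous_ext with (2 := Hk O). intros x. rewrite Csum_O. reflexivity.
  - apply continuous_ext with (fun x => plus (G := C_R_NormedModule) (Csum (trig_term sigma a x) n)
      (trig_term sigma a x (S n))).
    + intros x. rewrite Csum_Sn. reflexivity.
    + apply (continuous_plus (V := C_R_NormedModule)); [exact IH|apply Hk].
Qed.

Lemma continuous_trig sigma a t : abs_summable a -> continuous (trig sigma a) t.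
Proof.
  intros Ha. apply continuous_Cmod. intros eps Heps.
  destruct (trig_uniform sigma a (eps / 3) Ha ltac:(lra)) as [N HN].
  generalize (proj1 (continuous_Cmod _ _) (continuous_Csum_trig sigma a N t) (eps / 3) ltac:(lra)).
  apply filter_imp. intros x Hx.
  assert (H1 := HN N (le_n N) x). assert (H2 := HN N (le_n N) t).
  set (A := Csum (trig_term sigma a x) N) in *. set (B := Csum (trig_term sigma a t) N) in *.
  replace (trig sigma a x - trig sigma a t)%C
    with (- (A - trig sigma a x) + ((A - B) + (B - trig sigma a t)))%C by ring.
  eapply Rle_lt_trans; [apply Cmod_triangle|]. rewrite Cmod_opp.
  generalize (Cmod_triangle (A - B) (B - trig sigma a t)). lra.
Qed.


(** * Termwise integration and Fourier coefficients *)

Definition is_CInt (f : R -> C) (a b : R) (l : C) : Prop :=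
  is_RInt (V := C_R_NormedModule) f a b l.

Lemma is_CInt_components f a b l :
  is_RInt (fun x => Re (f x)) a b (Re l) -> is_RInt (fun x => Im (f x)) a b (Im l) ->
  is_CInt f a b l.
Proof.
  intros H1 H2. unfold is_CInt. rewrite (surjective_pairing l).
  exact (is_RInt_fct_extend_pair (U := R_NormedModule) (V := R_NormedModule) f a b _ _ H1 H2).
Qed.

Lemma is_CInt_Re f a b l : is_CInt f a b l -> is_RInt (fun x => Re (f x)) a b (Re l).
Proof. exact (is_RInt_fct_extend_fst (U := R_NormedModule) (V := R_NormedModule) f a b l). Qed.

Lemma is_CInt_Im f a b l : is_CInt f a b l -> is_RInt (fun x => Im (f x)) a b (Im l).
Proof. exact (is_RInt_fct_extend_snd (U := R_NormedModule) (V := R_NormedModule) f a b l). Qed.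

Lemma is_CInt_ext f g a b l : (forall x, f x = g x) -> is_CInt f a b l -> is_CInt g a b l.
Proof. intros H. apply is_RInt_ext. intros x _. apply H. Qed.

Lemma is_CInt_plus f g a b lf lg :
  is_CInt f a b lf -> is_CInt g a b lg -> is_CInt (fun x => (f x + g x)%C) a b (lf + lg)%C.
Proof. exact (is_RInt_plus (V := C_R_NormedModule) f g a b lf lg). Qed.

Lemma is_CInt_scal c f a b l : is_CInt f a b l -> is_CInt (fun x => (c * f x)%C) a b (c * l)%C.
Proof.
  intros H. assert (H1 := is_CInt_Re _ _ _ _ H). assert (H2 := is_CInt_Im _ _ _ _ H).
  apply is_CInt_components; unfold Re, Im in *; simpl.
  - exact (is_RInt_minus _ _ _ _ _ _ (is_RInt_scal _ _ _ (fst c) _ H1)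
      (is_RInt_scal _ _ _ (snd c) _ H2)).
  - exact (is_RInt_plus _ _ _ _ _ _ (is_RInt_scal _ _ _ (fst c) _ H2)
      (is_RInt_scal _ _ _ (snd c) _ H1)).
Qed.

Lemma is_CInt_unique f a b l : is_CInt f a b l -> RInt (V := C_R_CompleteNormedModule) f a b = l.
Proof. exact (is_RInt_unique (V := C_R_CompleteNormedModule) f a b l). Qed.

Lemma is_CInt_Csum (f : nat -> R -> C) (I : nat -> C) a b n :
  (forall k, is_CInt (f k) a b (I k)) -> is_CInt (fun x => Csum (fun k => f k x) n) a b (Csum I n).
Proof.
  intros H. induction n as [|n IH].
  - rewrite Csum_O. apply is_CInt_ext with (2 := H O). intros x. rewrite Csum_O. reflexivity.
  - rewrite Csum_Sn. apply is_CInt_ext with (2 := is_CInt_plus _ _ _ _ _ _ IH (H (S n))).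
    intros x. rewrite Csum_Sn. reflexivity.
Qed.

Lemma C_norm_le (z : C) : norm (V := C_R_NormedModule) z = Cmod z.
Proof.
  change (sqrt (Rabs (fst z) ^ 2 + Rabs (snd z) ^ 2) = Cmod z).
  unfold Cmod. rewrite !pow2_abs. reflexivity.
Qed.

Lemma Cmod_CInt_le f a b l M :
  (forall x, Cmod (f x) <= M) -> is_CInt f a b l -> Cmod l <= Rabs (b - a) * M.
Proof.
  intros HM H. rewrite <- C_norm_le.
  apply (norm_RInt_le_const_abs (V := C_R_NormedModule) f a b l M); [|exact H].
  intros x _. rewrite C_norm_le. apply HM.
Qed.

(** The partial sums of the trigonometric series converge uniformly and [g] is bounded, so
    the limit passes under the integral.  The frequencies are arbitrary integers, since
    series in negative and in positive wavenumbers are both needed. *)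
Lemma is_CInt_trig_mult sigma a (g : R -> C) (G : R) (I : nat -> C) u v :
  abs_summable a -> (forall x, Cmod (g x) <= G) ->
  (forall k, is_CInt (fun x => (expi (IZR (sigma k) * x) * g x)%C) u v (I k)) ->
  is_CInt (fun x => (trig sigma a x * g x)%C) u v (CSeries (fun k => (a k * I k)%C)).
Proof.
  intros Ha HG HI.
  assert (HG0 : 0 <= G) by (eapply Rle_trans; [apply (Cmod_ge_0 (g 0))|apply HG]).
  assert (HaI : abs_summable (fun k => (a k * I k)%C)).
  { apply abs_summable_dom with (a := a) (K := Rabs (v - u) * G); [|exact Ha].
    intros k. rewrite Cmod_mult, Rmult_comm. apply Rmult_le_compat_r; [apply Cmod_ge_0|].
    apply Cmod_CInt_le with (2 := HI k). intros x. rewrite Cmod_mult, Cmod_expi, Rmult_1_l. apply HG. }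
  destruct (filterlim_RInt (V := C_R_CompleteNormedModule)
    (fun n x => (Csum (trig_term sigma a x) n * g x)%C) u v eventually _
    (fun x => (trig sigma a x * g x)%C) (fun n => Csum (fun k => (a k * I k)%C) n))
    as [l [Hl1 Hl2]].
  - intros n.
    apply is_CInt_ext with (2 := is_CInt_Csum _ _ u v n
      (fun k => is_CInt_scal (a k) _ _ _ _ (HI k))).
    intros x. rewrite (Cmult_comm (Csum _ n)), <- Csum_scal. apply Csum_ext. intros k _.
    unfold trig_term. ring.
  - apply filterlim_locally. intros eps.
    assert (He : 0 < eps / (G + 1)) by (apply Rdiv_lt_0_compat; [apply cond_pos|lra]).
    destruct (trig_uniform sigma a _ Ha He) as [N HN].
    exists N. intros n Hn x. apply C_NormedModule_mixin_compat1.
    change (Cmod (Csum (trig_term sigma a x) n * g x - trig sigma a x * g x) < eps).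
    replace (Csum (trig_term sigma a x) n * g x - trig sigma a x * g x)%C
      with ((Csum (trig_term sigma a x) n - trig sigma a x) * g x)%C by ring.
    rewrite Cmod_mult.
    apply Rle_lt_trans with (Cmod (Csum (trig_term sigma a x) n - trig sigma a x) * (G + 1)).
    + apply Rmult_le_compat_l; [apply Cmod_ge_0|]. generalize (HG x). lra.
    + apply Rlt_le_trans with (eps / (G + 1) * (G + 1)).
      * apply Rmult_lt_compat_r; [lra|]. apply HN, Hn.
      * right. field. lra.
  - assert (E : l = CSeries (fun k => (a k * I k)%C)).
    { apply (filterlim_locally_unique (V := C_R_NormedModule)
        (fun n => Csum (fun k => (a k * I k)%C) n) (F := eventually)); [exact Hl1|].
      exact (is_series_CSeries _ HaI). }
    rewrite <- E. exact Hl2.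
Qed.

Lemma is_CInt_const (c : C) u v : is_CInt (fun _ => c) u v (RtoC (v - u) * c)%C.
Proof.
  assert (H := is_RInt_const (V := C_R_NormedModule) u v c).
  unfold is_CInt. evar_last; [exact H|].
  unfold scal; simpl. unfold prod_scal, scal; simpl. unfold mult; simpl.
  unfold Cmult, RtoC; simpl. f_equal; ring.
Qed.

Lemma is_CInt_expi (m : R) u v : m <> 0 ->
  is_CInt (fun x => expi (m * x)) u v ((expi (m * v) - expi (m * u)) / (Ci * RtoC m))%C.
Proof.
  intros Hm.
  replace ((expi (m * v) - expi (m * u)) / (Ci * RtoC m))%C
    with ((sin (m * v) / m - sin (m * u) / m, - cos (m * v) / m - - cos (m * u) / m) : C).
  - apply is_CInt_components; unfold Re, Im; simpl.
    + apply (is_RInt_derive (V := R_CompleteNormedModule) (fun x => sin (m * x) / m)).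
      * intros x _. auto_derive; [easy|]. field. exact Hm.
      * intros x _. apply (ex_derive_continuous (fun x => cos (m * x))). auto_derive. easy.
    + apply (is_RInt_derive (V := R_CompleteNormedModule) (fun x => - cos (m * x) / m)).
      * intros x _. auto_derive; [easy|]. field. exact Hm.
      * intros x _. apply (ex_derive_continuous (fun x => sin (m * x))). auto_derive. easy.
  - unfold expi, Cdiv, Cinv, Cminus, Cplus, Copp, Cmult, RtoC, Ci; simpl.
    assert (0 < m * m) by (apply Rsqr_pos_lt, Hm).
    f_equal; field; repeat split; try exact Hm; nra.
Qed.


(** The differentiated series [h] can be integrated termwise, which gives back the
    increments of the original series; then the fundamental theorem of calculus applies
    to each component because [h] is continuous. *)
Lemma dx_trig sigma g x :
  (forall k, sigma k <> 0%Z) -> abs_summable g ->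
  abs_summable (fun k => (Ci * RtoC (IZR (sigma k)) * g k)%C) ->
  dx (trig sigma g) x = trig sigma (fun k => (Ci * RtoC (IZR (sigma k)) * g k)%C) x.
Proof.
  intros Hsig Hg Hh.
  set (h := fun k => (Ci * RtoC (IZR (sigma k)) * g k)%C) in *.
  assert (Hint : forall y, is_CInt (trig sigma h) 0 y (trig sigma g y - trig sigma g 0)%C).
  { intros y.
    assert (Hone : forall t : R, Cmod ((fun _ : R => RtoC 1) t) <= 1)
      by (intros; rewrite Cmod_1; lra).
    assert (HI : forall k, is_CInt (fun t => (expi (IZR (sigma k) * t) * RtoC 1)%C) 0 y
      ((expi (IZR (sigma k) * y) - expi (IZR (sigma k) * 0)) / (Ci * RtoC (IZR (sigma k))))%C).
    { intros k. apply is_CInt_ext with (fun t => expi (IZR (sigma k) * t)).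
      - intros t. ring.
      - apply is_CInt_expi. apply not_0_IZR, Hsig. }
    assert (H := is_CInt_trig_mult sigma h (fun _ => RtoC 1) 1 _ 0 y Hh Hone HI).
    apply is_CInt_ext with (g := trig sigma h) in H; [|intros; ring].
    evar_last; [exact H|].
    unfold trig. rewrite <- CSeries_minus by (apply trig_term_summable, Hg).
    apply CSeries_ext. intros k. unfold trig_term, h. field. split.
    - intros E. apply (f_equal fst) in E. apply (Hsig k), eq_IZR, E.
    - intros E. apply (f_equal snd) in E. simpl in E. lra. }
  unfold dx. rewrite (surjective_pairing (trig sigma h x)).
  assert (Hder : forall (pr : C -> R),
    (forall y, is_RInt (fun t => pr (trig sigma h t)) 0 y (pr (trig sigma g y) - pr (trig sigma g 0))) ->
    (forall t, continuous (fun y => pr (trig sigma h y)) t) ->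
    Derive (fun y => pr (trig sigma g y)) x = pr (trig sigma h x)).
  { intros pr H1 H2. apply is_derive_unique.
    assert (HD := is_derive_RInt (V := R_NormedModule) (fun t => pr (trig sigma h t))
      (fun y => pr (trig sigma g y) - pr (trig sigma g 0)) 0 x
      (filter_forall _ H1) (H2 x)).
    apply is_derive_ext with (fun y => pr (trig sigma g y) - pr (trig sigma g 0) + pr (trig sigma g 0)).
    - intros t. change (pr (trig sigma g t) - pr (trig sigma g 0) + pr (trig sigma g 0) = pr (trig sigma g t)). ring.
    - evar_last.
      + apply (is_derive_plus (V := R_NormedModule) _ (fun _ => pr (trig sigma g 0))).
        * exact HD.
        * apply (is_derive_const (V := R_NormedModule)).
      + apply Rplus_0_r. }
  f_equal; apply Hder.
  - intros y. exact (is_CInt_Re _ _ _ _ (Hint y)).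
  - intros t. apply (filterlim_comp _ _ _ (trig sigma h) fst _ (locally (trig sigma h t))).
    + apply continuous_trig, Hh.
    + apply (continuous_fst (U := R_UniformSpace) (V := R_UniformSpace)).
  - intros y. exact (is_CInt_Im _ _ _ _ (Hint y)).
  - intros t. apply (filterlim_comp _ _ _ (trig sigma h) snd _ (locally (trig sigma h t))).
    + apply continuous_trig, Hh.
    + apply (continuous_snd (U := R_UniformSpace) (V := R_UniformSpace)).
Qed.

Lemma two_PI_neq_0 : RtoC (2 * PI) <> RtoC 0.
Proof.
  intros E. apply (f_equal fst) in E. simpl in E. generalize PI_RGT_0. lra.
Qed.

Lemma fourier_of_int g n l :
  is_CInt (fun x => (expi (IZR (- n) * x) * g x)%C) 0 (2 * PI) l ->
  fourier g n = (RtoC (/ (2 * PI)) * l)%C.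
Proof.
  intros H. unfold fourier. f_equal. apply is_CInt_unique.
  apply is_CInt_ext with (2 := H). intros x. rewrite Cmult_comm. f_equal. f_equal.
  rewrite opp_IZR. ring.
Qed.

(** Bounded functions whose products with all exponentials are integrable.  This class is
    stable under the products that occur in the equations, and Fourier coefficients can
    be computed termwise on it. *)
Definition tame (g : R -> C) : Prop :=
  (exists G, forall x, Cmod (g x) <= G) /\
  forall m : Z, is_CInt (fun x => (expi (IZR m * x) * g x)%C) 0 (2 * PI)
    (RtoC (2 * PI) * fourier g (- m))%C.

Lemma tame_intro g G (I : Z -> C) :
  (forall x, Cmod (g x) <= G) ->
  (forall m, is_CInt (fun x => (expi (IZR m * x) * g x)%C) 0 (2 * PI) (I m)) ->
  tame g /\ forall n, fourier g n = (RtoC (/ (2 * PI)) * I (- n)%Z)%C.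
Proof.
  intros HG HI.
  assert (HF : forall n, fourier g n = (RtoC (/ (2 * PI)) * I (- n)%Z)%C).
  { intros n. apply fourier_of_int, HI. }
  split; [|exact HF]. split; [exists G; exact HG|].
  intros m. rewrite HF, Z.opp_involutive.
  evar_last; [apply HI|]. rewrite RtoC_inv by (generalize PI_RGT_0; lra).
  field. apply two_PI_neq_0.
Qed.

(** Expanding one factor only gives the convolution formula as a single series. *)
Lemma tame_trig_mult sigma a g : abs_summable a -> tame g ->
  tame (fun x => (trig sigma a x * g x)%C) /\
  forall n, fourier (fun x => (trig sigma a x * g x)%C) n
    = CSeries (fun k => (a k * fourier g (n - sigma k))%C).
Proof.
  intros Ha [[G HG] Hg].
  assert (HG0 : 0 <= G) by (eapply Rle_trans; [apply (Cmod_ge_0 (g 0))|apply HG]).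
  destruct (tame_intro (fun x => (trig sigma a x * g x)%C) (wiener a * G)
    (fun m => CSeries (fun k => (a k * (RtoC (2 * PI) * fourier g (- (m + sigma k))))%C)))
    as [HT HF].
  - intros x. rewrite Cmod_mult. apply Rmult_le_compat; try apply Cmod_ge_0; [|apply HG].
    apply Cmod_trig, Ha.
  - intros m.
    apply is_CInt_ext with (fun x => (trig sigma a x * (expi (IZR m * x) * g x))%C); [intros; ring|].
    apply is_CInt_trig_mult with (G := G); [exact Ha| |].
    + intros x. rewrite Cmod_mult, Cmod_expi, Rmult_1_l. apply HG.
    + intros k. apply is_CInt_ext with (2 := Hg (m + sigma k)%Z).
      intros x. rewrite plus_IZR, Rmult_plus_distr_r, expi_plus. ring.
  - split; [exact HT|]. intros n. rewrite HF.
    rewrite <- CSeries_scal.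
    + apply CSeries_ext. intros k. rewrite RtoC_inv by (generalize PI_RGT_0; lra).
      replace (- (- n + sigma k))%Z with (n - sigma k)%Z by ring.
      field. apply two_PI_neq_0.
    + apply abs_summable_dom with (a := a) (K := Rabs (2 * PI - 0) * G); [|exact Ha].
      intros k. rewrite Cmod_mult, Rmult_comm. apply Rmult_le_compat_r; [apply Cmod_ge_0|].
      apply Cmod_CInt_le with (2 := Hg (- n + sigma k)%Z).
      intros x. rewrite Cmod_mult, Cmod_expi, Rmult_1_l. apply HG.
Qed.

Lemma tame_scal c g : tame g ->
  tame (fun x => (c * g x)%C) /\ forall n, fourier (fun x => (c * g x)%C) n = (c * fourier g n)%C.
Proof.
  intros [[G HG] Hg].
  destruct (tame_intro (fun x => (c * g x)%C) (Cmod c * G)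
    (fun m => (c * (RtoC (2 * PI) * fourier g (- m)))%C)) as [HT HF].
  - intros x. rewrite Cmod_mult. apply Rmult_le_compat_l; [apply Cmod_ge_0|apply HG].
  - intros m. apply is_CInt_ext with (2 := is_CInt_scal c _ _ _ _ (Hg m)). intros; ring.
  - split; [exact HT|]. intros n. rewrite HF, Z.opp_involutive, RtoC_inv by (generalize PI_RGT_0; lra).
    field. apply two_PI_neq_0.
Qed.

Lemma tame_plus f g : tame f -> tame g ->
  tame (fun x => (f x + g x)%C) /\
  forall n, fourier (fun x => (f x + g x)%C) n = (fourier f n + fourier g n)%C.
Proof.
  intros [[F HF] Hf] [[G HG] Hg].
  destruct (tame_intro (fun x => (f x + g x)%C) (F + G)
    (fun m => (RtoC (2 * PI) * fourier f (- m) + RtoC (2 * PI) * fourier g (- m))%C)) as [HT HFo].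
  - intros x. eapply Rle_trans; [apply Cmod_triangle|]. apply Rplus_le_compat; auto.
  - intros m. apply is_CInt_ext with (2 := is_CInt_plus _ _ _ _ _ _ (Hf m) (Hg m)). intros; ring.
  - split; [exact HT|]. intros n. rewrite HFo, Z.opp_involutive, RtoC_inv by (generalize PI_RGT_0; lra).
    field. apply two_PI_neq_0.
Qed.

Lemma tame_one :
  tame (fun _ => RtoC 1) /\
  forall n, fourier (fun _ => RtoC 1) n = if Z.eq_dec n 0 then RtoC 1 else RtoC 0.
Proof.
  destruct (tame_intro (fun _ => RtoC 1) 1
    (fun m => if Z.eq_dec m 0 then RtoC (2 * PI) else RtoC 0)) as [HT HF].
  - intros _. rewrite Cmod_1. lra.
  - intros m. destruct Z.eq_dec as [->|Hm].
    + apply is_CInt_ext with (fun _ => RtoC 1).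
      * intros x. rewrite Rmult_0_l, expi_0. ring.
      * evar_last; [apply is_CInt_const|]. rewrite Rminus_0_r. ring.
    + apply is_CInt_ext with (fun x => expi (IZR m * x)); [intros; ring|].
      evar_last; [apply is_CInt_expi, not_0_IZR, Hm|].
      rewrite expi_2PI, Rmult_0_r, expi_0. unfold Cdiv. ring.
  - split; [exact HT|]. intros n. rewrite HF.
    destruct (Z.eq_dec (- n) 0), (Z.eq_dec n 0); try lia.
    + rewrite RtoC_inv by (generalize PI_RGT_0; lra). field. apply two_PI_neq_0.
    + ring.
Qed.

Lemma tame_trig sigma a : abs_summable a ->
  tame (trig sigma a) /\
  forall n, fourier (trig sigma a) n
    = CSeries (fun k => (a k * if Z.eq_dec (n - sigma k) 0 then RtoC 1 else RtoC 0)%C).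
Proof.
  intros Ha. destruct (tame_trig_mult sigma a _ Ha (proj1 tame_one)) as [H1 H2].
  replace (fun x : R => (trig sigma a x * RtoC 1)%C) with (trig sigma a) in *
    by (apply functional_extensionality; intros; ring).
  split; [exact H1|]. intros n. rewrite H2. apply CSeries_ext. intros k.
  rewrite (proj2 tame_one). reflexivity.
Qed.

(** * One-sided Fourier series *)

(** The sign [e] is 1 for series in positive wavenumbers, -1 for negative ones. *)
Definition is_sign (e : Z) : Prop := e = 1%Z \/ e = (-1)%Z.

Definition Syn (e : Z) (a : nat -> C) : R -> C := trig (fun k => (e * wavenumber k)%Z) a.

Lemma wavenumber_inj e j k : is_sign e -> (e * wavenumber j = e * wavenumber k)%Z -> j = k.
Proof. unfold is_sign, wavenumber. intros [-> | ->] H; lia. Qed.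

Lemma wavenumber_neq_0 e k : is_sign e -> (e * wavenumber k <> 0)%Z.
Proof. unfold is_sign, wavenumber. intros [-> | ->]; lia. Qed.

Lemma fourier_Syn_hit e a k : is_sign e -> abs_summable a ->
  fourier (Syn e a) (e * wavenumber k) = a k.
Proof.
  intros He Ha. unfold Syn. rewrite (proj2 (tame_trig _ a Ha)).
  rewrite (CSeries_single _ k).
  - destruct Z.eq_dec as [_|H]; [ring|]. exfalso. apply H. ring.
  - intros j Hj. destruct Z.eq_dec as [H|_]; [|ring]. exfalso. apply Hj.
    apply (wavenumber_inj e); [exact He|]. lia.
Qed.

Lemma fourier_Syn_miss e a n : abs_summable a -> (forall k, n <> (e * wavenumber k)%Z) ->
  fourier (Syn e a) n = RtoC 0.
Proof.
  intros Ha Hn. unfold Syn. rewrite (proj2 (tame_trig _ a Ha)).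
  apply CSeries_zero. intros k. destruct Z.eq_dec as [H|_]; [|ring].
  exfalso. apply (Hn k). lia.
Qed.

Lemma CSeries_finite a m : (forall k, (m < k)%nat -> a k = RtoC 0) -> CSeries a = Csum a m.
Proof.
  intros H. apply CSeries_unique. apply filterlim_ext_loc with (fun _ : nat => Csum a m).
  - exists m. intros n Hn. symmetry. change (Csum a n = Csum a m).
    induction Hn as [|n Hn IH]; [reflexivity|]. rewrite Csum_Sn, IH, H by lia. ring.
  - apply filterlim_const.
Qed.

Lemma tame_Syn_mult e e' b c : abs_summable b -> abs_summable c ->
  tame (fun x => (Syn e b x * Syn e' c x)%C).
Proof. intros Hb Hc. apply tame_trig_mult; [exact Hb|]. apply tame_trig, Hc. Qed.

Lemma fourier_Syn_mult e e' b c n : abs_summable b -> abs_summable c ->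
  fourier (fun x => (Syn e b x * Syn e' c x)%C) n
  = CSeries (fun k => (b k * fourier (Syn e' c) (n - e * wavenumber k))%C).
Proof. intros Hb Hc. apply tame_trig_mult; [exact Hb|]. apply tame_trig, Hc. Qed.

(** The wavenumbers of the second factor have the sign [e], so only finitely many indices
    contribute and the series is a finite convolution. *)
Lemma fourier_Syn_mult_hit e b c m : is_sign e -> abs_summable b -> abs_summable c ->
  fourier (fun x => (Syn e b x * Syn e c x)%C) (e * wavenumber (S m)) = conv b c m.
Proof.
  intros He Hb Hc.
  rewrite fourier_Syn_mult by assumption.
  rewrite (CSeries_finite _ m).
  - apply Csum_ext. intros k Hk. f_equal.
    replace (e * wavenumber (S m) - e * wavenumber k)%Z with (e * wavenumber (m - k))%Z
      by (unfold wavenumber; destruct He as [-> | ->]; lia).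
    apply fourier_Syn_hit; assumption.
  - intros k Hk. rewrite fourier_Syn_miss; [ring|exact Hc|].
    intros j. unfold wavenumber. destruct He as [-> | ->]; lia.
Qed.

Lemma fourier_Syn_mult_miss e b c n : is_sign e -> abs_summable b -> abs_summable c ->
  (forall m, n <> (e * wavenumber (S m))%Z) ->
  fourier (fun x => (Syn e b x * Syn e c x)%C) n = RtoC 0.
Proof.
  intros He Hb Hc Hn.
  rewrite fourier_Syn_mult by assumption.
  apply CSeries_zero. intros k. rewrite fourier_Syn_miss; [ring|exact Hc|].
  intros j E. apply (Hn (k + j)%nat). revert E. unfold wavenumber.
  destruct He as [-> | ->]; lia.
Qed.

(** The first factor lowers the wavenumber in absolute value, so the coefficient collects
    the entries of [d] at the larger wavenumbers. *)
Lemma fourier_Syn_opp_mult e a d n : is_sign e -> abs_summable a -> abs_summable d ->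
  fourier (fun x => (Syn (- e) a x * Syn e d x)%C) (e * wavenumber n)
  = CSeries (fun k => (a k * d (S (n + k)))%C).
Proof.
  intros He Ha Hd.
  rewrite fourier_Syn_mult by assumption.
  apply CSeries_ext. intros k. f_equal.
  replace (e * wavenumber n - - e * wavenumber k)%Z with (e * wavenumber (S (n + k)))%Z
    by (unfold wavenumber; destruct He as [-> | ->]; lia).
  apply fourier_Syn_hit; assumption.
Qed.

(** In each pair of opposite wavenumbers summed by [dx_inv] one term vanishes. *)
Lemma dx_inv_onesided e f x : is_sign e ->
  (forall k, fourier f (- (e * wavenumber k)) = RtoC 0) ->
  dx_inv f x = Syn e (fun k => (/ (Ci * RtoC (IZR (e * wavenumber k)))
    * fourier f (e * wavenumber k))%C) x.
Proof.
  intros He Hf. unfold dx_inv, Syn, trig. apply CSeries_ext. intros k.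
  unfold paired, trig_term, mode.
  change (@plus C_AbelianMonoid) with Cplus.
  specialize (Hf k). destruct He as [-> | ->].
  - replace (1 * wavenumber k)%Z with (wavenumber k) in * by ring.
    rewrite Hf. ring.
  - replace (- (-1 * wavenumber k))%Z with (wavenumber k) in Hf by ring.
    replace (-1 * wavenumber k)%Z with (- wavenumber k)%Z in * by ring.
    rewrite Hf. ring.
Qed.


(** * The right-hand sides on Fourier coefficients *)

Lemma Syn_plus e a b x : abs_summable a -> abs_summable b ->
  Syn e (fun k => (a k + b k)%C) x = (Syn e a x + Syn e b x)%C.
Proof.
  intros Ha Hb. unfold Syn, trig.
  rewrite <- CSeries_plus by (apply trig_term_summable; assumption).
  apply CSeries_ext. intros k. unfold trig_term. ring.
Qed.

Lemma Syn_scal e c a x : abs_summable a -> Syn e (fun k => (c * a k)%C) x = (c * Syn e a x)%C.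
Proof.
  intros Ha. unfold Syn, trig.
  rewrite <- CSeries_scal by (apply trig_term_summable; assumption).
  apply CSeries_ext. intros k. unfold trig_term. ring.
Qed.

Lemma Cconj_CSeries a : Cconj (CSeries a) = CSeries (fun k => Cconj (a k)).
Proof.
  unfold Cconj, CSeries; simpl. f_equal. rewrite <- Series_opp. reflexivity.
Qed.

Lemma Cconj_Syn e a x : Cconj (Syn e a x) = Syn (- e) (conj_seq a) x.
Proof.
  unfold Syn, trig. rewrite Cconj_CSeries. apply CSeries_ext. intros k.
  unfold trig_term, conj_seq. rewrite Cmult_conj, <- expi_opp. f_equal. f_equal.
  rewrite !mult_IZR, opp_IZR. ring.
Qed.

Lemma IZR_wavenumber e k : IZR (e * wavenumber k) = IZR e * INR (S k).
Proof. unfold wavenumber. rewrite mult_IZR, <- INR_IZR_INZ. reflexivity. Qed.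

Lemma sign_sqr e : is_sign e -> IZR e * IZR e = 1.
Proof. intros [-> | ->]; lra. Qed.

(** The antiderivative of a product of two series of sign [e].  Such a product has no mode at
    the wavenumber [e], hence the shift by one index. *)
Definition prim (e : Z) (q : nat -> C) (k : nat) : C :=
  match k with
  | O => RtoC 0
  | S m => (/ (Ci * RtoC (IZR (e * wavenumber (S m)))) * q m)%C
  end.

Lemma IZR_sign_wavenumber_ge e k : is_sign e -> 1 <= Rabs (IZR (e * wavenumber k)).
Proof.
  intros He. rewrite IZR_wavenumber, Rabs_mult.
  assert (HS : 1 <= INR (S k)) by (rewrite S_INR; generalize (pos_INR k); lra).
  rewrite (Rabs_pos_eq (INR (S k))) by lra.
  replace (Rabs (IZR e)) with 1; [lra|].
  destruct He as [-> | ->]; unfold Rabs; destruct Rcase_abs; lra.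
Qed.

Lemma Ci_IZR_neq_0 e k : is_sign e -> (Ci * RtoC (IZR (e * wavenumber k)))%C <> RtoC 0.
Proof.
  intros He E. apply (f_equal snd) in E. simpl in E.
  generalize (IZR_sign_wavenumber_ge e k He).
  replace (IZR (e * wavenumber k)) with 0 by lra. rewrite Rabs_R0. lra.
Qed.

Lemma Cmod_inv_Ci_IZR e k : is_sign e ->
  Cmod (/ (Ci * RtoC (IZR (e * wavenumber k)))) <= 1.
Proof.
  intros He. rewrite Cmod_inv by (apply Ci_IZR_neq_0, He).
  rewrite Cmod_mult, Cmod_Ci, Cmod_R, Rmult_1_l.
  rewrite <- Rinv_1. apply Rinv_le_contravar; [lra|]. apply IZR_sign_wavenumber_ge, He.
Qed.

Lemma prim_summable e q : is_sign e -> abs_summable q -> abs_summable (prim e q).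
Proof.
  intros He Hq. unfold abs_summable. apply ex_series_incr_1.
  apply (abs_summable_dom q (fun m => prim e q (S m)) 1); [|exact Hq].
  intros m. simpl prim. rewrite Cmod_mult.
  apply Rmult_le_compat_r; [apply Cmod_ge_0|]. apply Cmod_inv_Ci_IZR, He.
Qed.

Lemma conv_summable b c : abs_summable b -> abs_summable c -> abs_summable (conv b c).
Proof.
  intros Hb Hc. eapply l1_le_summable, conv_l1_le; apply summable_l1_le; assumption.
Qed.

Lemma dx_inv_Syn_mult e b c x : is_sign e -> abs_summable b -> abs_summable c ->
  dx_inv (fun z => (Syn e b z * Syn e c z)%C) x = Syn e (prim e (conv b c)) x.
Proof.
  intros He Hb Hc. rewrite (dx_inv_onesided e _ _ He).
  - f_equal. apply functional_extensionality. intros [|m]; simpl prim.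
    + rewrite fourier_Syn_mult_miss by (assumption ||
        (intros m E; apply wavenumber_inj in E; [lia|exact He])). ring.
    + rewrite fourier_Syn_mult_hit by assumption. reflexivity.
  - intros k. apply fourier_Syn_mult_miss; try assumption.
    intros m. unfold wavenumber. destruct He as [-> | ->]; lia.
Qed.

Lemma dx_inv_Syn e a x : is_sign e -> abs_summable a ->
  dx_inv (Syn e a) x = Syn e (fun k => (/ (Ci * RtoC (IZR (e * wavenumber k))) * a k)%C) x.
Proof.
  intros He Ha. rewrite (dx_inv_onesided e _ _ He).
  - f_equal. apply functional_extensionality. intros k. rewrite fourier_Syn_hit by assumption.
    reflexivity.
  - intros k. apply fourier_Syn_miss; [exact Ha|]. intros j. unfold wavenumber.
    destruct He as [-> | ->]; lia.
Qed.

(** The right-hand side of the first equation for [e = 1] and, with the unknowns exchanged,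
    of the second one for [e = -1]. *)
Definition rhs_signed (e : Z) (alpha beta gamma nu : R) (u v : R -> C) (x : R) : C :=
  (Ci * dx (Syn e (fun k => fourier (fun y =>
      alpha * (Cconj (u y) * dx_inv (fun z => u z * u z) y)
      + beta * (v y * dx_inv (fun z => u z * Cconj (v z)) y)) (e * wavenumber k))) x
   - gamma * u x - Ci * nu * dx_inv (dx_inv u) x)%C.

Lemma rhs_u_signed alpha beta gamma nu u v x :
  rhs_u alpha beta gamma nu u v x = rhs_signed 1 alpha beta gamma nu u v x.
Proof. reflexivity. Qed.

(** Exchanging the unknowns and reflecting the wavenumbers maps the first equation to
    the second one. *)
Lemma rhs_v_signed alpha beta gamma nu u v x :
  rhs_v alpha beta gamma nu u v x = rhs_signed (-1) alpha beta gamma nu v u x.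
Proof.
  unfold rhs_v.
  replace (fun z => (Cconj (u z) * v z)%C) with (fun z => (v z * Cconj (u z))%C)
    by (apply functional_extensionality; intros; ring).
  reflexivity.
Qed.

(** The factors [i e (n + 1)] of the derivative and [1 / (i e (n + k + 2))] of the inverse
    derivative combine into the real quotient in [tri_term]. *)
Lemma tri_of_prim e a b c n : is_sign e -> abs_summable a -> abs_summable b -> abs_summable c ->
  (Ci * (Ci * RtoC (IZR (e * wavenumber n))
    * CSeries (fun k => a k * prim e (conv b c) (S (n + k)))))%C = tri a b c n.
Proof.
  intros He Ha Hb Hc.
  assert (Hq := prim_summable e _ He (conv_summable b c Hb Hc)).
  rewrite Cmult_assoc, <- CSeries_scal.
  - unfold tri. apply CSeries_ext. intros k. unfold tri_term. simpl prim.
    rewrite !IZR_wavenumber.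
    set (X := INR (S n)). set (Y := INR (S (S (n + k)))).
    assert (HY : RtoC Y <> RtoC 0).
    { intros E. apply (f_equal fst) in E. simpl fst in E.
      assert (0 < Y) by (apply lt_0_INR; lia). lra. }
    assert (HC : Ci <> RtoC 0) by (intros E; apply (f_equal snd) in E; simpl in E; lra).
    assert (HY' : Y <> 0) by (intros E; apply HY; rewrite E; reflexivity).
    rewrite RtoC_div, !RtoC_mult by exact HY'.
    assert (Hes : RtoC (IZR e) <> RtoC 0).
    { intros E. apply (f_equal fst) in E. simpl in E. generalize (sign_sqr e He). rewrite E. lra. }
    field. auto.
  - apply abs_summable_dom with (a := a) (K := wiener (prim e (conv b c))); [|exact Ha].
    intros k. rewrite Cmod_mult, Rmult_comm. apply Rmult_le_compat_r; [apply Cmod_ge_0|].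
    apply (l1_le_coef (prim e (conv b c))), summable_l1_le, Hq.
Qed.

Lemma conj_seq_summable a : abs_summable a -> abs_summable (conj_seq a).
Proof. apply abs_summable_dom with (K := 1). intros k. unfold conj_seq. rewrite Cmod_Cconj. lra. Qed.

(** Every operation in the equation acts termwise on absolutely convergent series.  The only
    delicate one is the outer derivative, which is legitimate because the differentiated
    coefficients are those of the vector field, already known to be summable. *)
Lemma rhs_signed_Syn e alpha beta gamma nu s (p r : ell2 s) x : is_sign e -> 1 / 2 < s ->
  rhs_signed e alpha beta gamma nu (Syn e p) (Syn (- e) r) x
  = Syn e (coef_field alpha beta gamma nu p r) x.
Proof.
  intros He Hs.
  assert (Hp := ell2_summable p Hs). assert (Hr := ell2_summable r Hs).
  assert (Hcp := conj_seq_summable _ Hp). assert (Hcr := conj_seq_summable _ Hr).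
  set (d := prim e (conv p p)). set (d' := prim e (conv p (conj_seq r))).
  assert (Hd : abs_summable d) by (apply prim_summable, conv_summable; assumption).
  assert (Hd' : abs_summable d') by (apply prim_summable, conv_summable; assumption).
  assert (Hconj : forall y, Cconj (Syn (- e) r y) = Syn e (conj_seq r) y).
  { intros y. rewrite Cconj_Syn, Z.opp_involutive. reflexivity. }
  unfold rhs_signed.
  replace (fun y => (alpha * (Cconj (Syn e p y) * dx_inv (fun z => Syn e p z * Syn e p z) y)
      + beta * (Syn (- e) r y * dx_inv (fun z => Syn e p z * Cconj (Syn (- e) r z)) y))%C)
    with (fun y => (alpha * (Syn (- e) (conj_seq p) y * Syn e d y)
      + beta * (Syn (- e) r y * Syn e d' y))%C).
  2:{ apply functional_extensionality. intros y.
      rewrite Cconj_Syn, dx_inv_Syn_mult by assumption.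
      replace (fun z => (Syn e p z * Cconj (Syn (- e) r z))%C)
        with (fun z => (Syn e p z * Syn e (conj_seq r) z)%C)
        by (apply functional_extensionality; intros; rewrite Hconj; reflexivity).
      rewrite dx_inv_Syn_mult by assumption. reflexivity. }
  set (g := fun k : nat => fourier _ (e * wavenumber k)).
  assert (Hg : forall n, g n = (alpha * CSeries (fun k => conj_seq p k * d (S (n + k)))
    + beta * CSeries (fun k => r k * d' (S (n + k))))%C).
  { intros n. unfold g.
    assert (T1 := tame_Syn_mult (- e) e _ _ Hcp Hd). assert (T2 := tame_Syn_mult (- e) e _ _ Hr Hd').
    rewrite (proj2 (tame_plus _ _ (proj1 (tame_scal alpha _ T1)) (proj1 (tame_scal beta _ T2)))).
    rewrite (proj2 (tame_scal alpha _ T1)), (proj2 (tame_scal beta _ T2)).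
    rewrite !fourier_Syn_opp_mult by assumption. reflexivity. }
  set (N := fun n => (alpha * tri (conj_seq p) p p n + beta * tri r p (conj_seq r) n)%C).
  set (h := fun k => (Ci * RtoC (IZR (e * wavenumber k)) * g k)%C).
  assert (HN : forall n, (Ci * h n = N n)%C).
  { intros n. unfold h, N. rewrite Hg.
    rewrite <- (tri_of_prim e (conj_seq p) p p n) by assumption.
    rewrite <- (tri_of_prim e r p (conj_seq r) n) by assumption.
    fold d d'. ring. }
  (* [N] is the vector field without its linear part, hence lies in the Sobolev space. *)
  assert (HNs : abs_summable N).
  { assert (Hf := coef_field_ex s alpha beta 0 0 p r Hs (coefs_finite _ p) (coefs_finite _ r)).
    apply (ell2_summable (Ell2 _ Hf)) in Hs. apply abs_summable_dom with (K := 1) (2 := Hs).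
    intros k. simpl coefs. unfold coef_field, symbol, N. rewrite Rmult_1_l. right. f_equal. ring. }
  assert (Hh : abs_summable h).
  { apply abs_summable_dom with (a := N) (K := 1); [|exact HNs]. intros k.
    rewrite <- HN, Cmod_mult, Cmod_Ci. lra. }
  assert (Hgs : abs_summable g).
  { apply abs_summable_dom with (a := h) (K := 1); [|exact Hh]. intros k. unfold h.
    rewrite !Cmod_mult, Cmod_Ci, Cmod_R.
    generalize (IZR_sign_wavenumber_ge e k He) (Cmod_ge_0 (g k)). intros. nra. }
  unfold Syn at 1.
  rewrite (dx_trig _ g x (fun k => wavenumber_neq_0 e k He) Hgs Hh).
  match goal with |- context [trig ?sg ?a x] => change (trig sg a x) with (Syn e h x) end.
  assert (Hinv : forall a, abs_summable a ->
    abs_summable (fun k => (/ (Ci * RtoC (IZR (e * wavenumber k))) * a k)%C)).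
  { intros a. apply abs_summable_dom with (K := 1). intros k. rewrite Cmod_mult.
    apply Rmult_le_compat_r; [apply Cmod_ge_0|apply Cmod_inv_Ci_IZR, He]. }
  replace (dx_inv (Syn e p))
    with (Syn e (fun k => (/ (Ci * RtoC (IZR (e * wavenumber k))) * p k)%C))
    by (apply functional_extensionality; intros; rewrite dx_inv_Syn by assumption; reflexivity).
  rewrite dx_inv_Syn by auto.
  set (q := fun k => (/ (Ci * RtoC (IZR (e * wavenumber k)))
    * (/ (Ci * RtoC (IZR (e * wavenumber k))) * p k))%C).
  assert (Hq : abs_summable q) by (apply Hinv, Hinv, Hp).
  replace (Ci * Syn e h x - gamma * Syn e p x - Ci * nu * Syn e q x)%C
    with (Ci * Syn e h x + ((- gamma) * Syn e p x + (- (Ci * nu)) * Syn e q x))%C by ring.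
  rewrite <- !Syn_scal by assumption.
  assert (H1 := abs_summable_scal Ci h Hh). assert (H2 := abs_summable_scal (- gamma)%C p Hp).
  assert (H3 := abs_summable_scal (- (Ci * nu))%C q Hq).
  rewrite <- (Syn_plus e _ _ x H2 H3).
  rewrite <- (Syn_plus e _ _ x H1 (abs_summable_plus _ _ H2 H3)).
  f_equal. apply functional_extensionality. intros k.
  rewrite HN. unfold coef_field, N, symbol, q. rewrite IZR_wavenumber.
  assert (HX0 : 0 < INR (S k)) by (apply lt_0_INR; lia).
  set (X := INR (S k)) in *.
  assert (HX : RtoC X <> RtoC 0) by (intros E; apply (f_equal fst) in E; simpl in E; lra).
  assert (HX' : X ^ 2 <> 0) by (apply pow_nonzero; lra).
  rewrite RtoC_inv, RtoC_pow, RtoC_mult by exact HX'.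
  assert (Hee : (RtoC (IZR e) * RtoC (IZR e) = 1)%C) by (rewrite <- RtoC_mult, sign_sqr by exact He; reflexivity).
  assert (Hes : RtoC (IZR e) <> RtoC 0).
  { intros E. rewrite E in Hee. apply (f_equal fst) in Hee. simpl in Hee. lra. }
  assert (HCC : (Ci * Ci = - 1)%C) by (unfold Ci, Cmult, Copp, RtoC; simpl; f_equal; ring).
  assert (HC : Ci <> RtoC 0) by (intros E; apply (f_equal snd) in E; simpl in E; lra).
  assert (Hsq : (/ (Ci * (RtoC (IZR e) * RtoC X))
      * (/ (Ci * (RtoC (IZR e) * RtoC X)) * p k) = - (/ RtoC X ^ 2 * p k))%C).
  { transitivity (/ (Ci * Ci * (RtoC (IZR e) * RtoC (IZR e))) * (/ RtoC X ^ 2 * p k))%C.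
    - field. auto.
    - rewrite HCC, Hee. field. exact HX. }
  rewrite Hsq. ring.
Qed.


(** * The blow-up criterion in phase space *)

Lemma ode_phase_density_continuous {s} (F : phase_space s -> phase_space s)
    (Y : R -> phase_space s) (b x : R) :
  1 / 2 < s -> 0 <= b -> ode_sol F (fun t => 0 <= t <= b) Y ->
  continuous (fun r => phase_density (Y (clamp 0 b r))) x.
Proof.
  intros Hs Hb HY.
  assert (Hw : forall pr : phase_space s -> ell2 s,
    (forall z z' : phase_space s, ell2_norm (minus (pr z) (pr z')) <= norm (minus z z')) ->
    continuous (fun r => wiener (pr (Y (clamp 0 b r))) ^ 2) x).
  { intros pr Hpr.
    assert (Hc : continuous (fun r => wiener (pr (Y (clamp 0 b r)))) x).
    { apply (continuous_clamp (fun r => wiener (pr (Y r))) 0 b Hb).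
      intros t Ht eps Heps.
      assert (HE : 0 <= embed_const s) by apply sqrt_pos.
      assert (He : 0 < eps / (embed_const s + 1)) by (apply Rdiv_lt_0_compat; lra).
      destruct (has_deriv_cont _ _ _ _ (HY t Ht) _ He) as [d [Hd K]].
      exists d. split; [exact Hd|]. intros r Hr Hrt.
      eapply Rle_trans; [apply wiener_lipschitz, Hs|].
      apply Rle_trans with ((embed_const s + 1) * (eps / (embed_const s + 1))).
      - apply Rmult_le_compat; [exact HE|apply sqrt_pos|lra|].
        eapply Rle_trans; [apply Hpr|]. apply K; assumption.
      - right. field. lra. }
    apply (continuous_comp (fun r => wiener (pr (Y (clamp 0 b r)))) (fun z => z ^ 2)); [exact Hc|].
    apply (ex_derive_continuous (fun z : R => z ^ 2)). auto_derive. easy. }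
  apply (continuous_plus (V := R_NormedModule)); apply Hw.
  - intros z z'. exact (phase_norm_fst s (minus z z')).
  - intros z z'. exact (phase_norm_snd s (minus z z')).
Qed.

Lemma phase_density_nonneg {s} (x : phase_space s) : 0 <= phase_density x.
Proof. unfold phase_density. generalize (pow2_ge_0 (wiener (fst x))) (pow2_ge_0 (wiener (snd x))). lra. Qed.

Lemma ode_phase_density_int {s} (F : phase_space s -> phase_space s)
    (Y : R -> phase_space s) (b a c : R) :
  1 / 2 < s -> 0 <= a <= c -> c <= b -> ode_sol F (fun t => 0 <= t <= b) Y ->
  ex_RInt (fun r => phase_density (Y r)) a c.
Proof.
  intros Hs Hac Hcb HY.
  apply ex_RInt_ext with (fun r => phase_density (Y (clamp 0 b r))).
  - rewrite Rmin_left, Rmax_right by lra. intros x Hx. rewrite clamp_id by lra. reflexivity.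
  - apply (ex_RInt_continuous (V := R_CompleteNormedModule)). intros z _.
    apply ode_phase_density_continuous with F; [exact Hs|lra|exact HY].
Qed.

Lemma growth_const_nonneg s alpha beta : 0 <= growth_const s alpha beta.
Proof.
  unfold growth_const. generalize (tri_const_pos s) (Rabs_pos alpha) (Rabs_pos beta). intros.
  apply Rmult_le_pos; [lra|]. apply Rmult_le_pos; lra.
Qed.

(** Gronwall's inequality with the rate of [flow_field_growth].  The rate is clamped to be
    continuous on the whole line, so that its integral is differentiable at the endpoints. *)
Lemma flow_norm_bound s alpha beta gamma nu (Y : R -> phase_space s) (b : R) :
  1 / 2 < s -> 0 <= b ->
  ode_sol (flow_field s alpha beta gamma nu) (fun t => 0 <= t <= b) Y ->
  norm (Y b) <= norm (Y 0) * exp (growth_const s alpha beta * RInt (fun r => phase_density (Y r)) 0 b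
    + 2 * (Rabs gamma + Rabs nu) * b).
Proof.
  intros Hs Hb HY.
  set (D := fun r => phase_density (Y (clamp 0 b r))).
  assert (HD : forall x, continuous D x)
    by (intros x; apply ode_phase_density_continuous with (flow_field s alpha beta gamma nu); assumption).
  set (a := fun r => growth_const s alpha beta * D r + 2 * (Rabs gamma + Rabs nu)).
  assert (Ha : forall x, continuous a x).
  { intros x. apply (continuous_plus (V := R_NormedModule)).
    - apply (continuous_scal_r (V := R_NormedModule) (growth_const s alpha beta) D), HD.
    - apply continuous_const. }
  assert (Hex : forall f : R -> R, (forall x, continuous f x) -> forall c, ex_RInt f 0 c).
  { intros f Hf c. apply (ex_RInt_continuous (V := R_CompleteNormedModule)). intros; apply Hf. }
  assert (H := norm_gronwall Y (fun t => flow_field s alpha beta gamma nu (Y t)) a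
    (fun t => RInt a 0 t) b Hb).
  eapply Rle_trans; [apply H|].
  - intros t Ht. apply (is_derive_RInt (V := R_NormedModule) a (fun t => RInt a 0 t) 0 t).
    + apply filter_forall. intros c. apply (RInt_correct (V := R_CompleteNormedModule)), Hex, Ha.
    + apply Ha.
  - exact HY.
  - intros t Ht. unfold a, D. rewrite clamp_id by exact Ht. apply flow_field_growth, Hs.
  - apply Rmult_le_compat_l; [apply norm_ge_0|]. right. f_equal.
    rewrite RInt_point. transitivity (RInt a 0 b); [apply Rminus_0_r|].
    apply (is_RInt_unique (V := R_CompleteNormedModule)).
    replace (RInt (fun r => phase_density (Y r)) 0 b) with (RInt D 0 b).
    + evar_last.
      * apply (is_RInt_plus (V := R_NormedModule)).
        -- apply (is_RInt_scal (V := R_NormedModule)).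
           apply (RInt_correct (V := R_CompleteNormedModule)), Hex, HD.
        -- apply (is_RInt_const (V := R_NormedModule)).
      * unfold plus, scal; simpl. unfold mult; simpl. ring.
    + apply RInt_ext. rewrite Rmin_left, Rmax_right by lra. intros x Hx. unfold D.
      rewrite clamp_id by lra. reflexivity.
Qed.

Lemma ode_phase_density_mono {s} (F : phase_space s -> phase_space s)
    (Y : R -> phase_space s) (r t : R) :
  1 / 2 < s -> 0 <= r <= t -> ode_sol F (fun q => 0 <= q <= t) Y ->
  RInt (fun q => phase_density (Y q)) 0 r <= RInt (fun q => phase_density (Y q)) 0 t.
Proof.
  intros Hs Hrt HY.
  rewrite <- (RInt_Chasles (V := R_CompleteNormedModule) (fun q => phase_density (Y q)) 0 r t).
  - assert (0 <= RInt (fun q => phase_density (Y q)) r t).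
    { apply RInt_ge_0; [lra| |].
      - apply ode_phase_density_int with F t; [exact Hs|lra|lra|exact HY].
      - intros; apply phase_density_nonneg. }
    unfold plus; simpl. lra.
  - apply ode_phase_density_int with F t; [exact Hs|lra|lra|exact HY].
  - apply ode_phase_density_int with F t; [exact Hs|lra|lra|exact HY].
Qed.

(** The bound [M] keeps the Sobolev norm bounded up to [b], which is all that continuation
    requires. *)
Lemma flow_continue s alpha beta gamma nu (Y : R -> phase_space s) (b M : R) :
  1 / 2 < s -> 0 < b ->
  ode_sol (flow_field s alpha beta gamma nu) (Ico 0 b) Y ->
  (forall t, 0 <= t < b -> RInt (fun r => phase_density (Y r)) 0 t <= M) ->
  exists b' Z, b < b' /\ ode_sol (flow_field s alpha beta gamma nu) (Ico 0 b') Z /\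
    forall t, Ico 0 b t -> Z t = Y t.
Proof.
  intros Hs Hb HY HM.
  apply (ode_continue (flow_field s alpha beta gamma nu)
    (fun M => 2 * coef_field_lip s alpha beta gamma nu M)
    (norm (Y 0) * exp (growth_const s alpha beta * M + 2 * (Rabs gamma + Rabs nu) * b))).
  - apply flow_field_lipschitz, Hs.
  - apply flow_field_zero.
  - exact Hb.
  - apply Rmult_le_pos; [apply norm_ge_0|left; apply exp_pos].
  - exact HY.
  - intros t Ht. unfold Ico in Ht.
    eapply Rle_trans; [apply (flow_norm_bound s alpha beta gamma nu Y t Hs)|].
    + lra.
    + apply ode_sol_incl with (Ico 0 b); [unfold Ico; intros; lra|exact HY].
    + apply Rmult_le_compat_l; [apply norm_ge_0|]. apply exp_increasing_le.
      apply Rplus_le_compat.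
      * apply Rmult_le_compat_l; [apply growth_const_nonneg|]. apply HM, Ht.
      * apply Rmult_le_compat_l; [|lra]. generalize (Rabs_pos gamma) (Rabs_pos nu). lra.
Qed.


(** * Between functions and coefficient sequences *)

Definition coef (e : Z) (s : R) (f : R -> C) : ell2 s :=
  ell2_make s (fun k => fourier f (e * wavenumber k)).

Lemma sobolev_term_signed s f e k : is_sign e ->
  sobolev_term s f (e * wavenumber k) = sob_term s (fun k => fourier f (e * wavenumber k)) k.
Proof.
  intros He. unfold sobolev_term, sob_term, weight. f_equal. f_equal.
  rewrite IZR_wavenumber, Rabs_mult, (Rabs_pos_eq (INR _)) by apply pos_INR.
  replace (Rabs (IZR e)) with 1; [ring|].
  destruct He as [-> | ->]; unfold Rabs; destruct Rcase_abs; lra.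
Qed.

Lemma sobolev_term_nonneg s f n : 0 <= sobolev_term s f n.
Proof. apply Rmult_le_pos; [left; apply exp_pos|apply pow2_ge_0]. Qed.

Lemma paired_signed e (a : Z -> R) k : is_sign e ->
  paired (G := R_AbelianMonoid) a k = a (e * wavenumber k)%Z + a (- (e * wavenumber k))%Z.
Proof.
  intros He. unfold paired. change (@plus R_AbelianMonoid) with Rplus.
  destruct He as [-> | ->].
  - rewrite Z.mul_1_l. reflexivity.
  - replace (-1 * wavenumber k)%Z with (- wavenumber k)%Z by ring.
    rewrite Z.opp_involutive. apply Rplus_comm.
Qed.

Lemma Hdot_coef_finite e s f : is_sign e -> Hdot s f ->
  ex_series (sob_term s (fun k => fourier f (e * wavenumber k))).
Proof.
  intros He Hf.
  apply (ex_series_le (V := R_CompleteNormedModule) _ (paired (sobolev_term s f))).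
  - intros k. change (Rabs (sob_term s (fun k => fourier f (e * wavenumber k)) k)
      <= paired (sobolev_term s f) k).
    rewrite Rabs_pos_eq by apply sob_term_pos.
    rewrite (paired_signed e) by exact He. rewrite <- sobolev_term_signed by exact He.
    generalize (sobolev_term_nonneg s f (- (e * wavenumber k))). lra.
  - exact (Hdot_finite s f Hf).
Qed.

Lemma coef_coefs e s f k : is_sign e -> Hdot s f ->
  coef e s f k = fourier f (e * wavenumber k).
Proof. intros He Hf. apply ell2_make_coefs, Hdot_coef_finite; assumption. Qed.

(** The clause [projP u x = u x] is itself the one-sided Fourier expansion of [u]. *)
Lemma Hplus_Syn s u : Hplus s u -> u = Syn 1 (coef 1 s u).
Proof.
  intros [Hu Hp]. apply functional_extensionality. intros x. rewrite <- Hp at 1.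
  change (Syn 1 (fun k => fourier u (1 * wavenumber k)) x = Syn 1 (coef 1 s u) x).
  f_equal. apply functional_extensionality. intros k. symmetry.
  apply coef_coefs; [left; reflexivity|exact Hu].
Qed.

Lemma Hminus_Syn s v : Hminus s v -> v = Syn (-1) (coef (-1) s v).
Proof.
  intros [Hv Hp]. apply functional_extensionality. intros x. rewrite <- Hp at 1.
  change (Syn (-1) (fun k => fourier v (-1 * wavenumber k)) x = Syn (-1) (coef (-1) s v) x).
  f_equal. apply functional_extensionality. intros k. symmetry.
  apply coef_coefs; [right; reflexivity|exact Hv].
Qed.

Lemma fourier_Syn_opp e a k : is_sign e -> abs_summable a ->
  fourier (Syn e a) (- (e * wavenumber k)) = RtoC 0.
Proof.
  intros He Ha. apply fourier_Syn_miss; [exact Ha|].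
  intros j. unfold wavenumber. destruct He as [-> | ->]; lia.
Qed.

Lemma paired_sobolev_Syn e s (a : ell2 s) k : is_sign e -> 1 / 2 < s ->
  paired (sobolev_term s (Syn e a)) k = sob_term s a k.
Proof.
  intros He Hs. assert (Ha := ell2_summable a Hs).
  change (paired (G := R_AbelianMonoid) (sobolev_term s (Syn e a)) k = sob_term s a k).
  rewrite (paired_signed e) by exact He.
  rewrite sobolev_term_signed by exact He. unfold sobolev_term.
  rewrite fourier_Syn_opp by assumption. rewrite Cmod_0. unfold sob_term.
  rewrite fourier_Syn_hit by assumption.
  assert (E : forall b c : R, b + c * 0 ^ 2 = b) by (intros; ring). apply E.
Qed.

Lemma normH_Syn e s (a : ell2 s) : is_sign e -> 1 / 2 < s -> normH s (Syn e a) = ell2_norm a.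
Proof.
  intros He Hs. unfold normH, ell2_norm. f_equal. apply Series_ext. intros k.
  apply paired_sobolev_Syn; assumption.
Qed.

Lemma normA_Syn e a : is_sign e -> abs_summable a -> normA (Syn e a) = wiener a.
Proof.
  intros He Ha. unfold normA, wiener. apply Series_ext. intros k.
  change (paired (G := R_AbelianMonoid) (fun n => Cmod (fourier (Syn e a) n)) k = Cmod (a k)).
  rewrite (paired_signed e) by exact He.
  rewrite fourier_Syn_opp, fourier_Syn_hit by assumption. rewrite Cmod_0. apply Rplus_0_r.
Qed.

Lemma Hdot_Syn e s (a : ell2 s) : is_sign e -> 1 / 2 < s -> Hdot s (Syn e a).
Proof.
  intros He Hs. assert (Ha := ell2_summable a Hs). split.
  - intros x. unfold Syn, trig. apply CSeries_ext. intros k. unfold trig_term.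
    rewrite Rmult_plus_distr_l, expi_plus, expi_2PI. ring.
  - apply fourier_Syn_miss; [exact Ha|]. intros k E. symmetry in E.
    revert E. apply wavenumber_neq_0, He.
  - apply ex_series_ext with (2 := coefs_finite _ a).
    intros k. symmetry. apply paired_sobolev_Syn; assumption.
  - intros x. apply (is_series_ext (V := C_R_NormedModule) (trig_term (fun k => (e * wavenumber k)%Z) a x)).
    + intros k. unfold paired, mode, trig_term.
      change (@plus C_AbelianMonoid) with Cplus.
      assert (H1 := fourier_Syn_hit e a k He Ha). assert (H2 := fourier_Syn_opp e a k He Ha).
      destruct He as [-> | ->].
      * replace (1 * wavenumber k)%Z with (wavenumber k) in * by ring. rewrite H1, H2.
        match goal with |- _ = ?z => change (@eq C (a k * expi (IZR (wavenumber k) * x))%C z) end.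
        ring.
      * replace (- (-1 * wavenumber k))%Z with (wavenumber k) in H2 by ring.
        replace (-1 * wavenumber k)%Z with (- wavenumber k)%Z in * by ring. rewrite H1, H2.
        match goal with |- _ = ?z => change (@eq C (a k * expi (IZR (- wavenumber k) * x))%C z) end.
        ring.
    + apply is_series_CSeries, trig_term_summable, Ha.
Qed.

Lemma proj_Syn e a x : is_sign e -> abs_summable a ->
  Syn e (fun k => fourier (Syn e a) (e * wavenumber k)) x = Syn e a x.
Proof.
  intros He Ha. f_equal. apply functional_extensionality. intros k.
  apply fourier_Syn_hit; assumption.
Qed.

Lemma Hplus_of_Syn s (a : ell2 s) : 1 / 2 < s -> Hplus s (Syn 1 a).
Proof.
  intros Hs. split; [apply Hdot_Syn; [left; reflexivity|exact Hs]|].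
  intros x.
  change (Syn 1 (fun k => fourier (Syn 1 a) (1 * wavenumber k)) x = Syn 1 a x).
  apply proj_Syn; [left; reflexivity|apply ell2_summable, Hs].
Qed.

Lemma Hminus_of_Syn s (a : ell2 s) : 1 / 2 < s -> Hminus s (Syn (-1) a).
Proof.
  intros Hs. split; [apply Hdot_Syn; [right; reflexivity|exact Hs]|].
  intros x.
  change (Syn (-1) (fun k => fourier (Syn (-1) a) (-1 * wavenumber k)) x = Syn (-1) a x).
  apply proj_Syn; [right; reflexivity|apply ell2_summable, Hs].
Qed.

Lemma Syn_minus e s (a b : ell2 s) x : 1 / 2 < s ->
  (Syn e a x - Syn e b x)%C = Syn e (minus a b) x.
Proof.
  intros Hs. change (Syn e (minus a b) x) with (Syn e (fun k => a k + - b k)%C x).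
  replace (fun k => (a k + - b k)%C) with (fun k => (a k + (- 1) * b k)%C)
    by (apply functional_extensionality; intros; ring).
  rewrite Syn_plus, Syn_scal; auto using ell2_summable, abs_summable_scal. ring.
Qed.

Lemma Syn_Rscal e s (c : R) (a : ell2 s) x : 1 / 2 < s ->
  (RtoC c * Syn e a x)%C = Syn e (scal c a) x.
Proof. intros Hs. symmetry. apply Syn_scal, ell2_summable, Hs. Qed.

Lemma normH_quotient e s (a b w : ell2 s) (h : R) : is_sign e -> 1 / 2 < s -> h <> 0 ->
  normH s (fun x => (Syn e a x - Syn e b x) / RtoC h - Syn e w x)%C
  = norm (minus (scal (/ h) (minus a b)) w).
Proof.
  intros He Hs Hh. change (norm (minus (scal (/ h) (minus a b)) w))
    with (ell2_norm (minus (scal (/ h) (minus a b)) w)).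
  rewrite <- (normH_Syn e s _ He Hs). f_equal. apply functional_extensionality. intros x.
  rewrite <- Syn_minus, <- Syn_Rscal, <- Syn_minus by exact Hs.
  rewrite RtoC_inv by exact Hh. unfold Cdiv. ring.
Qed.

Lemma scal_inv_cancel {V : ModuleSpace R_Ring} (c c' : R) (v : V) :
  c * c' = 1 -> scal c (scal c' v) = v.
Proof.
  intros H. rewrite scal_assoc.
  replace (mult c c') with (one (K := R_Ring)) by (symmetry; exact H). apply scal_one.
Qed.

Lemma scal_quotient {V : ModuleSpace R_Ring} (c : R) (d w : V) :
  c <> 0 -> minus d (scal c w) = scal c (minus (scal (/ c) d) w).
Proof.
  intros Hc. rewrite scal_minus_distr_l, scal_inv_cancel; [reflexivity|]. field. exact Hc.
Qed.

Lemma scal_quotient_inv {V : ModuleSpace R_Ring} (c : R) (d w : V) :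
  c <> 0 -> minus (scal (/ c) d) w = scal (/ c) (minus d (scal c w)).
Proof.
  intros Hc. rewrite scal_minus_distr_l, scal_inv_cancel; [reflexivity|]. field. exact Hc.
Qed.

Lemma minus_self_scal_0 {V : ModuleSpace R_Ring} (v w : V) :
  minus (minus v v) (scal 0 w) = zero.
Proof.
  replace (scal 0 w) with (minus w w) by (rewrite minus_eq_zero; symmetry; exact (scal_zero_l w)).
  rewrite !minus_eq_zero. reflexivity.
Qed.

(** The passage to the difference quotients of [is_derive_H]. *)
Lemma has_deriv_quotient {X : NormedModule R_AbsRing} (I : R -> Prop) (y : R -> X) (t : R) (w : X) :
  has_deriv I y t w <->
  forall eps, 0 < eps -> exists del, 0 < del /\
    forall r, I r -> r <> t -> Rabs (r - t) < del ->
      norm (minus (scal (/ (r - t)) (minus (y r) (y t))) w) <= eps.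
Proof.
  assert (Hq : forall r, r <> t ->
    minus (minus (y r) (y t)) (scal (r - t) w)
    = scal (r - t) (minus (scal (/ (r - t)) (minus (y r) (y t))) w)).
  { intros r Hr. apply (scal_quotient (V := X) (r - t) (minus (y r) (y t)) w). lra. }
  assert (Hq' : forall r, r <> t ->
    minus (scal (/ (r - t)) (minus (y r) (y t))) w
    = scal (/ (r - t)) (minus (minus (y r) (y t)) (scal (r - t) w))).
  { intros r Hr. apply (scal_quotient_inv (V := X) (r - t) (minus (y r) (y t)) w). lra. }
  split; intros H eps Heps; destruct (H eps Heps) as [d [Hd K]]; exists d; (split; [exact Hd|]).
  - intros r Hr Hne Hrt. rewrite Hq' by exact Hne.
    eapply Rle_trans; [apply norm_scal_le|].
    assert (Hp : 0 < Rabs (r - t)) by (apply Rabs_pos_lt; lra).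
    apply Rle_trans with (Rabs (/ (r - t)) * (eps * Rabs (r - t))).
    + apply Rmult_le_compat_l; [apply Rabs_pos|]. apply K; assumption.
    + rewrite Rabs_inv. right. field. lra.
  - intros r Hr Hrt. destruct (Req_dec r t) as [->|Hne].
    + replace (t - t) with 0 by ring. rewrite Rabs_R0, Rmult_0_r.
      right. eapply eq_trans; [|apply (norm_zero (V := X))]. f_equal.
      exact (minus_self_scal_0 (V := X) (y t) w).
    + rewrite Hq by exact Hne. eapply Rle_trans; [apply norm_scal_le|].
      rewrite Rmult_comm. apply Rmult_le_compat_r; [apply Rabs_pos|]. apply K; assumption.
Qed.

Lemma is_derive_H_Syn e s (I : R -> Prop) (u : R -> R -> C) (p : R -> ell2 s) (t : R) (w : ell2 s) :
  is_sign e -> 1 / 2 < s -> I t -> (forall r, I r -> u r = Syn e (p r)) ->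
  (is_derive_H s I u t (Syn e w) <-> has_deriv I p t w).
Proof.
  intros He Hs Ht Hu. rewrite has_deriv_quotient. unfold is_derive_H. split.
  - intros [_ H] eps Heps.
    destruct (proj1 (filterlim_locally _ _) H (mkposreal _ Heps)) as [d Hd].
    exists d. split; [apply cond_pos|]. intros r Hr Hne Hrt.
    specialize (Hd r Hrt (conj Hr Hne)).
    change (Rabs (normH s (fun x => (u r x - u t x) / RtoC (r - t) - Syn e w x)%C - 0) < eps) in Hd.
    rewrite (Hu r Hr), (Hu t Ht), normH_quotient in Hd by (assumption || lra).
    apply Rabs_lt_between in Hd. rewrite Rminus_0_r in Hd. left. apply Hd.
  - intros H. split; [apply Hdot_Syn; assumption|].
    apply filterlim_locally. intros eps.
    destruct (H (eps / 2)) as [d [Hd K]]; [generalize (cond_pos eps); lra|].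
    exists (mkposreal d Hd). intros r Hrt [Hr Hne].
    change (Rabs (normH s (fun x => (u r x - u t x) / RtoC (r - t) - Syn e w x)%C - 0) < eps).
    rewrite Rminus_0_r, Rabs_pos_eq by apply sqrt_pos.
    rewrite (Hu r Hr), (Hu t Ht), normH_quotient by (assumption || lra).
    apply Rle_lt_trans with (1 := K r Hr Hne Hrt). generalize (cond_pos eps). lra.
Qed.

Lemma continuous_H_Syn e s (I : R -> Prop) (u : R -> R -> C) (p : R -> ell2 s) (t : R) (w : ell2 s) :
  is_sign e -> 1 / 2 < s -> I t -> (forall r, I r -> u r = Syn e (p r)) ->
  has_deriv I p t w -> continuous_H s I u t.
Proof.
  intros He Hs Ht Hu H. apply filterlim_locally. intros eps.
  destruct (has_deriv_cont _ _ _ _ H (eps / 2)) as [d [Hd K]]; [generalize (cond_pos eps); lra|].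
  exists (mkposreal d Hd). intros r Hrt Hr.
  change (Rabs (normH s (fun x => u r x - u t x)%C - 0) < eps).
  rewrite Rminus_0_r, Rabs_pos_eq by apply sqrt_pos.
  rewrite (Hu r Hr), (Hu t Ht).
  replace (fun x => (Syn e (p r) x - Syn e (p t) x)%C) with (Syn e (minus (p r) (p t)))
    by (apply functional_extensionality; intros; rewrite Syn_minus by exact Hs; reflexivity).
  rewrite normH_Syn by assumption.
  apply Rle_lt_trans with (1 := K r Hr Hrt). generalize (cond_pos eps). lra.
Qed.

Lemma has_deriv_pair s (I : R -> Prop) (y : R -> phase_space s) (t : R) (w : phase_space s) :
  has_deriv I y t w <->
  has_deriv I (fun r => fst (y r)) t (fst w) /\ has_deriv I (fun r => snd (y r)) t (snd w).
Proof.
  split.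
  - intros H. split; intros eps Heps; destruct (H eps Heps) as [d [Hd K]]; exists d;
      (split; [exact Hd|]); intros r Hr Hrt; eapply Rle_trans; try apply (K r Hr Hrt).
    + exact (phase_norm_fst s (minus (minus (y r) (y t)) (scal (r - t) w))).
    + exact (phase_norm_snd s (minus (minus (y r) (y t)) (scal (r - t) w))).
  - intros [H1 H2] eps Heps.
    destruct (H1 (eps / 2) ltac:(lra)) as [d1 [Hd1 K1]].
    destruct (H2 (eps / 2) ltac:(lra)) as [d2 [Hd2 K2]].
    exists (Rmin d1 d2). split; [apply Rmin_pos; lra|]. intros r Hr Hrt.
    specialize (K1 r Hr (Rlt_le_trans _ _ _ Hrt (Rmin_l _ _))).
    specialize (K2 r Hr (Rlt_le_trans _ _ _ Hrt (Rmin_r _ _))).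
    eapply Rle_trans; [apply (phase_norm_le s)|].
    eapply Rle_trans; [exact (Rplus_le_compat _ _ _ _ K1 K2)|]. right. field.
Qed.

Definition phase_point (s : R) (u v : R -> C) : phase_space s := (coef 1 s u, coef (-1) s v).

Lemma Syn_coef_field e s alpha beta gamma nu (p r : ell2 s) : 1 / 2 < s ->
  Syn e (ell2_make s (coef_field alpha beta gamma nu p r)) = Syn e (coef_field alpha beta gamma nu p r).
Proof.
  intros Hs. f_equal. apply functional_extensionality. intros k.
  apply ell2_make_coefs, coef_field_ex; [exact Hs| |]; apply coefs_finite.
Qed.

Lemma sign_1 : is_sign 1.
Proof. left; reflexivity. Qed.

Lemma sign_m1 : is_sign (-1).
Proof. right; reflexivity. Qed.

Lemma rhs_u_Syn s alpha beta gamma nu (x : phase_space s) : 1 / 2 < s ->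
  rhs_u alpha beta gamma nu (Syn 1 (fst x)) (Syn (-1) (snd x))
  = Syn 1 (fst (flow_field s alpha beta gamma nu x)).
Proof.
  intros Hs. apply functional_extensionality. intros z. rewrite rhs_u_signed.
  simpl fst. rewrite Syn_coef_field by exact Hs.
  exact (rhs_signed_Syn 1 alpha beta gamma nu s (fst x) (snd x) z sign_1 Hs).
Qed.

Lemma rhs_v_Syn s alpha beta gamma nu (x : phase_space s) : 1 / 2 < s ->
  rhs_v alpha beta gamma nu (Syn 1 (fst x)) (Syn (-1) (snd x))
  = Syn (-1) (snd (flow_field s alpha beta gamma nu x)).
Proof.
  intros Hs. apply functional_extensionality. intros z. rewrite rhs_v_signed.
  simpl snd. rewrite Syn_coef_field by exact Hs.
  exact (rhs_signed_Syn (-1) alpha beta gamma nu s (snd x) (fst x) z sign_m1 Hs).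
Qed.

Lemma solution_to_ode s alpha beta gamma nu f g I u v : 1 / 2 < s ->
  is_solution alpha beta gamma nu s f g I u v ->
  ode_sol (flow_field s alpha beta gamma nu) I (fun t => phase_point s (u t) (v t)).
Proof.
  intros Hs H t Ht.
  assert (Hu : forall r, I r -> u r = Syn 1 (coef 1 s (u r)))
    by (intros r Hr; apply Hplus_Syn, (sol_u_space _ _ _ _ _ _ _ _ _ _ H r Hr)).
  assert (Hv : forall r, I r -> v r = Syn (-1) (coef (-1) s (v r)))
    by (intros r Hr; apply Hminus_Syn, (sol_v_space _ _ _ _ _ _ _ _ _ _ H r Hr)).
  assert (Eu := sol_u_eq _ _ _ _ _ _ _ _ _ _ H t Ht).
  assert (Ev := sol_v_eq _ _ _ _ _ _ _ _ _ _ H t Ht).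
  apply has_deriv_pair. split.
  - apply (is_derive_H_Syn 1 s I u (fun r => coef 1 s (u r)) t _ sign_1 Hs Ht Hu).
    rewrite <- rhs_u_Syn by exact Hs. unfold phase_point. simpl fst. simpl snd.
    rewrite <- (Hu t Ht), <- (Hv t Ht). exact Eu.
  - apply (is_derive_H_Syn (-1) s I v (fun r => coef (-1) s (v r)) t _ sign_m1 Hs Ht Hv).
    rewrite <- rhs_v_Syn by exact Hs. unfold phase_point. simpl fst. simpl snd.
    rewrite <- (Hu t Ht), <- (Hv t Ht). exact Ev.
Qed.

Lemma ode_to_solution s alpha beta gamma nu f g I (y : R -> phase_space s) : 1 / 2 < s ->
  Hplus s f -> Hminus s g -> y 0 = phase_point s f g ->
  ode_sol (flow_field s alpha beta gamma nu) I y ->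
  is_solution alpha beta gamma nu s f g I
    (fun t => Syn 1 (fst (y t))) (fun t => Syn (-1) (snd (y t))).
Proof.
  intros Hs Hf Hg H0 Hy.
  assert (Hd : forall t, I t ->
    has_deriv I (fun r => fst (y r)) t (fst (flow_field s alpha beta gamma nu (y t))) /\
    has_deriv I (fun r => snd (y r)) t (snd (flow_field s alpha beta gamma nu (y t)))).
  { intros t Ht. apply has_deriv_pair, Hy, Ht. }
  split.
  - intros t _. apply Hplus_of_Syn, Hs.
  - intros t _. apply Hminus_of_Syn, Hs.
  - intros t Ht. apply (continuous_H_Syn 1 s I _ (fun r => fst (y r)) t _ sign_1 Hs Ht)
      with (2 := proj1 (Hd t Ht)). reflexivity.
  - intros t Ht. apply (continuous_H_Syn (-1) s I _ (fun r => snd (y r)) t _ sign_m1 Hs Ht)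
      with (2 := proj2 (Hd t Ht)). reflexivity.
  - intros t Ht. rewrite rhs_u_Syn by exact Hs.
    apply (is_derive_H_Syn 1 s I _ (fun r => fst (y r)) t _ sign_1 Hs Ht); [reflexivity|].
    apply Hd, Ht.
  - intros t Ht. rewrite rhs_v_Syn by exact Hs.
    apply (is_derive_H_Syn (-1) s I _ (fun r => snd (y r)) t _ sign_m1 Hs Ht); [reflexivity|].
    apply Hd, Ht.
  - intros x. rewrite H0. simpl fst. rewrite <- (Hplus_Syn s f Hf). reflexivity.
  - intros x. rewrite H0. simpl snd. rewrite <- (Hminus_Syn s g Hg). reflexivity.
Qed.

Lemma solution_initial s alpha beta gamma nu f g I u v :
  is_solution alpha beta gamma nu s f g I u v -> phase_point s (u 0) (v 0) = phase_point s f g.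
Proof.
  intros H.
  replace (u 0) with f by (apply functional_extensionality; intros x; symmetry; apply H).
  replace (v 0) with g by (apply functional_extensionality; intros x; symmetry; apply H).
  reflexivity.
Qed.

Lemma phase_point_norm s f g : 1 / 2 < s -> Hplus s f -> Hminus s g ->
  norm (phase_point s f g) <= normH s f + normH s g.
Proof.
  intros Hs Hf Hg. eapply Rle_trans; [apply (phase_norm_le s)|].
  assert (Ef : normH s f = ell2_norm (coef 1 s f))
    by (rewrite (Hplus_Syn s f Hf) at 1; apply normH_Syn; [apply sign_1|exact Hs]).
  assert (Eg : normH s g = ell2_norm (coef (-1) s g))
    by (rewrite (Hminus_Syn s g Hg) at 1; apply normH_Syn; [apply sign_m1|exact Hs]).
  rewrite Ef, Eg. apply Rle_refl.
Qed.

Lemma wiener_density_phase s alpha beta gamma nu f g I u v t : 1 / 2 < s ->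
  is_solution alpha beta gamma nu s f g I u v -> I t ->
  wiener_density u v t = phase_density (phase_point s (u t) (v t)).
Proof.
  intros Hs H Ht. unfold wiener_density, phase_density, phase_point. simpl fst. simpl snd.
  rewrite (Hplus_Syn s (u t)) at 1 by apply H, Ht.
  rewrite (Hminus_Syn s (v t)) at 1 by apply H, Ht.
  rewrite !normA_Syn by (apply sign_1 || apply sign_m1 || (apply ell2_summable, Hs)).
  reflexivity.
Qed.

(** * Local well-posedness and the continuation criterion *)

(** If the integral stayed bounded, the solution would continue; being monotone, an
    unbounded integral tends to infinity. *)
Lemma wiener_criterion s alpha beta gamma nu f g Tstar u v : 1 / 2 < s ->
  Hplus s f -> Hminus s g -> 0 < Tstar ->
  breaks_down alpha beta gamma nu s f g Tstar u v ->
  (forall t, 0 <= t < Tstar -> ex_RInt (wiener_density u v) 0 t) /\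
  increases_to_infinity (fun t => RInt (wiener_density u v) 0 t) Tstar.
Proof.
  intros Hs Hf Hg HT [Hsol Hmax].
  set (Y := fun t => phase_point s (u t) (v t)).
  assert (HY : ode_sol (flow_field s alpha beta gamma nu) (Ico 0 Tstar) Y)
    by exact (solution_to_ode s alpha beta gamma nu f g _ u v Hs Hsol).
  assert (HYt : forall t, 0 <= t < Tstar ->
    ode_sol (flow_field s alpha beta gamma nu) (fun r => 0 <= r <= t) Y).
  { intros t Ht. apply ode_sol_incl with (2 := HY). unfold Ico. intros; lra. }
  assert (Hden : forall t, Ico 0 Tstar t -> phase_density (Y t) = wiener_density u v t)
    by (intros t Ht; symmetry;
        exact (wiener_density_phase s alpha beta gamma nu f g _ u v t Hs Hsol Ht)).
  assert (Hint : forall t, 0 <= t < Tstar ->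
    RInt (fun r => phase_density (Y r)) 0 t = RInt (wiener_density u v) 0 t).
  { intros t Ht. apply RInt_ext. rewrite Rmin_left, Rmax_right by lra.
    intros x Hx. apply Hden. unfold Ico; lra. }
  assert (Hmono : forall r t, 0 <= r -> r <= t -> t < Tstar ->
    RInt (wiener_density u v) 0 r <= RInt (wiener_density u v) 0 t).
  { intros r t H1 H2 H3. rewrite <- !Hint by lra.
    apply ode_phase_density_mono with (flow_field s alpha beta gamma nu); [exact Hs|lra|].
    apply HYt; lra. }
  split; [|split; [exact Hmono|]].
  - intros t Ht. apply ex_RInt_ext with (fun r => phase_density (Y r)).
    + rewrite Rmin_left, Rmax_right by lra. intros x Hx. apply Hden. unfold Ico; lra.
    + apply ode_phase_density_int with (flow_field s alpha beta gamma nu) t; try lra; try assumption.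
      apply HYt, Ht.
  - assert (Hunb : forall M, exists t, 0 <= t < Tstar /\ M < RInt (wiener_density u v) 0 t).
    { intros M. apply NNPP. intros Hn. apply Hmax.
      destruct (flow_continue s alpha beta gamma nu Y Tstar M Hs HT HY) as [T' [Z [HT' [HZ HZY]]]].
      { intros t Ht. rewrite Hint by exact Ht. apply Rnot_lt_le. intros Hlt.
        apply Hn. exists t. split; assumption. }
      assert (HZ0 : Z 0 = phase_point s f g).
      { rewrite HZY by (unfold Ico; lra).
        exact (solution_initial s alpha beta gamma nu f g _ u v Hsol). }
      exists T', (fun t => Syn 1 (fst (Z t))), (fun t => Syn (-1) (snd (Z t))).
      split; [exact HT'|]. split.
      - exact (ode_to_solution s alpha beta gamma nu f g _ Z Hs Hf Hg HZ0 HZ).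
      - intros t Ht x. rewrite (HZY t Ht). unfold Y, phase_point. simpl fst. simpl snd.
        rewrite <- (Hplus_Syn s (u t)) by apply Hsol, Ht.
        rewrite <- (Hminus_Syn s (v t)) by apply Hsol, Ht. split; reflexivity. }
    intros P [M HM]. destruct (Hunb M) as [t [Ht HtM]].
    assert (Hd : 0 < Tstar - t) by lra.
    exists (mkposreal _ Hd). intros r Hr HrT. apply HM.
    change (Rabs (r - Tstar) < Tstar - t) in Hr. apply Rabs_lt_between in Hr.
    apply Rlt_le_trans with (1 := HtM). apply Hmono; lra.
Qed.

Theorem theorem1 :
  forall (alpha beta gamma nu s : R), 1 / 2 < s ->
  exists T : R -> R -> R,
  forall f g : R -> C, Hplus s f -> Hminus s g ->
    0 < T (normH s f) (normH s g) /\
    (exists u v : R -> R -> C,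
       is_solution alpha beta gamma nu s f g
         (Icc (- T (normH s f) (normH s g)) (T (normH s f) (normH s g))) u v /\
       forall u' v' : R -> R -> C,
         is_solution alpha beta gamma nu s f g
           (Icc (- T (normH s f) (normH s g)) (T (normH s f) (normH s g))) u' v' ->
         agree_on
           (Icc (- T (normH s f) (normH s g)) (T (normH s f) (normH s g)))
           u v u' v') /\
    (forall (Tstar : R) (u v : R -> R -> C),
       0 < Tstar ->
       breaks_down alpha beta gamma nu s f g Tstar u v ->
       (forall t, 0 <= t < Tstar -> ex_RInt (wiener_density u v) 0 t) /\
       increases_to_infinity
         (fun t => RInt (wiener_density u v) 0 t) Tstar).
Proof.
  intros alpha beta gamma nu s Hs.
  set (L := fun M => 2 * coef_field_lip s alpha beta gamma nu M).
  assert (HL := flow_field_lipschitz s alpha beta gamma nu Hs : loc_lipschitz _ L).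
  (* The norm of a pair is at most the sum of the norms of its components. *)
  exists (fun a b => ode_time L (a + b)). intros f g Hf Hg.
  set (T := ode_time L (normH s f + normH s g)).
  assert (HT : 0 < T).
  { apply ode_time_pos. apply Rplus_le_le_0_compat; apply sqrt_pos. }
  split; [exact HT|]. split.
  - destruct (ode_exists (flow_field s alpha beta gamma nu) L (normH s f + normH s g)
      (phase_point s f g) HL (flow_field_zero s alpha beta gamma nu)
      (phase_point_norm s f g Hs Hf Hg)) as [y [Hy0 Hy]].
    fold T in Hy.
    exists (fun t => Syn 1 (fst (y t))), (fun t => Syn (-1) (snd (y t))).
    split; [exact (ode_to_solution s alpha beta gamma nu f g _ y Hs Hf Hg Hy0 Hy)|].
    intros u' v' Hsol t Ht x.
    assert (E : y t = phase_point s (u' t) (v' t)).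
    { apply (ode_unique (flow_field s alpha beta gamma nu) L y
        (fun t => phase_point s (u' t) (v' t)) (Icc (- T) T) HL); [| | | |exact Ht].
      - unfold Icc. intros p r Hp Hr. lra.
      - exact Hy.
      - exact (solution_to_ode s alpha beta gamma nu f g _ u' v' Hs Hsol).
      - rewrite Hy0. symmetry. apply (solution_initial s alpha beta gamma nu f g _ u' v' Hsol). }
    rewrite E. simpl fst. simpl snd.
    rewrite <- (Hplus_Syn s (u' t)) by apply Hsol, Ht.
    rewrite <- (Hminus_Syn s (v' t)) by apply Hsol, Ht. split; reflexivity.
  - intros Tstar u v HTs Hbd.
    exact (wiener_criterion s alpha beta gamma nu f g Tstar u v Hs Hf Hg HTs Hbd).
Qed.
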